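(* Let $k$ be any field and let $E$ and $F$ be finite graphs with no sinks. If the adjacency matrices of $E$ and $F$ are strong shift equivalent, then there exist a $kE^0$--$kF^0$-bimodule $M$, a $kF^0$--$kE^0$-bimodule $N$, a positive integer $n$, and bimodule isomorphisms $$\omega_E : M \otimes_{kF^0} N \to (kE^1)^{\otimes n}, \qquad \omega_F : N \otimes_{kE^0} M \to (kF^1)^{\otimes n},$$ $$\sigma_M : kE^1 \otimes_{kE^0} M \to M \otimes_{kF^0} kF^1, \qquad \sigma_N : kF^1 \otimes_{kF^0} N \to N \otimes_{kE^0} kE^1$$ such that $$(\omega_E\otimes \mathrm{id}_{kE^1})\circ(\sigma_M\#\sigma_N)=\nu_n^E\circ(\mathrm{id}_{kE^1}\otimes\omega_E)\quad\text{and}\quad(\omega_F\otimes \mathrm{id}_{kF^1})\circ(\sigma_N\#\sigma_M)=\nu_n^F\circ(\mathrm{id}_{kF^1}\otimes\omega_F).$$ In particular, $L_k(E)$ and $L_k(F)$ are graded Morita equivalent.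
   Context: A (directed) graph $E=(E^0,E^1,s,r)$ consists of a vertex set $E^0$, an edge set $E^1$, and source and range maps $s,r:E^1\to E^0$. It is finite if $E^0$ and $E^1$ are finite; a vertex $v$ is a sink if $s^{-1}(v)=\emptyset$. The adjacency matrix $A_E$ is the $E^0\times E^0$ matrix with $A_E(v,w)=\#\{e\in E^1: s(e)=v,\ r(e)=w\}$. Square matrices $A$ and $B$ (not necessarily of the same size) with entries in $\mathbb{Z}_{\ge 0}$ are elementary strong shift equivalent if there exist rectangular matrices $R$ and $S$ with entries in $\mathbb{Z}_{\ge0}$ such that $A=RS$ and $B=SR$. They are strong shift equivalent if there is a sequence $A_1,\dots,A_N$ of square matrices with entries in $\mathbb{Z}_{\ge 0}$ with $A_1=A$, $A_N=B$, and $A_i$ elementary strong shift equivalent to $A_{i+1}$ for $1\le i\le N-1$. $kE^0$ is the $k$-algebra with $k$-basis $E^0$ and product $vw=\delta_{v,w}v$. $kE^1$ is the $k$-vector space with basis $E^1$, a $kE^0$--$kE^0$-bimodule via $v\cdot e=\delta_{v,s(e)}e$ and $e\cdot w=\delta_{w,r(e)}e$. $(kE^1)^{\otimes n}$ is the $n$-fold tensor product over $kE^0$ (similarly for $F$). Bimodules over $k$-algebras are unital, and the left and right actions of $k$ agree. For bimodules ${}_RX_S$, ${}_SY_T$, ${}_TZ_U$, $\alpha_{X,Y,Z}:(X\otimes_SY)\otimes_TZ\to X\otimes_S(Y\otimes_TZ)$ is the associativity isomorphism $(x\otimes y)\otimes z\mapsto x\otimes(y\otimes z)$. Operation $\#$: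 let $E,F,G$ be finite graphs with no sinks, $M$ a $kE^0$--$kF^0$-bimodule, $N$ a $kF^0$--$kG^0$-bimodule, and $\sigma:kE^1\otimes_{kE^0}M\to M\otimes_{kF^0}kF^1$, $\psi:kF^1\otimes_{kF^0}N\to N\otimes_{kG^0}kG^1$ bimodule isomorphisms. Then $\sigma\#\psi: kE^1\otimes_{kE^0}(M\otimes_{kF^0}N)\to (M\otimes_{kF^0}N)\otimes_{kG^0}kG^1$ is the bimodule isomorphism $$\sigma\#\psi:=\alpha_{M,N,kG^1}^{-1}\circ(\mathrm{id}_M\otimes\psi)\circ\alpha_{M,kF^1,N}\circ(\sigma\otimes\mathrm{id}_N)\circ\alpha_{kE^1,M,N}^{-1}.$$ For $m\ge 1$, $\nu_m^E: kE^1\otimes_{kE^0}(kE^1)^{\otimes m}\to(kE^1)^{\otimes m}\otimes_{kE^0}kE^1$ is the bimodule isomorphism $x_1\otimes(y_1\otimes\cdots\otimes y_m)\mapsto(x_1\otimes y_1\otimes\cdots\otimes y_{m-1})\otimes y_m$. The Leavitt path algebra $L_k(E)$ of a finite graph with no sinks is the $k$-algebra generated by $\{v: v\in E^0\}\cup\{e,e^*: e\in E^1\}$ subject to: $vu=\delta_{v,u}v$; $s(e)e=er(e)=e$; $r(e)e^*=e^*s(e)=e^*$; $e^*e'=\delta_{e,e'}r(e)$; and $v=\sum_{e\in s^{-1}(v)}ee^*$ for every $v\in E^0$. It is $\mathbb{Z}$-graded with $n$th component spanned by the elements $\alpha\beta^*$ where $\alpha,\beta$ are paths in $E$ with $\ell(\alpha)-\ell(\beta)=n$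 (vertices being paths of length $0$). Graded Morita equivalence: for a $\mathbb{Z}$-graded ring $R$, $\mathsf{Gr}\text{-}R$ is the category of $\mathbb{Z}$-graded right $R$-modules with degree-preserving homomorphisms; for $\gamma\in\mathbb{Z}$, $\Psi_\gamma:\mathsf{Gr}\text{-}R\to\mathsf{Gr}\text{-}R$ sends $M$ to its suspension $M(\gamma)$, $M(\gamma)_g=M_{\gamma+g}$, and is the identity on morphisms. A functor $\Phi:\mathsf{Gr}\text{-}R\to\mathsf{Gr}\text{-}S$ is graded if $\Psi_\gamma(\Phi(M))=\Phi(\Psi_\gamma(M))$ as graded modules for all $M$ and $\gamma$. A functor $\varphi:\mathsf{Mod}\text{-}R\to\mathsf{Mod}\text{-}S$ (categories of right modules) is graded if there is a graded functor $\Phi:\mathsf{Gr}\text{-}R\to\mathsf{Gr}\text{-}S$ with $U_S\circ\Phi=\varphi\circ U_R$, where $U_R,U_S$ are the functors forgetting the grading. $R$ and $S$ are graded Morita equivalent if either of the following two conditions holds (they are known to be equivalent, by a theorem of Hazrat): (geMod) there is a graded functor $\mathsf{Mod}\text{-}R\to\mathsf{Mod}\text{-}S$ that is an equivalence of categories; (geGr) there is a graded functor $\Phi:\mathsf{Gr}\text{-}R\to\mathsf{Gr}\text{-}S$ and a graded functor $\Gamma:\mathsf{Gr}\text{-}S\to\mathsf{Gr}\text{-}R$ such that $\Gamma\circ\Phi$ and $\Phi\circ\Gamma$ are naturally isomorphic to the identity functors. *)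

(* Defs.v *)
From HB Require Import structures.
From mathcomp Require Import all_boot all_order all_algebra.
From mathcomp Require Import boolp classical_sets.

Set Implicit Arguments.
Unset Strict Implicit.
Unset Printing Implicit Defensive.

Import GRing.Theory.

Local Open Scope ring_scope.
Local Open Scope quotient_scope.

(* An algebra is a ring with a ring morphism from k to its center. MathComp's *)
(* lalgType and algType require 1 != 0, which would exclude the zero algebra, *)
(* that is, the graph without vertices.                                       *)
Record kalgebra (k : fieldType) := KAlgebra {
  kalg_ring :> pzRingType;
  kalg_in : {rmorphism k -> kalg_ring};
  kalg_inC : forall c a, kalg_in c * a = a * kalg_in c
}.

Record bimod (k : fieldType) (R S : kalgebra k) := Bimod {
  bimod_sort :> lmodType k;
  lact : R -> bimod_sort -> bimod_sort;
  ract : bimod_sort -> S -> bimod_sort;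
  lactDr : forall a x y, lact a (x + y) = lact a x + lact a y;
  lactDl : forall a b x, lact (a + b) x = lact a x + lact b x;
  lact1 : forall x, lact 1 x = x;
  lactM : forall a b x, lact (a * b) x = lact a (lact b x);
  ractDl : forall x y b, ract (x + y) b = ract x b + ract y b;
  ractDr : forall x a b, ract x (a + b) = ract x a + ract x b;
  ract1 : forall x, ract x 1 = x;
  ractM : forall x a b, ract x (a * b) = ract (ract x a) b;
  lract : forall a x b, lact a (ract x b) = ract (lact a x) b;
  lactZ : forall c x, lact (kalg_in R c) x = c *: x;
  ractZ : forall c x, ract x (kalg_in S c) = c *: x
}.

Section BimodTheory.
Variables (k : fieldType) (R S : kalgebra k) (X : bimod R S).

Lemma lact0r a : lact a (0 : X) = 0.
Proof. by apply: (addrI (lact a 0)); rewrite -lactDr !addr0. Qed.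

Lemma lact0l (x : X) : lact 0 x = 0.
Proof. by apply: (addrI (lact 0 x)); rewrite -lactDl !addr0. Qed.

Lemma ract0l b : ract (0 : X) b = 0.
Proof. by apply: (addrI (ract 0 b)); rewrite -ractDl !addr0. Qed.

Lemma ract0r (x : X) : ract x 0 = 0.
Proof. by apply: (addrI (ract x 0)); rewrite -ractDr !addr0. Qed.

End BimodTheory.

Record bimodHom (k : fieldType) (R S : kalgebra k) (X Y : bimod R S) :=
  BimodHom {
  bhom_fun :> X -> Y;
  bhomD : forall x y, bhom_fun (x + y) = bhom_fun x + bhom_fun y;
  bhomL : forall a x, bhom_fun (lact a x) = lact a (bhom_fun x);
  bhomR : forall x b, bhom_fun (ract x b) = ract (bhom_fun x) b
}.

Record bimodIso (k : fieldType) (R S : kalgebra k) (X Y : bimod R S) :=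
  BimodIso {
  biso_hom :> bimodHom X Y;
  biso_inv : Y -> X;
  biso_K : cancel biso_hom biso_inv;
  biso_VK : cancel biso_inv biso_hom
}.

Section BimodHomTheory.
Variables (k : fieldType) (R S : kalgebra k).
Implicit Types X Y Z : bimod R S.

Lemma bhom0 X Y (f : bimodHom X Y) : f 0 = 0.
Proof. by apply: (addrI (f 0)); rewrite -bhomD !addr0. Qed.

Definition bhom_id X : bimodHom X X :=
  @BimodHom _ _ _ X X id (fun _ _ => erefl) (fun _ _ => erefl)
    (fun _ _ => erefl).

Definition biso_id X : bimodIso X X :=
  @BimodIso _ _ _ X X (bhom_id X) id (fun _ => erefl) (fun _ => erefl).

Section Comp.
Variables (X Y Z : bimod R S).

Definition bhom_comp (g : bimodHom Y Z) (f : bimodHom X Y) : bimodHom X Z.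
Proof.
apply: (@BimodHom _ _ _ X Z (g \o f)) => [x y|a x|x b] /=.
- by rewrite !bhomD.
- by rewrite !bhomL.
- by rewrite !bhomR.
Defined.

Definition biso_comp (g : bimodIso Y Z) (f : bimodIso X Y) : bimodIso X Z :=
  @BimodIso _ _ _ X Z (bhom_comp g f) (biso_inv f \o biso_inv g)
    (can_comp (biso_K g) (biso_K f)) (can_comp (biso_VK f) (biso_VK g)).

Definition bhom_inv (f : bimodIso X Y) : bimodHom Y X.
Proof.
apply: (@BimodHom _ _ _ Y X (biso_inv f)) => [x y|a x|x b];
  apply: (can_inj (biso_K f)).
- by rewrite bhomD !biso_VK.
- by rewrite bhomL !biso_VK.
- by rewrite bhomR !biso_VK.
Defined.

Definition biso_sym (f : bimodIso X Y) : bimodIso Y X :=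
  @BimodIso _ _ _ Y X (bhom_inv f) f (biso_VK f) (biso_K f).

End Comp.
End BimodHomTheory.

Section Tensor.
Variables (k : fieldType) (R S T : kalgebra k).
Variables (X : bimod R S) (Y : bimod S T).

(* The list [:: (x1, y1); ..; (xm, ym)] stands for the formal sum             *)
(* x1 (x) y1 + .. + xm (x) ym. No signs or coefficients are needed, since     *)
(* -(x (x) y) = (- x) (x) y and c (x (x) y) = (c x) (x) y.                   *)
Inductive tens_eq : seq (X * Y) -> seq (X * Y) -> Prop :=
| tens_eq_refl s : tens_eq s s
| tens_eq_sym s t : tens_eq s t -> tens_eq t s
| tens_eq_trans s t u : tens_eq s t -> tens_eq t u -> tens_eq s u
| tens_eq_cat s s' t t' :
    tens_eq s s' -> tens_eq t t' -> tens_eq (s ++ t) (s' ++ t')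
| tens_eq_catC s t : tens_eq (s ++ t) (t ++ s)
| tens_eq_addl x x' y : tens_eq [:: (x + x', y)] [:: (x, y); (x', y)]
| tens_eq_addr x y y' : tens_eq [:: (x, y + y')] [:: (x, y); (x, y')]
| tens_eq_bal x b y : tens_eq [:: (ract x b, y)] [:: (x, lact b y)]
| tens_eq_0 : tens_eq [:: (0, 0)] [::].

Definition tens_rel : rel (seq (X * Y)) := fun s t => `[< tens_eq s t >].

Lemma tens_rel_refl : reflexive tens_rel.
Proof. by move=> s; apply/asboolP; constructor. Qed.

Lemma tens_rel_sym : symmetric tens_rel.
Proof. by move=> s t; apply/asboolP/asboolP => h; apply: tens_eq_sym. Qed.

Lemma tens_rel_trans : transitive tens_rel.
Proof.
move=> t s u /asboolP h1 /asboolP h2; apply/asboolP.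
exact: tens_eq_trans h1 h2.
Qed.

Canonical tens_equiv := EquivRel tens_rel tens_rel_refl tens_rel_sym
  tens_rel_trans.

Definition tens : Type := {eq_quot tens_rel}.
HB.instance Definition _ := Choice.on tens.

Definition tens_pi (s : seq (X * Y)) : tens := \pi_{eq_quot tens_rel} s.
Definition tens_repr (t : tens) : seq (X * Y) :=
  repr (t : {eq_quot tens_rel}).

Lemma tens_reprK t : tens_pi (tens_repr t) = t.
Proof. exact: reprK. Qed.

Lemma tens_piP s t : tens_pi s = tens_pi t <-> tens_eq s t.
Proof.
split=> [h|h].
  have /eqmodP : s = t %[mod {eq_quot tens_rel}] by exact: h.
  by move=> /asboolP.
by apply/eqmodP/asboolP.
Qed.

Lemma tens_reprP s : tens_eq (tens_repr (tens_pi s)) s.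
Proof. by apply/tens_piP; rewrite tens_reprK. Qed.

Definition tens_amap (f : X -> X) (g : Y -> Y) (s : seq (X * Y)) :=
  [seq (f p.1, g p.2) | p <- s].

Lemma tens_amapP f g s t :
    {morph f : x y / x + y} -> {morph g : x y / x + y} ->
    (forall x b y, tens_eq [:: (f (ract x b), g y)] [:: (f x, g (lact b y))]) ->
  tens_eq s t -> tens_eq (tens_amap f g s) (tens_amap f g t).
Proof.
move=> fD gD fg; have f0 : f 0 = 0.
  by apply: (addrI (f 0)); rewrite -fD !addr0.
have g0 : g 0 = 0 by apply: (addrI (g 0)); rewrite -gD !addr0.
elim=> {s t} /= [s|s t _|s t u _ + _|s s' t t' _ + _|s t|x x' y|x y y'|x b y|].
- exact: tens_eq_refl.
- exact: tens_eq_sym.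
- exact: tens_eq_trans.
- by rewrite /tens_amap !map_cat; apply: tens_eq_cat.
- by rewrite /tens_amap !map_cat; apply: tens_eq_catC.
- by rewrite fD; apply: tens_eq_addl.
- by rewrite gD; apply: tens_eq_addr.
- exact: fg.
- by rewrite f0 g0; apply: tens_eq_0.
Qed.

Definition tens_zero : tens := tens_pi [::].
Definition tens_add (t u : tens) : tens := tens_pi (tens_repr t ++ tens_repr u).
Definition tens_lact (a : R) (t : tens) : tens :=
  tens_pi (tens_amap (lact a) id (tens_repr t)).
Definition tens_ract (t : tens) (b : T) : tens :=
  tens_pi (tens_amap id (fun y => ract y b) (tens_repr t)).
Definition tens_opp (t : tens) : tens := tens_lact (- 1) t.

Lemma tens_pi_cat s t : tens_pi (s ++ t) = tens_add (tens_pi s) (tens_pi t).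
Proof.
by apply/tens_piP/tens_eq_cat; apply/tens_eq_sym/tens_reprP.
Qed.

Lemma tens_lact_pi a s :
  tens_lact a (tens_pi s) = tens_pi (tens_amap (lact a) id s).
Proof.
apply/tens_piP/tens_amapP => //; last exact: tens_reprP.
- by move=> x y; rewrite lactDr.
- by move=> x b y; rewrite lract; apply: tens_eq_bal.
Qed.

Lemma tens_ract_pi s b :
  tens_ract (tens_pi s) b = tens_pi (tens_amap id (fun y => ract y b) s).
Proof.
apply/tens_piP/tens_amapP => //; last exact: tens_reprP.
- by move=> x y; rewrite ractDl.
- by move=> x b' y; rewrite -lract; apply: tens_eq_bal.
Qed.

Lemma tens_addC : commutative tens_add.
Proof. by move=> t u; apply/tens_piP/tens_eq_catC. Qed.

Lemma tens_addA : associative tens_add.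
Proof.
move=> t u v; rewrite -[t]tens_reprK -[u]tens_reprK -[v]tens_reprK.
by rewrite -!tens_pi_cat catA.
Qed.

Lemma tens_add0 : left_id tens_zero tens_add.
Proof. by move=> t; rewrite -[t]tens_reprK -tens_pi_cat. Qed.

Lemma tens_eq0l y : tens_eq [:: (0, y)] [::].
Proof.
rewrite -[X in (X, _)](ract0l X 0).
by apply: tens_eq_trans (tens_eq_bal _ _ _) _; rewrite lact0l; apply: tens_eq_0.
Qed.

Lemma tens_addN : left_inverse tens_zero tens_opp tens_add.
Proof.
move=> t; rewrite -[t]tens_reprK /tens_opp tens_lact_pi.
elim: (tens_repr t) => [|p s IHs]; first by rewrite -tens_pi_cat.
have swap A B C D : tens_add (tens_add A B) (tens_add C D) =
    tens_add (tens_add A C) (tens_add B D).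
  by rewrite -!tens_addA (tens_addA B) (tens_addC B) -tens_addA.
rewrite [tens_amap _ _ _]/= -cat1s -(cat1s p) !tens_pi_cat swap IHs.
rewrite -[X in tens_add X _]tens_pi_cat.
have -> : tens_pi ([:: (lact (- 1) p.1, p.2)] ++ [:: p]) = tens_zero.
  case: p => x y /=; apply/tens_piP.
  apply: tens_eq_trans (tens_eq_sym (tens_eq_addl _ _ _)) _.
  by rewrite -[X in _ + X]lact1 -lactDl addNr lact0l; apply: tens_eq0l.
by rewrite tens_add0.
Qed.

HB.instance Definition _ := GRing.isZmodule.Build tens
  tens_addA tens_addC tens_add0 tens_addN.

Lemma tens_piD s t : tens_pi (s ++ t) = tens_pi s + tens_pi t.
Proof. exact: tens_pi_cat. Qed.

Definition tpure (x : X) (y : Y) : tens := tens_pi [:: (x, y)].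

Lemma tens_piE s : tens_pi s = \sum_(p <- s) tpure p.1 p.2.
Proof.
elim: s => [|[x y] s IHs]; first by rewrite big_nil.
by rewrite big_cons -cat1s tens_piD IHs.
Qed.

Lemma tens_sum t : t = \sum_(p <- tens_repr t) tpure p.1 p.2.
Proof. by rewrite -tens_piE tens_reprK. Qed.

Lemma tens_ind (P : tens -> Prop) :
  P 0 -> (forall x y t, P t -> P (tpure x y + t)) -> forall t, P t.
Proof.
move=> P0 PD t; rewrite (tens_sum t); elim: tens_repr => [|[x y] s IHs].
  by rewrite big_nil.
by rewrite big_cons; apply: PD.
Qed.

Lemma tpureDl x x' y : tpure (x + x') y = tpure x y + tpure x' y.
Proof. by rewrite /tpure -tens_piD; apply/tens_piP/tens_eq_addl. Qed.

Lemma tpureDr x y y' : tpure x (y + y') = tpure x y + tpure x y'.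
Proof. by rewrite /tpure -tens_piD; apply/tens_piP/tens_eq_addr. Qed.

Lemma tpure_bal x b y : tpure (ract x b) y = tpure x (lact b y).
Proof. by apply/tens_piP/tens_eq_bal. Qed.

Lemma tens_lact_pure a x y : tens_lact a (tpure x y) = tpure (lact a x) y.
Proof. by rewrite /tpure tens_lact_pi. Qed.

Lemma tens_ract_pure x y b : tens_ract (tpure x y) b = tpure x (ract y b).
Proof. by rewrite /tpure tens_ract_pi. Qed.

Lemma tens_lactD a : {morph tens_lact a : t u / t + u}.
Proof.
move=> t u; rewrite -[t]tens_reprK -[u]tens_reprK -tens_piD !tens_lact_pi.
by rewrite /tens_amap map_cat tens_piD.
Qed.

Lemma tens_ractD b : {morph tens_ract^~ b : t u / t + u}.
Proof.
move=> t u; rewrite -[t]tens_reprK -[u]tens_reprK -tens_piD !tens_ract_pi.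
by rewrite /tens_amap map_cat tens_piD.
Qed.

Lemma tens_lact0 a : tens_lact a 0 = 0.
Proof. by apply: (addrI (tens_lact a 0)); rewrite -tens_lactD !addr0. Qed.

Lemma tens_ract0 b : tens_ract 0 b = 0.
Proof. by apply: (addrI (tens_ract 0 b)); rewrite -tens_ractD !addr0. Qed.

Lemma tens_lactDl a b t : tens_lact (a + b) t = tens_lact a t + tens_lact b t.
Proof.
elim/tens_ind: t => [|x y t IHt]; first by rewrite !tens_lact0 addr0.
by rewrite !tens_lactD IHt !tens_lact_pure lactDl tpureDl addrACA.
Qed.

Lemma tens_lact1 t : tens_lact 1 t = t.
Proof.
elim/tens_ind: t => [|x y t IHt]; first by rewrite tens_lact0.
by rewrite tens_lactD IHt tens_lact_pure lact1.
Qed.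

Lemma tens_lactM a b t : tens_lact (a * b) t = tens_lact a (tens_lact b t).
Proof.
elim/tens_ind: t => [|x y t IHt]; first by rewrite !tens_lact0.
by rewrite !tens_lactD IHt !tens_lact_pure lactM.
Qed.

Lemma tens_ractDr t a b : tens_ract t (a + b) = tens_ract t a + tens_ract t b.
Proof.
elim/tens_ind: t => [|x y t IHt]; first by rewrite !tens_ract0 addr0.
by rewrite !tens_ractD IHt !tens_ract_pure ractDr tpureDr addrACA.
Qed.

Lemma tens_ract1 t : tens_ract t 1 = t.
Proof.
elim/tens_ind: t => [|x y t IHt]; first by rewrite tens_ract0.
by rewrite tens_ractD IHt tens_ract_pure ract1.
Qed.

Lemma tens_ractM t a b : tens_ract t (a * b) = tens_ract (tens_ract t a) b.
Proof.
elim/tens_ind: t => [|x y t IHt]; first by rewrite !tens_ract0.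
by rewrite !tens_ractD IHt !tens_ract_pure ractM.
Qed.

Lemma tens_lract a t b :
  tens_lact a (tens_ract t b) = tens_ract (tens_lact a t) b.
Proof.
elim/tens_ind: t => [|x y t IHt].
  by rewrite !(tens_lact0, tens_ract0).
by rewrite !(tens_lactD, tens_ractD) IHt !(tens_lact_pure, tens_ract_pure).
Qed.

Definition tens_scale (c : k) (t : tens) : tens := tens_lact (kalg_in R c) t.

Lemma tens_scaleA a b t : tens_scale a (tens_scale b t) = tens_scale (a * b) t.
Proof. by rewrite /tens_scale rmorphM tens_lactM. Qed.

Lemma tens_scale1 : left_id 1 tens_scale.
Proof. by move=> t; rewrite /tens_scale rmorph1 tens_lact1. Qed.

Lemma tens_scaleDr : right_distributive tens_scale +%R.
Proof. by move=> c t u; apply: tens_lactD. Qed.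

Lemma tens_scaleDl t : {morph tens_scale^~ t : a b / a + b}.
Proof. by move=> a b; rewrite /tens_scale rmorphD tens_lactDl. Qed.

HB.instance Definition _ := GRing.Zmodule_isLmodule.Build k tens
  tens_scaleA tens_scale1 tens_scaleDr tens_scaleDl.

Lemma tens_lactZ c t : tens_lact (kalg_in R c) t = c *: t.
Proof. by []. Qed.

Lemma tens_ractZ c t : tens_ract t (kalg_in T c) = c *: t.
Proof.
rewrite -tens_lactZ; elim/tens_ind: t => [|x y t IHt].
  by rewrite tens_lact0 tens_ract0.
rewrite tens_lactD tens_ractD IHt tens_lact_pure tens_ract_pure.
by rewrite ractZ lactZ -(ractZ c x) tpure_bal lactZ.
Qed.

Definition tensB : bimod R T :=
  @Bimod k R T tens tens_lact tens_ract tens_lactD tens_lactDl tens_lact1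
    tens_lactM (fun x y b => tens_ractD b x y) tens_ractDr tens_ract1
    tens_ractM tens_lract tens_lactZ tens_ractZ.

Section Lift.
Variables (V : zmodType) (f : X -> Y -> V).
Hypothesis fDl : forall x x' y, f (x + x') y = f x y + f x' y.
Hypothesis fDr : forall x y y', f x (y + y') = f x y + f x y'.
Hypothesis f_bal : forall x b y, f (ract x b) y = f x (lact b y).

Definition tens_lift (t : tens) : V := \sum_(p <- tens_repr t) f p.1 p.2.

Lemma tens_lift_pi s : tens_lift (tens_pi s) = \sum_(p <- s) f p.1 p.2.
Proof.
suff sumP u v : tens_eq u v ->
    \sum_(p <- u) f p.1 p.2 = \sum_(p <- v) f p.1 p.2.
  exact: sumP (tens_reprP s).
elim=> {s u v}
  [s|s t _ ->|s t u _ -> _ ->|s s' t t' _ IHs _ IHt|s t|x x' y|x y y'|x b y|] //.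
- by rewrite !big_cat /= IHs IHt.
- by rewrite !big_cat /= addrC.
- by rewrite !big_cons !big_nil /= !addr0 fDl.
- by rewrite !big_cons !big_nil /= !addr0 fDr.
- by rewrite !big_cons !big_nil /= !addr0 f_bal.
- rewrite big_cons !big_nil /= addr0.
  by apply: (addrI (f 0 0)); rewrite -fDl !addr0.
Qed.

Lemma tens_lift_pure x y : tens_lift (tpure x y) = f x y.
Proof. by rewrite tens_lift_pi big_cons big_nil addr0. Qed.

Lemma tens_liftD : {morph tens_lift : t u / t + u}.
Proof.
move=> t u; rewrite -[t]tens_reprK -[u]tens_reprK -tens_piD !tens_lift_pi.
by rewrite big_cat.
Qed.

End Lift.

Lemma tens_ext (V : zmodType) (f g : tens -> V) :
    {morph f : t u / t + u} -> {morph g : t u / t + u} ->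
  (forall x y, f (tpure x y) = g (tpure x y)) -> f =1 g.
Proof.
move=> fD gD fg; have f0 : f 0 = 0 by apply: (addrI (f 0)); rewrite -fD !addr0.
have g0 : g 0 = 0 by apply: (addrI (g 0)); rewrite -gD !addr0.
by elim/tens_ind => [|x y t IHt]; rewrite ?f0 ?g0 // fD gD fg IHt.
Qed.

End Tensor.

Arguments tensB {k R S T} X Y.
Arguments tens_lift {k R S T X Y V} f t.

Notation "X \ox Y" := (tensB X Y) (at level 40, left associativity).

Section TensorMaps.
Variable k : fieldType.
Implicit Types R S T U : kalgebra k.

Section Map.
Variables (R S T : kalgebra k) (X X' : bimod R S) (Y Y' : bimod S T).
Variables (f : bimodHom X X') (g : bimodHom Y Y').

Let fg (x : X) (y : Y) : X' \ox Y' := tpure (f x) (g y).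

Let fgDl x x' y : fg (x + x') y = fg x y + fg x' y.
Proof. by rewrite /fg bhomD tpureDl. Qed.

Let fgDr x y y' : fg x (y + y') = fg x y + fg x y'.
Proof. by rewrite /fg bhomD tpureDr. Qed.

Let fg_bal x b y : fg (ract x b) y = fg x (lact b y).
Proof. by rewrite /fg bhomR bhomL tpure_bal. Qed.

Lemma tens_map_pure x y : tens_lift fg (tpure x y) = tpure (f x) (g y).
Proof. exact: tens_lift_pure. Qed.

Definition tens_map : bimodHom (X \ox Y) (X' \ox Y').
Proof.
apply: (@BimodHom _ _ _ (X \ox Y) (X' \ox Y') (tens_lift fg)).
- exact: tens_liftD.
- move=> a; apply: tens_ext => [t u|t u|x y] /=.
  + by rewrite tens_lactD tens_liftD.
  + by rewrite tens_liftD // tens_lactD.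
  + by rewrite tens_lact_pure !tens_map_pure tens_lact_pure bhomL.
- move=> + b; apply: tens_ext => [t u|t u|x y] /=.
  + by rewrite tens_ractD tens_liftD.
  + by rewrite tens_liftD // tens_ractD.
  + by rewrite tens_ract_pure !tens_map_pure tens_ract_pure bhomR.
Defined.

Lemma tens_mapE x y : tens_map (tpure x y) = tpure (f x) (g y).
Proof. exact: tens_map_pure. Qed.

End Map.

Definition tens_iso R S T (X X' : bimod R S) (Y Y' : bimod S T)
    (f : bimodIso X X') (g : bimodIso Y Y') :
  bimodIso (X \ox Y) (X' \ox Y').
Proof.
apply: (@BimodIso _ _ _ (X \ox Y) (X' \ox Y') (tens_map f g)
  (tens_map (biso_sym f) (biso_sym g))).
- apply: tens_ext => [t u|//|x y]; first by rewrite !bhomD.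
  by rewrite !tens_mapE /= !biso_K.
- apply: tens_ext => [t u|//|x y]; first by rewrite !bhomD.
  by rewrite !tens_mapE /= !biso_VK.
Defined.

Section Assoc.
Variables (R S T U : kalgebra k).
Variables (X : bimod R S) (Y : bimod S T) (Z : bimod T U).

Let lr (z : Z) (x : X) (y : Y) : X \ox (Y \ox Z) :=
  tpure x (tpure y z : Y \ox Z).

Let lrDl z x x' y : lr z (x + x') y = lr z x y + lr z x' y.
Proof. exact: tpureDl. Qed.

Let lrDr z x y y' : lr z x (y + y') = lr z x y + lr z x y'.
Proof. by rewrite /lr tpureDl tpureDr. Qed.

Let lr_bal z x b y : lr z (ract x b) y = lr z x (lact b y).
Proof. by rewrite /lr tpure_bal /= tens_lact_pure. Qed.

Let assocf (t : X \ox Y) (z : Z) : X \ox (Y \ox Z) := tens_lift (lr z) t.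

Let assocfDl t t' z : assocf (t + t') z = assocf t z + assocf t' z.
Proof. exact: tens_liftD. Qed.

Let assocfE x y z : assocf (tpure x y) z = lr z x y.
Proof. exact: tens_lift_pure. Qed.

Let assocfDr t z z' : assocf t (z + z') = assocf t z + assocf t z'.
Proof.
apply: (@tens_ext _ _ _ _ X Y _ (assocf^~ (z + z'))
  (fun t => assocf t z + assocf t z')) => [u v|u v|x y].
- by rewrite assocfDl.
- by rewrite !assocfDl addrACA.
- by rewrite !assocfE /lr !tpureDr.
Qed.

Let assocf_bal t b z : assocf (ract t b) z = assocf t (lact b z).
Proof.
apply: (@tens_ext _ _ _ _ X Y _ (fun t : X \ox Y => assocf (ract t b) z)
  (fun t => assocf t (lact b z))) => [u v|u v|x y].
- by rewrite ractDl assocfDl.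
- by rewrite assocfDl.
- by rewrite /= tens_ract_pure !assocfE /lr tpure_bal.
Qed.

Lemma assoc_pure x y z :
  tens_lift assocf (tpure (tpure x y : X \ox Y) z) =
  tpure x (tpure y z : Y \ox Z).
Proof.
transitivity (assocf (tpure x y) z); first exact: tens_lift_pure.
exact: assocfE.
Qed.

Definition assoc_hom : bimodHom ((X \ox Y) \ox Z) (X \ox (Y \ox Z)).
Proof.
apply: (@BimodHom _ _ _ ((X \ox Y) \ox Z) (X \ox (Y \ox Z))
  (tens_lift assocf)).
- exact: tens_liftD.
- move=> a t; elim/tens_ind: t => [|t z u IHu].
    by rewrite lact0r -[0]/(tens_pi [::]) tens_lift_pi // big_nil lact0r.
  rewrite lactDr !tens_liftD // lactDr IHu; congr (_ + _).
  rewrite /= tens_lact_pure.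
  elim/tens_ind: t => [|x y v IHv].
    rewrite lact0r; have -> : tpure (0 : X \ox Y) z = 0.
      by apply: (addrI (tpure 0 z)); rewrite -tpureDl !addr0.
    by rewrite -[0]/(tens_pi [::]) tens_lift_pi // big_nil tens_lact0.
  rewrite lactDr !tpureDl !tens_liftD // tens_lactD IHv; congr (_ + _).
  by rewrite /= tens_lact_pure !assoc_pure tens_lact_pure.
- move=> t b; elim/tens_ind: t => [|t z u IHu].
    by rewrite ract0l -[0]/(tens_pi [::]) tens_lift_pi // big_nil ract0l.
  rewrite ractDl !tens_liftD // ractDl IHu; congr (_ + _).
  rewrite /= tens_ract_pure.
  elim/tens_ind: t => [|x y v IHv].
    have t0 z' : tpure (0 : X \ox Y) z' = 0.
      by apply: (addrI (tpure 0 z')); rewrite -tpureDl !addr0.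
    rewrite !t0.
    by rewrite -[0]/(tens_pi [::]) tens_lift_pi // big_nil tens_ract0.
  rewrite !tpureDl !tens_liftD // tens_ractD IHv; congr (_ + _).
  by rewrite /= !assoc_pure tens_ract_pure /= tens_ract_pure.
Defined.

Let rl (x : X) (y : Y) (z : Z) : (X \ox Y) \ox Z :=
  tpure (tpure x y : X \ox Y) z.

Let rlDl x y y' z : rl x (y + y') z = rl x y z + rl x y' z.
Proof. by rewrite /rl tpureDr tpureDl. Qed.

Let rlDr x y z z' : rl x y (z + z') = rl x y z + rl x y z'.
Proof. exact: tpureDr. Qed.

Let rl_bal x y b z : rl x (ract y b) z = rl x y (lact b z).
Proof. by rewrite /rl -tpure_bal /= tens_ract_pure. Qed.

Let assocg (x : X) (t : Y \ox Z) : (X \ox Y) \ox Z := tens_lift (rl x) t.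

Let assocgDr x t t' : assocg x (t + t') = assocg x t + assocg x t'.
Proof. exact: tens_liftD. Qed.

Let assocgE x y z : assocg x (tpure y z) = rl x y z.
Proof. exact: tens_lift_pure. Qed.

Let assocgDl x x' t : assocg (x + x') t = assocg x t + assocg x' t.
Proof.
apply: (@tens_ext _ _ _ _ Y Z _ (assocg (x + x'))
  (fun t => assocg x t + assocg x' t)) => [u v|u v|y z].
- by rewrite assocgDr.
- by rewrite !assocgDr addrACA.
- by rewrite !assocgE /rl !tpureDl.
Qed.

Let assocg_bal x b t : assocg (ract x b) t = assocg x (lact b t).
Proof.
apply: (@tens_ext _ _ _ _ Y Z _ (assocg (ract x b))
  (fun t : Y \ox Z => assocg x (lact b t))) => [u v|u v|y z].
- by rewrite assocgDr.
- by rewrite lactDr assocgDr.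
- by rewrite /= tens_lact_pure !assocgE /rl tpure_bal.
Qed.

Lemma assocV_pure x y z :
  tens_lift assocg (tpure x (tpure y z : Y \ox Z)) =
  tpure (tpure x y : X \ox Y) z.
Proof.
transitivity (assocg x (tpure y z)); first exact: tens_lift_pure.
exact: assocgE.
Qed.

Let assocgD : {morph tens_lift assocg : t u / t + u}.
Proof. exact: tens_liftD. Qed.

Definition assoc : bimodIso ((X \ox Y) \ox Z) (X \ox (Y \ox Z)).
Proof.
apply: (@BimodIso _ _ _ ((X \ox Y) \ox Z) (X \ox (Y \ox Z)) assoc_hom
  (tens_lift assocg)).
- apply: tens_ext => [t u|//|t z]; first by rewrite bhomD assocgD.
  move: t; apply: (@tens_ext _ _ _ _ X Y ((X \ox Y) \ox Z)
    (fun t : X \ox Y => tens_lift assocg (assoc_hom (tpure t z)))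
    (fun t : X \ox Y => tpure t z)).
  + by move=> u v; rewrite tpureDl bhomD assocgD.
  + by move=> u v; rewrite tpureDl.
  + by move=> x y; rewrite /= assoc_pure assocV_pure.
- apply: tens_ext => [t u|//|x t]; first by rewrite assocgD bhomD.
  move: t; apply: (@tens_ext _ _ _ _ Y Z (X \ox (Y \ox Z))
    (fun t : Y \ox Z => assoc_hom (tens_lift assocg (tpure x t)))
    (fun t : Y \ox Z => tpure x t)).
  + by move=> u v; rewrite tpureDr assocgD bhomD.
  + by move=> u v; rewrite tpureDr.
  + by move=> y z; rewrite assocV_pure /= assoc_pure.
Defined.

Lemma assocE x y z :
  assoc (tpure (tpure x y : X \ox Y) z) = tpure x (tpure y z : Y \ox Z).
Proof. exact: assoc_pure. Qed.

Lemma assocVE x y z :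
  biso_sym assoc (tpure x (tpure y z : Y \ox Z)) =
  tpure (tpure x y : X \ox Y) z.
Proof. exact: assocV_pure. Qed.

End Assoc.

(* The operation #, for arbitrary endo-bimodules X, Y, Z in place of          *)
(* kE^1, kF^1, kG^1.                                                          *)
Definition sharp R S T (X : bimod R R) (Y : bimod S S) (Z : bimod T T)
    (M : bimod R S) (N : bimod S T)
    (s : bimodIso (X \ox M) (M \ox Y)) (p : bimodIso (Y \ox N) (N \ox Z)) :
  bimodIso (X \ox (M \ox N)) ((M \ox N) \ox Z) :=
  biso_comp (biso_sym (assoc M N Z))
    (biso_comp (tens_iso (biso_id M) p)
      (biso_comp (assoc M Y N)
        (biso_comp (tens_iso s (biso_id N)) (biso_sym (assoc X M N))))).

Section Powers.
Variables (R : kalgebra k) (X : bimod R R).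

(* tpowS m is the tensor power with m + 1 factors, bracketed to the right *)
Fixpoint tpowS (m : nat) : bimod R R :=
  if m is m'.+1 then X \ox tpowS m' else X.

Fixpoint tpowS_pure (m : nat) : (nat -> X) -> tpowS m :=
  if m is m'.+1 then fun x => tpure (x 0%N) (tpowS_pure m' (fun i => x i.+1))
  else fun x => x 0%N.

(* nuS m is the isomorphism nu_(m+1) *)
Fixpoint nuS (m : nat) : bimodIso (X \ox tpowS m) (tpowS m \ox X) :=
  if m is m'.+1 then
    biso_comp (biso_sym (assoc X (tpowS m') X))
      (tens_iso (biso_id X) (nuS m'))
  else biso_id (X \ox X).

Lemma nuSE m (x : nat -> X) :
  nuS m (tpure (x 0%N) (tpowS_pure m (fun i => x i.+1))) =
  tpure (tpowS_pure m x) (x m.+1).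
Proof.
elim: m x => [//|m IHm] x.
transitivity (biso_sym (assoc X (tpowS m) X)
  (tens_map (bhom_id X) (nuS m) (tpure (x 0%N)
    (tpure (x 1%N) (tpowS_pure m (fun i => x i.+2)) : X \ox tpowS m))));
  first by [].
rewrite tens_mapE (IHm (fun i => x i.+1)); exact: assocV_pure.
Qed.

(* only meant for n > 0 *)
Definition tpow (n : nat) : bimod R R := tpowS n.-1.

Definition nu (n : nat) : bimodIso (X \ox tpow n) (tpow n \ox X) := nuS n.-1.

End Powers.
End TensorMaps.


Record graph := Graph {
  vert : finType;
  edge : finType;
  src : edge -> vert;
  rng : edge -> vert
}.

Definition sink (E : graph) (v : vert E) : Prop :=
  [set e : edge E | src e == v]%SET = finset.set0.

Definition no_sinks (E : graph) : Prop := forall v : vert E, ~ sink v.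

(* the vertices are numbered by enum_val to obtain a matrix over 'I_n *)
Definition adjmx (E : graph) : 'M[nat]_#|vert E| :=
  \matrix_(i, j) #|[set e : edge E |
    (src e == enum_val i) && (rng e == enum_val j)]%SET|.

Definition sqmx : Type := {n : nat & 'M[nat]_n}.

Definition elementary_sse (A B : sqmx) : Prop :=
  exists (R : 'M[nat]_(tag A, tag B)) (S : 'M[nat]_(tag B, tag A)),
    tagged A = R *m S /\ tagged B = S *m R.

Definition strong_shift_equivalent (m n : nat)
    (A : 'M[nat]_m) (B : 'M[nat]_n) : Prop :=
  exists (N : nat) (C : nat -> sqmx),
    [/\ C 0%N = existT (fun p => 'M[nat]_p) m A,
        C N = existT (fun p => 'M[nat]_p) n B
      & forall i, (i < N)%N -> elementary_sse (C i) (C i.+1)].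

Section GraphBimodules.
Variables (k : fieldType) (E : graph).

Definition kE0_in (c : k) : {ffun vert E -> k} := [ffun=> c].

Lemma kE0_in_zmod : zmod_morphism kE0_in.
Proof. by move=> c d; apply/ffunP => v; rewrite !ffunE. Qed.

Lemma kE0_in_monoid : monoid_morphism kE0_in.
Proof. by split=> [|c d]; apply/ffunP => v; rewrite !ffunE. Qed.

HB.instance Definition _ :=
  GRing.isZmodMorphism.Build k {ffun vert E -> k} kE0_in kE0_in_zmod.
HB.instance Definition _ :=
  GRing.isMonoidMorphism.Build k {ffun vert E -> k} kE0_in kE0_in_monoid.

Lemma kE0_inC c a : kE0_in c * a = a * kE0_in c.
Proof. by apply/ffunP => v; rewrite !ffunE mulrC. Qed.

(* k-valued functions on E^0 with the pointwise product; v in E^0 is the      *)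
(* indicator function of v                                                    *)
Definition kE0 : kalgebra k := @KAlgebra k {ffun vert E -> k} kE0_in kE0_inC.

Definition kE0_vert (v : vert E) : kE0 := [ffun w => (w == v)%:R].

Lemma kE0_vertM v w : kE0_vert v * kE0_vert w = kE0_vert v *+ (v == w).
Proof.
apply/ffunP => u; rewrite !ffunE ffunMnE !ffunE.
case: eqVneq => [->|_]; last by rewrite mul0r mul0rn.
by rewrite mul1r; case: eqVneq.
Qed.

Definition kE1_lact (a : kE0) (x : {ffun edge E -> k^o}) :
  {ffun edge E -> k^o} := [ffun e => a (src e) * x e].
Definition kE1_ract (x : {ffun edge E -> k^o}) (b : kE0) :
  {ffun edge E -> k^o} := [ffun e => x e * b (rng e)].

Definition kE1 : bimod kE0 kE0.
Proof.
apply: (@Bimod k kE0 kE0 {ffun edge E -> k^o} kE1_lact kE1_ract).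
- by move=> a x y; apply/ffunP => e; rewrite !ffunE mulrDr.
- by move=> a b x; apply/ffunP => e; rewrite !ffunE mulrDl.
- by move=> x; apply/ffunP => e; rewrite !ffunE mul1r.
- by move=> a b x; apply/ffunP => e; rewrite !ffunE mulrA.
- by move=> x y b; apply/ffunP => e; rewrite !ffunE mulrDl.
- by move=> x a b; apply/ffunP => e; rewrite !ffunE mulrDr.
- by move=> x; apply/ffunP => e; rewrite !ffunE mulr1.
- by move=> x a b; apply/ffunP => e; rewrite !ffunE mulrA.
- by move=> a x b; apply/ffunP => e; rewrite !ffunE mulrA.
- by move=> c x; apply/ffunP => e; rewrite !ffunE.
- by move=> c x; apply/ffunP => e; rewrite !ffunE mulrC.
Defined.

Definition kE1_edge (e : edge E) : kE1 := [ffun f => (f == e)%:R].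

Lemma kE1_lact_edge v e :
  lact (kE0_vert v) (kE1_edge e) = kE1_edge e *+ (v == src e).
Proof.
apply/ffunP => f; rewrite ffunMnE !ffunE /=.
case: (eqVneq f e) => [->|_]; last by rewrite mulr0 mul0rn.
by rewrite mulr1 eq_sym.
Qed.

Lemma kE1_ract_edge e w :
  ract (kE1_edge e) (kE0_vert w) = kE1_edge e *+ (w == rng e).
Proof.
apply/ffunP => f; rewrite ffunMnE !ffunE /=.
case: (eqVneq f e) => [->|_]; last by rewrite mul0r mul0rn.
by rewrite mul1r eq_sym.
Qed.

End GraphBimodules.

Section LeavittPathAlgebra.
Variables (k : fieldType) (E : graph).

(* Noncommutative polynomial expressions without constant term: L_k(E) is     *)
(* presented as an algebra without distinguished unit, and its unit           *)
(* \sum_v v is a consequence of the relations, E^0 being finite.              *)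
Inductive lpa_term : Type :=
| LZero
| LVert of vert E
| LEdge of edge E
| LGhost of edge E
| LAdd of lpa_term & lpa_term
| LScale of k & lpa_term
| LMul of lpa_term & lpa_term.

HB.instance Definition _ := gen_eqMixin lpa_term.
HB.instance Definition _ := gen_choiceMixin lpa_term.

Inductive lpa_eq : lpa_term -> lpa_term -> Prop :=
| lpa_eq_refl x : lpa_eq x x
| lpa_eq_sym x y : lpa_eq x y -> lpa_eq y x
| lpa_eq_trans x y z : lpa_eq x y -> lpa_eq y z -> lpa_eq x z
| lpa_eq_add x x' y y' :
    lpa_eq x x' -> lpa_eq y y' -> lpa_eq (LAdd x y) (LAdd x' y')
| lpa_eq_scale c x x' : lpa_eq x x' -> lpa_eq (LScale c x) (LScale c x')
| lpa_eq_mul x x' y y' :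
    lpa_eq x x' -> lpa_eq y y' -> lpa_eq (LMul x y) (LMul x' y')
| lpa_eq_addA x y z : lpa_eq (LAdd x (LAdd y z)) (LAdd (LAdd x y) z)
| lpa_eq_addC x y : lpa_eq (LAdd x y) (LAdd y x)
| lpa_eq_add0 x : lpa_eq (LAdd LZero x) x
| lpa_eq_addN x : lpa_eq (LAdd (LScale (- 1) x) x) LZero
| lpa_eq_scaleA c d x : lpa_eq (LScale c (LScale d x)) (LScale (c * d) x)
| lpa_eq_scale1 x : lpa_eq (LScale 1 x) x
| lpa_eq_scaleDr c x y :
    lpa_eq (LScale c (LAdd x y)) (LAdd (LScale c x) (LScale c y))
| lpa_eq_scaleDl c d x :
    lpa_eq (LScale (c + d) x) (LAdd (LScale c x) (LScale d x))
| lpa_eq_mulA x y z : lpa_eq (LMul x (LMul y z)) (LMul (LMul x y) z)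
| lpa_eq_mulDl x y z :
    lpa_eq (LMul (LAdd x y) z) (LAdd (LMul x z) (LMul y z))
| lpa_eq_mulDr x y z :
    lpa_eq (LMul x (LAdd y z)) (LAdd (LMul x y) (LMul x z))
| lpa_eq_scaleAl c x y : lpa_eq (LScale c (LMul x y)) (LMul (LScale c x) y)
| lpa_eq_scaleAr c x y : lpa_eq (LScale c (LMul x y)) (LMul x (LScale c y))
| lpa_eq_vert v u :
    lpa_eq (LMul (LVert v) (LVert u)) (if v == u then LVert v else LZero)
| lpa_eq_src_edge e : lpa_eq (LMul (LVert (src e)) (LEdge e)) (LEdge e)
| lpa_eq_edge_rng e : lpa_eq (LMul (LEdge e) (LVert (rng e))) (LEdge e)
| lpa_eq_rng_ghost e : lpa_eq (LMul (LVert (rng e)) (LGhost e)) (LGhost e)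
| lpa_eq_ghost_src e : lpa_eq (LMul (LGhost e) (LVert (src e))) (LGhost e)
| lpa_eq_ck1 e f :
    lpa_eq (LMul (LGhost e) (LEdge f)) (if e == f then LVert (rng e) else LZero)
| lpa_eq_ck2 v :
    lpa_eq (LVert v)
      (\big[LAdd/LZero]_(e | src e == v) LMul (LEdge e) (LGhost e)).

Definition lpa_rel : rel lpa_term := fun x y => `[< lpa_eq x y >].

Lemma lpa_rel_refl : reflexive lpa_rel.
Proof. by move=> x; apply/asboolP; constructor. Qed.

Lemma lpa_rel_sym : symmetric lpa_rel.
Proof. by move=> x y; apply/asboolP/asboolP => h; apply: lpa_eq_sym. Qed.

Lemma lpa_rel_trans : transitive lpa_rel.
Proof.
move=> y x z /asboolP h1 /asboolP h2; apply/asboolP.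
exact: lpa_eq_trans h1 h2.
Qed.

Canonical lpa_equiv := EquivRel lpa_rel lpa_rel_refl lpa_rel_sym lpa_rel_trans.

Definition lpa : Type := {eq_quot lpa_rel}.
HB.instance Definition _ := Choice.on lpa.

Definition lpa_pi (x : lpa_term) : lpa := \pi_{eq_quot lpa_rel} x.
Definition lpa_repr (a : lpa) : lpa_term := repr (a : {eq_quot lpa_rel}).

Lemma lpa_reprK a : lpa_pi (lpa_repr a) = a.
Proof. exact: reprK. Qed.

Lemma lpa_piP x y : lpa_pi x = lpa_pi y <-> lpa_eq x y.
Proof.
split=> [h|h].
  have /eqmodP : x = y %[mod {eq_quot lpa_rel}] by exact: h.
  by move=> /asboolP.
by apply/eqmodP/asboolP.
Qed.

Lemma lpa_reprP x : lpa_eq (lpa_repr (lpa_pi x)) x.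
Proof. by apply/lpa_piP; rewrite lpa_reprK. Qed.

Definition lpa_add (a b : lpa) : lpa := lpa_pi (LAdd (lpa_repr a) (lpa_repr b)).
Definition lpa_scale (c : k) (a : lpa) : lpa := lpa_pi (LScale c (lpa_repr a)).
Definition lpa_mul (a b : lpa) : lpa := lpa_pi (LMul (lpa_repr a) (lpa_repr b)).
Definition lpa_zero : lpa := lpa_pi LZero.
Definition lpa_opp (a : lpa) : lpa := lpa_scale (- 1) a.

Lemma lpa_pi_add x y : lpa_add (lpa_pi x) (lpa_pi y) = lpa_pi (LAdd x y).
Proof. by apply/lpa_piP/lpa_eq_add; apply: lpa_reprP. Qed.

Lemma lpa_pi_scale c x : lpa_scale c (lpa_pi x) = lpa_pi (LScale c x).
Proof. by apply/lpa_piP/lpa_eq_scale; apply: lpa_reprP. Qed.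

Lemma lpa_pi_mul x y : lpa_mul (lpa_pi x) (lpa_pi y) = lpa_pi (LMul x y).
Proof. by apply/lpa_piP/lpa_eq_mul; apply: lpa_reprP. Qed.

Lemma lpa_addA : associative lpa_add.
Proof.
move=> a b c; rewrite -(lpa_reprK a) -(lpa_reprK b) -(lpa_reprK c).
by rewrite !lpa_pi_add; apply/lpa_piP/lpa_eq_addA.
Qed.

Lemma lpa_addC : commutative lpa_add.
Proof. by move=> a b; apply/lpa_piP/lpa_eq_addC. Qed.

Lemma lpa_add0 : left_id lpa_zero lpa_add.
Proof.
by move=> a; rewrite -(lpa_reprK a) lpa_pi_add; apply/lpa_piP/lpa_eq_add0.
Qed.

Lemma lpa_addN : left_inverse lpa_zero lpa_opp lpa_add.
Proof.
move=> a; rewrite -(lpa_reprK a) /lpa_opp lpa_pi_scale lpa_pi_add.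
exact/lpa_piP/lpa_eq_addN.
Qed.

HB.instance Definition _ := GRing.isZmodule.Build lpa
  lpa_addA lpa_addC lpa_add0 lpa_addN.

Lemma lpa_scaleA c d a : lpa_scale c (lpa_scale d a) = lpa_scale (c * d) a.
Proof.
rewrite -(lpa_reprK a) !lpa_pi_scale; exact/lpa_piP/lpa_eq_scaleA.
Qed.

Lemma lpa_scale1 : left_id 1 lpa_scale.
Proof.
by move=> a; rewrite -(lpa_reprK a) lpa_pi_scale; apply/lpa_piP/lpa_eq_scale1.
Qed.

Lemma lpa_scaleDr : right_distributive lpa_scale +%R.
Proof.
move=> c a b; rewrite -[+%R]/lpa_add -(lpa_reprK a) -(lpa_reprK b).
by rewrite !(lpa_pi_add, lpa_pi_scale); apply/lpa_piP/lpa_eq_scaleDr.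
Qed.

Lemma lpa_scaleDl a : {morph lpa_scale^~ a : c d / c + d}.
Proof.
move=> c d; rewrite -[RHS]/(lpa_add _ _) -(lpa_reprK a).
by rewrite !(lpa_pi_add, lpa_pi_scale); apply/lpa_piP/lpa_eq_scaleDl.
Qed.

HB.instance Definition _ := GRing.Zmodule_isLmodule.Build k lpa
  lpa_scaleA lpa_scale1 lpa_scaleDr lpa_scaleDl.

Lemma lpa_mulA : associative lpa_mul.
Proof.
move=> a b c; rewrite -(lpa_reprK a) -(lpa_reprK b) -(lpa_reprK c).
by rewrite !lpa_pi_mul; apply/lpa_piP/lpa_eq_mulA.
Qed.

Lemma lpa_mulDl : left_distributive lpa_mul +%R.
Proof.
move=> a b c; rewrite -[+%R]/lpa_add.
rewrite -(lpa_reprK a) -(lpa_reprK b) -(lpa_reprK c).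
by rewrite !(lpa_pi_add, lpa_pi_mul); apply/lpa_piP/lpa_eq_mulDl.
Qed.

Lemma lpa_mulDr : right_distributive lpa_mul +%R.
Proof.
move=> a b c; rewrite -[+%R]/lpa_add.
rewrite -(lpa_reprK a) -(lpa_reprK b) -(lpa_reprK c).
by rewrite !(lpa_pi_add, lpa_pi_mul); apply/lpa_piP/lpa_eq_mulDr.
Qed.

Lemma lpa_scaleAl c a b : c *: lpa_mul a b = lpa_mul (c *: a) b.
Proof.
rewrite -[LHS]/(lpa_scale _ _) -[c *: a]/(lpa_scale c a).
rewrite -(lpa_reprK a) -(lpa_reprK b).
by rewrite !(lpa_pi_scale, lpa_pi_mul); apply/lpa_piP/lpa_eq_scaleAl.
Qed.

Lemma lpa_scaleAr c a b : c *: lpa_mul a b = lpa_mul a (c *: b).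
Proof.
rewrite -[LHS]/(lpa_scale _ _) -[c *: b]/(lpa_scale c b).
rewrite -(lpa_reprK a) -(lpa_reprK b).
by rewrite !(lpa_pi_scale, lpa_pi_mul); apply/lpa_piP/lpa_eq_scaleAr.
Qed.

Definition lpa_vert (v : vert E) : lpa := lpa_pi (LVert v).
Definition lpa_edge (e : edge E) : lpa := lpa_pi (LEdge e).
Definition lpa_ghost (e : edge E) : lpa := lpa_pi (LGhost e).

Definition lpa_one : lpa := \sum_v lpa_vert v.

Lemma lpa_ind (P : lpa -> Prop) :
    P 0 -> (forall v, P (lpa_vert v)) -> (forall e, P (lpa_edge e)) ->
    (forall e, P (lpa_ghost e)) -> (forall a b, P a -> P b -> P (a + b)) ->
    (forall c a, P a -> P (c *: a)) ->
    (forall a b, P a -> P b -> P (lpa_mul a b)) ->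
  forall a, P a.
Proof.
move=> P0 Pv Pe Pg PD PZ PM a; rewrite -(lpa_reprK a).
elim: (lpa_repr a) => {a} [|v|e|e|x IHx y IHy|c x IHx|x IHx y IHy] //.
- exact: Pv.
- exact: Pe.
- exact: Pg.
- by rewrite -lpa_pi_add; apply: PD.
- by rewrite -lpa_pi_scale; apply: PZ.
- by rewrite -lpa_pi_mul; apply: PM.
Qed.

Lemma lpa_mul0l a : lpa_mul 0 a = 0.
Proof. by apply: (addrI (lpa_mul 0 a)); rewrite -lpa_mulDl !addr0. Qed.

Lemma lpa_mul0r a : lpa_mul a 0 = 0.
Proof. by apply: (addrI (lpa_mul a 0)); rewrite -lpa_mulDr !addr0. Qed.

Lemma lpa_mul_vert v u :
  lpa_mul (lpa_vert v) (lpa_vert u) = lpa_vert v *+ (v == u).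
Proof.
rewrite lpa_pi_mul; transitivity (lpa_pi (if v == u then LVert v else LZero)).
  exact/lpa_piP/lpa_eq_vert.
by case: eqP.
Qed.

Lemma lpa_src_edge e : lpa_mul (lpa_vert (src e)) (lpa_edge e) = lpa_edge e.
Proof. rewrite lpa_pi_mul; exact/lpa_piP/lpa_eq_src_edge. Qed.

Lemma lpa_edge_rng e : lpa_mul (lpa_edge e) (lpa_vert (rng e)) = lpa_edge e.
Proof. rewrite lpa_pi_mul; exact/lpa_piP/lpa_eq_edge_rng. Qed.

Lemma lpa_rng_ghost e : lpa_mul (lpa_vert (rng e)) (lpa_ghost e) = lpa_ghost e.
Proof. rewrite lpa_pi_mul; exact/lpa_piP/lpa_eq_rng_ghost. Qed.

Lemma lpa_ghost_src e : lpa_mul (lpa_ghost e) (lpa_vert (src e)) = lpa_ghost e.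
Proof. rewrite lpa_pi_mul; exact/lpa_piP/lpa_eq_ghost_src. Qed.

Lemma lpa_mul1_vert v : lpa_mul lpa_one (lpa_vert v) = lpa_vert v.
Proof.
have -> : lpa_mul lpa_one (lpa_vert v) =
    \sum_u lpa_mul (lpa_vert u) (lpa_vert v).
  by apply: (big_morph (lpa_mul^~ _)) => [a b|]; rewrite ?lpa_mulDl ?lpa_mul0l.
rewrite (bigD1 v) //= big1 ?addr0 ?lpa_mul_vert ?eqxx // => u /negPf uv.
by rewrite lpa_mul_vert uv.
Qed.

Lemma lpa_mul_vert1 v : lpa_mul (lpa_vert v) lpa_one = lpa_vert v.
Proof.
have -> : lpa_mul (lpa_vert v) lpa_one =
    \sum_u lpa_mul (lpa_vert v) (lpa_vert u).
  by apply: big_morph => [a b|]; rewrite ?lpa_mulDr ?lpa_mul0r.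
rewrite (bigD1 v) //= big1 ?addr0 ?lpa_mul_vert ?eqxx // => u /negPf uv.
by rewrite lpa_mul_vert eq_sym uv.
Qed.

Lemma lpa_mul1l : left_id lpa_one lpa_mul.
Proof.
elim/lpa_ind => [|v|e|e|a b IHa IHb|c a IHa|a b IHa IHb].
- exact: lpa_mul0r.
- exact: lpa_mul1_vert.
- by rewrite -[in LHS]lpa_src_edge lpa_mulA lpa_mul1_vert lpa_src_edge.
- by rewrite -[in LHS]lpa_rng_ghost lpa_mulA lpa_mul1_vert lpa_rng_ghost.
- by rewrite lpa_mulDr IHa IHb.
- by rewrite -lpa_scaleAr IHa.
- by rewrite lpa_mulA IHa.
Qed.

Lemma lpa_mul1r : right_id lpa_one lpa_mul.
Proof.
elim/lpa_ind => [|v|e|e|a b IHa IHb|c a IHa|a b IHa IHb].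
- exact: lpa_mul0l.
- exact: lpa_mul_vert1.
- by rewrite -[in LHS]lpa_edge_rng -lpa_mulA lpa_mul_vert1 lpa_edge_rng.
- by rewrite -[in LHS]lpa_ghost_src -lpa_mulA lpa_mul_vert1 lpa_ghost_src.
- by rewrite lpa_mulDl IHa IHb.
- by rewrite -lpa_scaleAl IHa.
- by rewrite -lpa_mulA IHb.
Qed.

HB.instance Definition _ := GRing.Zmodule_isPzRing.Build lpa
  lpa_mulA lpa_mul1l lpa_mul1r lpa_mulDl lpa_mulDr.

Lemma lpa_scaleMl c (a b : lpa) : c *: (a * b) = (c *: a) * b.
Proof. exact: lpa_scaleAl. Qed.

Lemma lpa_scaleMr c (a b : lpa) : c *: (a * b) = a * (c *: b).
Proof. exact: lpa_scaleAr. Qed.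

Lemma lpa_vertM v u : lpa_vert v * lpa_vert u = lpa_vert v *+ (v == u).
Proof. exact: lpa_mul_vert. Qed.

Lemma lpa_src_edgeM e : lpa_vert (src e) * lpa_edge e = lpa_edge e.
Proof. exact: lpa_src_edge. Qed.

Lemma lpa_edge_rngM e : lpa_edge e * lpa_vert (rng e) = lpa_edge e.
Proof. exact: lpa_edge_rng. Qed.

Lemma lpa_rng_ghostM e : lpa_vert (rng e) * lpa_ghost e = lpa_ghost e.
Proof. exact: lpa_rng_ghost. Qed.

Lemma lpa_ghost_srcM e : lpa_ghost e * lpa_vert (src e) = lpa_ghost e.
Proof. exact: lpa_ghost_src. Qed.

Lemma lpa_ck1 e f : lpa_ghost e * lpa_edge f = lpa_vert (rng e) *+ (e == f).
Proof.
rewrite -[LHS]/(lpa_mul _ _) lpa_pi_mul.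
transitivity (lpa_pi (if e == f then LVert (rng e) else LZero)).
  exact/lpa_piP/lpa_eq_ck1.
by case: eqP.
Qed.

Lemma lpa_ck2 v : lpa_vert v = \sum_(e | src e == v) lpa_edge e * lpa_ghost e.
Proof.
transitivity
  (lpa_pi (\big[LAdd/LZero]_(e | src e == v) LMul (LEdge e) (LGhost e))).
  exact/lpa_piP/lpa_eq_ck2.
by elim/big_rec2: _ => // e a x _ <-; rewrite -lpa_pi_add -lpa_pi_mul.
Qed.

Fixpoint is_path (v : vert E) (p : seq (edge E)) : bool :=
  if p is e :: p' then (src e == v) && is_path (rng e) p' else true.

(* alpha and beta^* for paths alpha and beta given by their source and their  *)
(* list of edges                                                              *)
Definition lpa_path (v : vert E) (p : seq (edge E)) : lpa :=
  lpa_vert v * \prod_(e <- p) lpa_edge e.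

Definition lpa_path_ghost (v : vert E) (p : seq (edge E)) : lpa :=
  \prod_(e <- rev p) lpa_ghost e * lpa_vert v.

Inductive lpa_homog (n : int) : lpa -> Prop :=
| lpa_homog0 : lpa_homog n 0
| lpa_homogD c v p w q a :
    is_path v p -> is_path w q -> (size p)%:Z - (size q)%:Z = n ->
    lpa_homog n a ->
    lpa_homog n (c *: (lpa_path v p * lpa_path_ghost w q) + a).

End LeavittPathAlgebra.

(* V is the internal direct sum of its subgroups V_n, for n in Z *)
Definition direct_sum (V : zmodType) (V_ : int -> V -> Prop) : Prop :=
  [/\ forall n, V_ n 0 /\ (forall x y, V_ n x -> V_ n y -> V_ n (x - y)),
      forall x, exists s : seq V,
        (forall y, y \in s -> exists n, V_ n y) /\ x = \sum_(y <- s) y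
    & forall (s : seq int) (f : int -> V),
        uniq s -> (forall n, V_ n (f n)) -> \sum_(n <- s) f n = 0 ->
        forall n, n \in s -> f n = 0].

Record gradedRing := GradedRing {
  gring :> pzRingType;
  gring_comp : int -> gring -> Prop;
  gring_direct : direct_sum gring_comp;
  gring_mul : forall m n a b,
    gring_comp m a -> gring_comp n b -> gring_comp (m + n) (a * b)
}.

(* Right R-modules are left modules over the converse ring R^c, x . a being   *)
(* written (a : R^c) *: x.                                                    *)
Record gradedModule (R : gradedRing) := GradedModule {
  gmod :> lmodType R^c;
  gmod_comp : int -> gmod -> Prop;
  gmod_direct : direct_sum gmod_comp;
  gmod_act : forall m n (x : gmod) (a : R),
    gmod_comp m x -> gring_comp n a -> gmod_comp (m + n) ((a : R^c) *: x)
}.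

Section LpaGrading.
Variables (k : fieldType) (E : graph).
Local Notation L := (lpa k E).
Local Notation homog := (@lpa_homog k E).
Implicit Types (a b : L) (m n : int) (u v w : vert E) (e : edge E).
Implicit Types (p q : seq (edge E)).

Lemma lpa_homog_scale c n a : homog n a -> homog n (c *: a).
Proof.
elim=> {a} [|d v p w q a pv qw pq _ IH].
  by rewrite scaler0; apply: lpa_homog0.
by rewrite scalerDr scalerA; apply: lpa_homogD.
Qed.

Lemma lpa_homog_add n a b : homog n a -> homog n b -> homog n (a + b).
Proof.
move=> + hb; elim=> {a} [|d v p w q a pv qw pq _ IH]; first by rewrite add0r.
by rewrite -addrA; apply: lpa_homogD.
Qed.

Lemma lpa_homog_mono v p w q : is_path v p -> is_path w q ->
  homog ((size p)%:Z - (size q)%:Z) (lpa_path k v p * lpa_path_ghost k w q).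
Proof.
move=> pv qw; rewrite -[_ * _]addr0 -[X in X + 0]scale1r.
by apply: lpa_homogD => //; apply: lpa_homog0.
Qed.

Lemma lpa_homog_left m n a :
    (forall v p w q, is_path v p -> is_path w q ->
       homog (m + ((size p)%:Z - (size q)%:Z))
         (a * (lpa_path k v p * lpa_path_ghost k w q))) ->
  forall b, homog n b -> homog (m + n) (a * b).
Proof.
move=> am b; elim=> {b} [|d v p w q b pv qw pq _ IH].
  by rewrite mulr0; apply: lpa_homog0.
rewrite mulrDr -lpa_scaleMr; apply: lpa_homog_add => //.
by apply: lpa_homog_scale; rewrite -pq; apply: am.
Qed.

Lemma lpa_vert_path u v p :
  lpa_vert k u * lpa_path k v p = lpa_path k v p *+ (u == v).
Proof.
rewrite /lpa_path mulrA lpa_vertM.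
by case: eqVneq => [->|_]; rewrite ?mulr0n ?mul0r.
Qed.

Lemma lpa_edge_path e v p : lpa_edge k e * lpa_path k v p =
  lpa_path k (src e) (e :: p) *+ (rng e == v).
Proof.
rewrite /lpa_path big_cons mulrA -{1}(lpa_edge_rngM k e).
rewrite -(mulrA (lpa_edge k e)) lpa_vertM.
case: eqVneq => [_|_]; last by rewrite mulr0n mulr0 mul0r.
by rewrite !mulr1n lpa_edge_rngM mulrA lpa_src_edgeM.
Qed.

Lemma lpa_ghost_path e f p : lpa_ghost k e * lpa_path k (src f) (f :: p) =
  lpa_path k (rng f) p *+ (e == f).
Proof.
rewrite /lpa_path big_cons (mulrA (lpa_vert k _)) lpa_src_edgeM mulrA lpa_ck1.
by case: eqVneq => [->|_]; rewrite ?mulr0n ?mul0r.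
Qed.

Lemma lpa_homog_vertl u n b : homog n b -> homog n (lpa_vert k u * b).
Proof.
rewrite -{2}[n]add0r; apply: lpa_homog_left => v p w q pv qw.
rewrite add0r mulrA lpa_vert_path.
case: eqVneq => [_|_]; last by rewrite mulr0n mul0r; apply: lpa_homog0.
exact: lpa_homog_mono.
Qed.

Lemma lpa_homog_edgel e n b : homog n b -> homog (1 + n) (lpa_edge k e * b).
Proof.
apply: lpa_homog_left => v p w q pv qw; rewrite mulrA lpa_edge_path.
case: eqVneq => [ev|_]; last by rewrite mulr0n mul0r; apply: lpa_homog0.
have -> : 1 + ((size p)%:Z - (size q)%:Z) = (size (e :: p))%:Z - (size q)%:Z.
  by rewrite addrA -intS.
by apply: lpa_homog_mono => //=; rewrite eqxx ev.
Qed.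

Fixpoint path_end (v : vert E) (p : seq (edge E)) : vert E :=
  if p is e :: p' then path_end (rng e) p' else v.

Lemma lpa_path_ghost_end v p : is_path v p ->
  lpa_path_ghost k v p = lpa_vert k (path_end v p) * lpa_path_ghost k v p.
Proof.
rewrite /lpa_path_ghost; elim: p v => [|e p IHp] v /=.
  by rewrite big_nil mul1r lpa_vertM eqxx.
case/andP=> /eqP <- {v} /IHp pe.
rewrite rev_cons -cats1 big_cat big_seq1 /=.
have h : \prod_(f <- rev p) lpa_ghost k f * lpa_ghost k e =
    lpa_vert k (path_end (rng e) p) *
      (\prod_(f <- rev p) lpa_ghost k f * lpa_ghost k e).
  by rewrite -(lpa_rng_ghostM k e) (mulrA (\prod_(_ <- _) _)) {1}pe !mulrA.
by rewrite {1}h !mulrA.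
Qed.

Lemma is_path_rcons v p e :
  is_path v (rcons p e) = is_path v p && (src e == path_end v p).
Proof. by elim: p v => [|f p IHp] v /=; rewrite ?andbT // IHp andbA. Qed.

Lemma lpa_homog_ghostl e n b : homog n b -> homog (- 1 + n) (lpa_ghost k e * b).
Proof.
apply: lpa_homog_left => v [|f p] w q /=.
  move=> _ qw; rewrite mulrA {1}/lpa_path big_nil mulr1 -(lpa_ghost_srcM k e).
  rewrite -(mulrA (lpa_ghost k e)) lpa_vertM.
  case: eqVneq => [_|_]; last by rewrite mulr0n mulr0 mul0r; apply: lpa_homog0.
  rewrite mulr1n (lpa_path_ghost_end qw) -mulrA (mulrA (lpa_vert k _)) lpa_vertM.
  case: eqVneq => [ew|_]; last by rewrite mulr0n mul0r mulr0; apply: lpa_homog0.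
  have -> : lpa_ghost k e * (lpa_vert k (src e) *+ true * lpa_path_ghost k w q) =
      lpa_path k (rng e) [::] * lpa_path_ghost k w (rcons q e).
    rewrite mulr1n mulrA lpa_ghost_srcM /lpa_path /lpa_path_ghost big_nil mulr1.
    by rewrite rev_rcons big_cons !mulrA lpa_rng_ghostM.
  have -> : -1 + (0%:Z - (size q)%:Z) =
      (size (@nil (edge E)))%:Z - (size (rcons q e))%:Z.
    by rewrite size_rcons intS /= opprD addrCA.
  by apply: lpa_homog_mono => //; rewrite is_path_rcons qw ew eqxx.
case/andP=> /eqP <- {v} pf qw.
rewrite mulrA lpa_ghost_path.
case: eqVneq => [ef|_]; last by rewrite mulr0n mul0r; apply: lpa_homog0.
rewrite mulr1n; have -> : -1 + ((size p).+1%:Z - (size q)%:Z) =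
    (size p)%:Z - (size q)%:Z by rewrite intS !addrA addNr add0r.
exact: lpa_homog_mono.
Qed.

Lemma lpa_homog_mul m n a b : homog m a -> homog n b -> homog (m + n) (a * b).
Proof.
move=> + hb; elim=> {a} [|d v p w q a pv qw pq _ IH].
  by rewrite mul0r; apply: lpa_homog0.
rewrite mulrDl; apply: lpa_homog_add => //.
rewrite -lpa_scaleMl; apply: lpa_homog_scale; rewrite -pq {a IH pq pv qw}.
have {hb} hb : homog (- (size q)%:Z + n) (lpa_path_ghost k w q * b).
  rewrite /lpa_path_ghost -mulrA -[size q]size_rev.
  have {}hb := lpa_homog_vertl w hb.
  elim: (rev q) => [|e s IHs]; first by rewrite big_nil mul1r oppr0 add0r.
  rewrite big_cons -mulrA /= intS opprD -addrA; exact: lpa_homog_ghostl.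
rewrite -addrA -mulrA /lpa_path -[X in homog X _]add0r -[X in homog X _]/(_).
rewrite add0r -mulrA; apply: lpa_homog_vertl.
elim: p => [|e p IHp]; first by rewrite big_nil mul1r add0r.
by rewrite big_cons -mulrA /= intS -addrA; apply: lpa_homog_edgel.
Qed.

(* L_k(E) acts on functions Z -> L_k(E), edges shifting the argument by one;  *)
(* evaluating this action separates the homogeneous components.               *)
Fixpoint lpa_tact (x : lpa_term k E) (f : int -> L) : int -> L :=
  match x with
  | LZero => fun=> 0
  | LVert v => fun n => lpa_vert k v * f n
  | LEdge e => fun n => lpa_edge k e * f (n - 1)
  | LGhost e => fun n => lpa_ghost k e * f (n + 1)
  | LAdd x y => fun n => lpa_tact x f n + lpa_tact y f n
  | LScale c x => fun n => c *: lpa_tact x f n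
  | LMul x y => lpa_tact x (lpa_tact y f)
  end.

Lemma lpa_tactD x f g :
  lpa_tact x (fun n => f n + g n) = fun n => lpa_tact x f n + lpa_tact x g n.
Proof.
elim: x f g => [|v|e|e|x IHx y IHy|c x IHx|x IHx y IHy] f g;
  apply/funext => n /=; rewrite ?addr0 ?mulrDr //.
- by rewrite IHx IHy addrACA.
- by rewrite IHx scalerDr.
- by rewrite IHy IHx.
Qed.

Lemma lpa_tactZ x c f :
  lpa_tact x (fun n => c *: f n) = fun n => c *: lpa_tact x f n.
Proof.
elim: x f => [|v|e|e|x IHx y IHy|d x IHx|x IHx y IHy] f;
  apply/funext => n /=; rewrite ?scaler0 ?lpa_scaleMr //.
- by rewrite IHx IHy scalerDr.
- by rewrite IHx !scalerA mulrC.
- by rewrite IHy IHx.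
Qed.

Lemma lpa_tact_sum (I : Type) (r : seq I) (P : pred I) F f n :
  lpa_tact (\big[@LAdd k E/@LZero k E]_(i <- r | P i) F i) f n =
  \sum_(i <- r | P i) lpa_tact (F i) f n.
Proof. by elim/big_rec2: _ => //= i a x _ <-. Qed.

Lemma lpa_tactP x y : lpa_eq x y -> lpa_tact x = lpa_tact y.
Proof.
elim=> {x y}; try by [].
- by move=> x y z _ -> _ ->.
- by move=> x x' y y' _ /= -> _ ->.
- by move=> c x x' _ /= ->.
- by move=> x x' y y' _ /= -> _ ->.
- by move=> x y z; apply/funext => f; apply/funext => n /=; rewrite addrA.
- by move=> x y; apply/funext => f; apply/funext => n /=; rewrite addrC.
- by move=> x; apply/funext => f; apply/funext => n /=; rewrite add0r.
- by move=> x; apply/funext => f; apply/funext => n /=; rewrite scaleN1r addNr.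
- by move=> c d x; apply/funext => f; apply/funext => n /=; rewrite scalerA.
- by move=> x; apply/funext => f; apply/funext => n /=; rewrite scale1r.
- by move=> c x y; apply/funext => f; apply/funext => n /=; rewrite scalerDr.
- by move=> c d x; apply/funext => f; apply/funext => n /=; rewrite scalerDl.
- by move=> x y z; apply/funext => f; rewrite /= lpa_tactD.
- by move=> c x y; apply/funext => f; rewrite /= lpa_tactZ.
- move=> v u; apply/funext => f; apply/funext => n /=.
  by rewrite mulrA lpa_vertM; case: eqP => //=; rewrite mul0r.
- move=> e; apply/funext => f; apply/funext => n /=.
  by rewrite mulrA lpa_src_edgeM.
- move=> e; apply/funext => f; apply/funext => n /=.
  by rewrite mulrA lpa_edge_rngM.
- move=> e; apply/funext => f; apply/funext => n /=.
  by rewrite mulrA lpa_rng_ghostM.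
- move=> e; apply/funext => f; apply/funext => n /=.
  by rewrite mulrA lpa_ghost_srcM.
- move=> e g; apply/funext => f; apply/funext => n /=.
  by rewrite mulrA lpa_ck1 addrK; case: eqP => //=; rewrite mul0r.
- move=> v; apply/funext => f; apply/funext => n /=.
  rewrite lpa_tact_sum /= lpa_ck2 mulr_suml; apply: eq_bigr => e _.
  by rewrite subrK mulrA.
Qed.

Definition lpa_shift n a : Prop :=
  forall f m, lpa_tact (lpa_repr a) f m = a * f (m - n).

Lemma lpa_tact_repr x : lpa_tact (lpa_repr (lpa_pi x)) = lpa_tact x.
Proof. exact/lpa_tactP/lpa_reprP. Qed.

Lemma lpa_shift0 n : lpa_shift n 0.
Proof.
by move=> f m; rewrite -[0]/(lpa_pi _) lpa_tact_repr mul0r.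
Qed.

Lemma lpa_tact0 f m : lpa_tact (lpa_repr 0) f m = 0.
Proof. by rewrite -[0]/(lpa_pi _) lpa_tact_repr. Qed.

Lemma lpa_tact_add a b f m : lpa_tact (lpa_repr (a + b)) f m =
  lpa_tact (lpa_repr a) f m + lpa_tact (lpa_repr b) f m.
Proof. by rewrite -[a + b]/(lpa_pi _) lpa_tact_repr. Qed.

Lemma lpa_shiftD n a b : lpa_shift n a -> lpa_shift n b -> lpa_shift n (a + b).
Proof. by move=> ha hb f m; rewrite lpa_tact_add ha hb mulrDl. Qed.

Lemma lpa_shiftZ n c a : lpa_shift n a -> lpa_shift n (c *: a).
Proof.
move=> ha f m; rewrite -lpa_scaleMl -ha.
by rewrite -[c *: a]/(lpa_pi (LScale c (lpa_repr a))) lpa_tact_repr.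
Qed.

Lemma lpa_shiftM m n a b :
  lpa_shift m a -> lpa_shift n b -> lpa_shift (m + n) (a * b).
Proof.
move=> ha hb f i.
transitivity (lpa_tact (lpa_repr a) (lpa_tact (lpa_repr b) f) i).
  by rewrite -[a * b]/(lpa_pi (LMul (lpa_repr a) (lpa_repr b))) lpa_tact_repr.
by rewrite ha hb mulrA opprD addrA.
Qed.

Lemma lpa_shift_vert v : lpa_shift 0 (lpa_vert k v).
Proof. by move=> f m; rewrite lpa_tact_repr subr0. Qed.

Lemma lpa_shift_edge e : lpa_shift 1 (lpa_edge k e).
Proof. by move=> f m; rewrite lpa_tact_repr. Qed.

Lemma lpa_shift_ghost e : lpa_shift (- 1) (lpa_ghost k e).
Proof. by move=> f m; rewrite lpa_tact_repr opprK. Qed.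

Lemma lpa_shift1 : lpa_shift 0 1.
Proof.
rewrite -[1]/(\sum_v lpa_vert k v); elim/big_rec: _ => [|v a _ ha].
  exact: lpa_shift0.
by apply: lpa_shiftD => //; apply: lpa_shift_vert.
Qed.

Lemma lpa_homog_shift n a : homog n a -> lpa_shift n a.
Proof.
elim=> {a} [|d v p w q a pv qw <- _ IH]; first exact: lpa_shift0.
apply: lpa_shiftD => //; apply: lpa_shiftZ; apply: lpa_shiftM.
  rewrite /lpa_path -[_%:Z]add0r; apply: lpa_shiftM.
    exact: lpa_shift_vert.
  elim: (p) => [|e s IHs]; first by rewrite big_nil; apply: lpa_shift1.
  rewrite big_cons /= intS; apply: lpa_shiftM => //; exact: lpa_shift_edge.
rewrite /lpa_path_ghost -[- _]addr0 -[size q]size_rev; apply: lpa_shiftM.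
  elim: (rev q) => [|e s IHs]; first by rewrite big_nil; apply: lpa_shift1.
  rewrite big_cons /= intS opprD; apply: lpa_shiftM => //.
  exact: lpa_shift_ghost.
exact: lpa_shift_vert.
Qed.

Lemma lpa_direct : direct_sum homog.
Proof.
split=> [n||s f us hf sf0 n ns].
- split=> [|x y hx hy]; first exact: lpa_homog0.
  by apply: lpa_homog_add => //; rewrite -scaleN1r; apply: lpa_homog_scale.
- pose D (a : L) := exists s : seq L,
    (forall y, y \in s -> exists n, homog n y) /\ a = \sum_(y <- s) y.
  have D1 n a : homog n a -> D a.
    move=> ha; exists [:: a]; rewrite big_seq1; split=> // y.
    by rewrite inE => /eqP ->; exists n.
  apply: (@lpa_ind k E D) => [|v|e|e|a b [s [hs ->]] [t [ht ->]]|c a [s [hs ->]]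
                             |a b [s [hs ->]] [t [ht ->]]].
  + by exists [::]; rewrite big_nil.
  + have := @lpa_homog_mono v [::] v [::] isT isT.
    rewrite /lpa_path /lpa_path_ghost !big_nil mulr1 mul1r lpa_vertM eqxx.
    exact: D1.
  + have /(_ _ isT) := @lpa_homog_mono (src e) [:: e] (rng e) [::].
    rewrite /= eqxx /lpa_path /lpa_path_ghost big_nil big_seq1 mul1r => /(_ isT).
    rewrite -mulrA lpa_edge_rngM.
    rewrite lpa_src_edgeM; exact: D1.
  + have /(_ isT) := @lpa_homog_mono (rng e) [::] (src e) [:: e].
    rewrite /= eqxx /lpa_path /lpa_path_ghost big_nil big_seq1 mulr1 => /(_ isT).
    rewrite lpa_ghost_srcM lpa_rng_ghostM; exact: D1.
  + exists (s ++ t); rewrite big_cat; split=> // y.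
    by rewrite mem_cat => /orP[/hs|/ht].
  + exists [seq c *: y | y <- s]; rewrite big_map scaler_sumr; split=> // y.
    by case/mapP=> z /hs[n hz] ->; exists n; apply: lpa_homog_scale.
  + exists [seq y * z | y <- s, z <- t]; split=> [y|].
      case/allpairsP=> -[y1 y2] /= [/hs[m h1] /ht[n h2] ->].
      by exists (m + n); apply: lpa_homog_mul.
    transitivity ((\sum_(y <- s) y) * (\sum_(y <- t) y)); first by [].
    rewrite big_allpairs_dep /= mulr_suml.
    by apply: eq_bigr => y _; rewrite mulr_sumr.
- pose d (i : int) : L := if i == 0 then 1 else 0.
  have tsum r : lpa_tact (lpa_repr (\sum_(i <- r) f i)) d n =
      \sum_(i <- r) f i * d (n - i).
    elim: r => [|i r IHr].
      by rewrite !big_nil lpa_tact0.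
    by rewrite !big_cons lpa_tact_add IHr (lpa_homog_shift (hf i)).
  have := tsum s; rewrite sf0 lpa_tact0 => /esym.
  rewrite (bigD1_seq n) //= subrr /d eqxx mulr1 big1 ?addr0 // => i /negPf ni.
  by rewrite subr_eq0 eq_sym ni mulr0.
Qed.

Definition lpa_graded : gradedRing :=
  @GradedRing (lpa k E) homog lpa_direct lpa_homog_mul.

End LpaGrading.

Record category := Category {
  obj :> Type;
  mor : obj -> obj -> Type;
  idm : forall a, mor a a;
  cmp : forall a b c, mor b c -> mor a b -> mor a c;
  cmp1m : forall a b (f : mor a b), cmp (idm b) f = f;
  cmpm1 : forall a b (f : mor a b), cmp f (idm a) = f;
  cmpA : forall a b c d (h : mor c d) (g : mor b c) (f : mor a b),
    cmp h (cmp g f) = cmp (cmp h g) f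
}.

Record functor (C D : category) := Functor {
  fobj :> C -> D;
  fmor : forall a b : C, mor a b -> mor (fobj a) (fobj b);
  fmor1 : forall a, fmor (idm a) = idm (fobj a);
  fmorM : forall a b c (g : mor b c) (f : mor a b),
    fmor (cmp g f) = cmp (fmor g) (fmor f)
}.

Definition functor_id (C : category) : functor C C :=
  @Functor C C id (fun _ _ f => f) (fun _ => erefl) (fun _ _ _ _ _ => erefl).

Definition functor_comp (C D E : category) (G : functor D E) (F : functor C D) :
  functor C E.
Proof.
apply: (@Functor C E (fun a => G (F a)) (fun a b f => fmor G (fmor F f))).
- by move=> a; rewrite !fmor1.
- by move=> a b c g f; rewrite !fmorM.
Defined.

Definition nat_iso (C D : category) (F G : functor C D) : Prop :=
  exists (t : forall a, mor (F a) (G a)) (u : forall a, mor (G a) (F a)),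
    [/\ forall a, cmp (u a) (t a) = idm (F a),
        forall a, cmp (t a) (u a) = idm (G a)
      & forall a b (f : mor a b), cmp (t b) (fmor F f) = cmp (fmor G f) (t a)].

Definition is_equivalence (C D : category) (F : functor C D) : Prop :=
  exists G : functor D C,
    nat_iso (functor_comp G F) (functor_id C) /\
    nat_iso (functor_comp F G) (functor_id D).

Lemma linear_ext (R : pzRingType) (M N : lmodType R) (f g : {linear M -> N}) :
  f =1 g -> f = g.
Proof.
case: f g => f cf [g cg] /= /funext fg; case: _ / fg cg => cg.
congr GRing.Linear.Pack; case: cf cg => [[f1] [f2]] [[g1] [g2]].
by congr GRing.Linear.Class; congr (_ _); apply: Prop_irrelevance.
Qed.

Section ModuleCategories.

Definition ModCat (R : pzRingType) : category.
Proof.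
apply: (@Category (lmodType R^c) (fun M N => {linear M -> N})
  (fun M => idfun : {linear M -> M})
  (fun M N P g f => (g \o f : {linear M -> P}))).
- by move=> M N f; apply: linear_ext.
- by move=> M N f; apply: linear_ext.
- by move=> M N P Q h g f; apply: linear_ext.
Defined.

Variable R : gradedRing.

Record gradedHom (M N : gradedModule R) := GradedHom {
  ghom :> {linear M -> N};
  ghom_deg : forall n (x : M), gmod_comp n x -> gmod_comp n (ghom x)
}.

Lemma gradedHom_ext (M N : gradedModule R) (f g : gradedHom M N) :
  f =1 g -> f = g.
Proof.
case: f g => f hf [g hg] /= /linear_ext fg; case: _ / fg hg => hg.
by congr GradedHom; apply: Prop_irrelevance.
Qed.

Definition gradedHom_id (M : gradedModule R) : gradedHom M M :=
  @GradedHom M M (idfun : {linear M -> M}) (fun _ _ h => h).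

Definition gradedHom_comp (M N P : gradedModule R)
    (g : gradedHom N P) (f : gradedHom M N) : gradedHom M P :=
  @GradedHom M P (g \o f : {linear M -> P})
    (fun n x h => ghom_deg g (ghom_deg f h)).

Definition GrCat : category.
Proof.
apply: (@Category (gradedModule R) gradedHom gradedHom_id gradedHom_comp).
- by move=> M N f; apply: gradedHom_ext.
- by move=> M N f; apply: gradedHom_ext.
- by move=> M N P Q h g f; apply: gradedHom_ext.
Defined.

Definition forget_grading : functor GrCat (ModCat R).
Proof.
apply: (@Functor GrCat (ModCat R) (fun M => gmod M)
  (fun M N (f : gradedHom M N) => ghom f)).
- by [].
- by [].
Defined.

Lemma suspension_direct (M : gradedModule R) (g : int) :
  direct_sum (fun n => @gmod_comp R M (g + n)).
Proof.
have [sub gen ind] := gmod_direct M; split=> [n|x|s f us hf sf0 n ns].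
- exact: sub.
- have [s [hs ->]] := gen x; exists s; split=> // y /hs [n hn].
  by exists (n - g); rewrite addrC subrK.
- have h i : gmod_comp i (f (i - g)).
    by rewrite -[X in gmod_comp X _](subrK g) addrC; apply: hf.
  have := ind [seq g + i | i <- s] (fun i => f (i - g)) _ h.
  rewrite (map_inj_uniq (addrI g)) => /(_ us).
  rewrite big_map; under eq_bigr do rewrite addrC addKr.
  by move=> /(_ sf0 (g + n) (map_f _ ns)); rewrite addrC addKr.
Qed.

Lemma suspension_act (M : gradedModule R) (g m n : int) (x : M) (a : R) :
  gmod_comp (g + m) x -> gring_comp n a ->
  gmod_comp (g + (m + n)) ((a : R^c) *: x).
Proof. by rewrite addrA; apply: gmod_act. Qed.

Definition suspension (g : int) (M : gradedModule R) : gradedModule R :=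
  @GradedModule R M (fun n => gmod_comp (g + n)) (suspension_direct M g)
    (@suspension_act M g).

Definition suspension_functor (g : int) : functor GrCat GrCat.
Proof.
apply: (@Functor GrCat GrCat (suspension g)
  (fun M N (f : gradedHom M N) =>
     @GradedHom (suspension g M) (suspension g N) f
       (fun n x => @ghom_deg M N f (g + n) x))).
- by move=> M; apply: gradedHom_ext.
- by move=> M N P h f; apply: gradedHom_ext.
Defined.

End ModuleCategories.

Definition graded_functor (R S : gradedRing)
    (Phi : functor (GrCat R) (GrCat S)) : Prop :=
  forall (g : int) (M : gradedModule R),
    suspension_functor S g (Phi M) = Phi (suspension_functor R g M).

Definition graded_mod_functor (R S : gradedRing)
    (phi : functor (ModCat R) (ModCat S)) : Prop :=
  exists2 Phi : functor (GrCat R) (GrCat S), graded_functor Phi &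
    functor_comp (forget_grading S) Phi = functor_comp phi (forget_grading R).

Definition geMod (R S : gradedRing) : Prop :=
  exists2 phi : functor (ModCat R) (ModCat S),
    graded_mod_functor phi & is_equivalence phi.

Definition geGr (R S : gradedRing) : Prop :=
  exists (Phi : functor (GrCat R) (GrCat S)) (Gam : functor (GrCat S) (GrCat R)),
    [/\ graded_functor Phi, graded_functor Gam,
        nat_iso (functor_comp Gam Phi) (functor_id (GrCat R))
      & nat_iso (functor_comp Phi Gam) (functor_id (GrCat S))].

Definition graded_morita_equivalent (R S : gradedRing) : Prop :=
  geMod R S \/ geGr R S.

(* Main.v *)
Require Import Defs.
From HB Require Import structures.
From mathcomp Require Import all_boot all_order all_algebra.
From mathcomp Require Import boolp.

Set Implicit Arguments.
Unset Strict Implicit.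
Unset Printing Implicit Defensive.

Import GRing.Theory.

Local Open Scope ring_scope.

(** An elementary strong shift equivalence A_E = R S, A_F = S R is, in terms of
    graphs, a pair of bipartite multigraphs R from E^0 to F^0 and S from F^0 to
    E^0 such that the edges of E are the composable pairs (r, s) and the edges
    of F are the composable pairs (s, r) ([factors]; a bijection respecting end
    points exists because the matrix equations say that both sides have the
    same number of elements between any two vertices). Both halves of the
    theorem are proved for one such step and then propagated along a chain of
    steps through the graphs of the intermediate matrices ([sse_chain]).

    Bimodules. For one step take M = kR and N = kS. Then M (x) N = kE^1 and
    N (x) M = kF^1, and regrouping M (x) N (x) M gives
    sigma_M : kE^1 (x) M -> M (x) kF^1; the two identities, with n = 1, say no
    more than that regrouping four factors in two ways gives the same result
    ([step_sharp]). For a chain, let (M1, N1) be an elementary step between X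
    and Y, and let (M, N) with exponent n relate Y and Z. Then M1 (x) M and
    N (x) N1 relate X and Z with exponent n + 1, by means of
      N (x) (N1 (x) M1) (x) M = N (x) Y (x) M = N (x) M (x) Z = Z^n (x) Z,
      M1 (x) (M (x) N) (x) N1 = M1 (x) Y^n (x) N1 = M1 (x) N1 (x) X^n = X^(n+1).
    The last line moves N1 through the n factors of Y^n one at a time, and the
    main point is that this iteration is compatible with nu ([powS_iso_nu]).

    Graded Morita equivalence. A graded right L_k(E)-module is a family of
    graded spaces P_v, for v in E^0, with isomorphisms between P_v and the sum
    of the P_(r(e)) over the edges e leaving v, shifted by one degree. Given
    such a family, the spaces Q_w = sum of the P_v over the elements s : w -> v
    of S form a family of the same kind for F, since both sides of the required
    isomorphism are sums over the paths s r s'. Doing this twice gives the sum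
    of the P_(r(e)) over e = (r, s) leaving v, that is, P_v up to a shift by
    one, so that the two constructions are inverse to each other after a
    suspension. Here the construction is written with matrices: it is the
    functor P |-> P^S rho(1) for a homomorphism rho from L_k(F) to matrices over
    L_k(E) ([transfer]), and the natural isomorphism is given by the row of the
    edges (r, s) and the column of the ghost edges (r, s)^* ([splitting],
    [transfer_splitting], [geGr_splitting]). *)

(** * Calculus of pure tensors *)

Section PureTensors.
Variables (k : fieldType) (A B C : kalgebra k).
Variables (X : bimod A B) (Y : bimod B C).

(** [tpure] retyped as an element of the bimodule [X \ox Y], so that the
    lemmas on bimodule maps and on tensors rewrite the same expressions. *)
Definition tp (x : X) (y : Y) : X \ox Y := tpure x y.

Lemma tpDl x x' y : tp (x + x') y = tp x y + tp x' y.
Proof. exact: tpureDl. Qed.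

Lemma tpDr x y y' : tp x (y + y') = tp x y + tp x y'.
Proof. exact: tpureDr. Qed.

Lemma tp0l y : tp 0 y = 0.
Proof. by apply: (addrI (tp 0 y)); rewrite -tpDl !addr0. Qed.

Lemma tp0r x : tp x 0 = 0.
Proof. by apply: (addrI (tp x 0)); rewrite -tpDr !addr0. Qed.

Lemma tpB_ind (P : X \ox Y -> Prop) :
  P 0 -> (forall x y t, P t -> P (tp x y + t)) -> forall t, P t.
Proof. exact: tens_ind. Qed.

End PureTensors.

Section PureMaps.
Variable k : fieldType.

Lemma tens_isoEp (A B C : kalgebra k) (X X' : bimod A B) (Y Y' : bimod B C)
    (f : bimodIso X X') (g : bimodIso Y Y') x y :
  tens_iso f g (tp x y) = tp (f x) (g y).
Proof. exact: tens_mapE. Qed.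

Lemma assocEp (A B C D : kalgebra k) (X : bimod A B) (Y : bimod B C)
    (Z : bimod C D) x y z :
  assoc X Y Z (tp (tp x y) z) = tp x (tp y z).
Proof. exact: assocE. Qed.

Lemma assocVEp (A B C D : kalgebra k) (X : bimod A B) (Y : bimod B C)
    (Z : bimod C D) x y z :
  biso_sym (assoc X Y Z) (tp x (tp y z)) = tp (tp x y) z.
Proof. exact: assocVE. Qed.

Lemma biso_symK (A B : kalgebra k) (X Y : bimod A B) (f : bimodIso X Y) x :
  biso_sym f (f x) = x.
Proof. exact: biso_K. Qed.

Lemma biso_symVK (A B : kalgebra k) (X Y : bimod A B) (f : bimodIso X Y) x :
  f (biso_sym f x) = x.
Proof. exact: biso_VK. Qed.

Lemma biso_compE (A B : kalgebra k) (X Y Z : bimod A B) (g : bimodIso Y Z)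
  (f : bimodIso X Y) x : biso_comp g f x = g (f x).
Proof. by []. Qed.

Lemma biso_idE (A B : kalgebra k) (X : bimod A B) (x : X) : biso_id X x = x.
Proof. by []. Qed.

End PureMaps.

Definition tpE := (biso_idE, tens_isoEp, assocEp, assocVEp).
Definition tpD := (bhomD, tpDl, tpDr).
Definition tp0 := (bhom0, tp0l, tp0r).

(** Reduces a goal that is additive in the tensor [t] to pure tensors. The goal
    may contain [t] only under bimodule maps and [tp]; this is how the value of
    an isomorphism such as [sigma_M] on a pure tensor, which is not pure in
    general, is treated as if it were. *)
Ltac pure_tensor t x y :=
  let IH := fresh "IH" in
  elim/tpB_ind: t => [|x y t IH]; [by rewrite !tp0 |
    rewrite !tpD; congr (_ + _); [clear t IH | exact: IH]].

Section ElementaryStep.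
Variables (k : fieldType) (A B : kalgebra k) (X : bimod A A) (Y : bimod B B).
Variables (M : bimod A B) (N : bimod B A).
Variables (wX : bimodIso (M \ox N) X) (wY : bimodIso (N \ox M) Y).

Definition step_iso : bimodIso (X \ox M) (M \ox Y) :=
  biso_comp (tens_iso (biso_id M) wY)
    (biso_comp (assoc M N M) (tens_iso (biso_sym wX) (biso_id M))).

(** Since [M \ox N] is a copy of [X], this formula determines [step_iso]: it
    only moves the brackets in m (x) n (x) m'. *)
Lemma step_isoE m n m' :
  step_iso (tp (wX (tp m n)) m') = tp m (wY (tp n m')).
Proof. by rewrite /step_iso !biso_compE !tpE biso_symK !tpE. Qed.

End ElementaryStep.

Lemma sharpE (k : fieldType) (A B C : kalgebra k) (X : bimod A A)
    (Y : bimod B B) (Z : bimod C C) (M : bimod A B) (N : bimod B C)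
    (s : bimodIso (X \ox M) (M \ox Y)) (p : bimodIso (Y \ox N) (N \ox Z))
    x m n :
  sharp s p (tp x (tp m n)) =
  biso_sym (assoc M N Z) (tens_iso (biso_id M) p
    (assoc M Y N (tp (s (tp x m)) n))).
Proof. by rewrite /sharp !biso_compE !tpE. Qed.

Section ElementarySharp.
Variables (k : fieldType) (A B : kalgebra k) (X : bimod A A) (Y : bimod B B).
Variables (M : bimod A B) (N : bimod B A).
Variables (wX : bimodIso (M \ox N) X) (wY : bimodIso (N \ox M) Y).

(** On m' (x) n' (x) m (x) n both sides are the same regrouping. *)
Lemma step_sharp x m n :
  tens_iso wX (biso_id X) (sharp (step_iso wX wY) (step_iso wY wX)
    (tp x (tp m n))) = tp x (wX (tp m n)).
Proof.
rewrite sharpE -[x](biso_symVK wX).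
move: (biso_sym wX x) => t; pure_tensor t m' n'.
by rewrite (step_isoE wX wY) !tpE (step_isoE wY wX) !tpE.
Qed.

End ElementarySharp.

Section Slide.
Variables (k : fieldType) (A B C : kalgebra k).
Variables (X : bimod A A) (Y : bimod B B) (N : bimod B A).
Variables (s : bimodIso (Y \ox N) (N \ox X)).

Definition slide (Z : bimod A C) :
    bimodIso (Y \ox (N \ox Z)) (N \ox (X \ox Z)) :=
  biso_comp (assoc N X Z)
    (biso_comp (tens_iso s (biso_id Z)) (biso_sym (assoc Y N Z))).

Lemma slideE (Z : bimod A C) y n (z : Z) :
  slide Z (tp y (tp n z)) = assoc N X Z (tp (s (tp y n)) z).
Proof. by rewrite /slide !biso_compE !tpE. Qed.

Lemma slide_natural (Z Z' : bimod A C) (f : bimodIso Z Z') y t :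
  slide Z' (tp y (tens_iso (biso_id N) f t)) =
  tens_iso (biso_id N) (tens_iso (biso_id X) f) (slide Z (tp y t)).
Proof.
pure_tensor t n z; rewrite tpE !slideE.
by move: (s _) => t; pure_tensor t n' x; rewrite !tpE.
Qed.

End Slide.

Section PowerOfIntertwiner.
Variables (k : fieldType) (A B : kalgebra k) (X : bimod A A) (Y : bimod B B).
Variables (N : bimod B A) (s : bimodIso (Y \ox N) (N \ox X)).

(** N is carried through the factors of Y^(m+1) from right to left, each of them
    becoming a factor X. *)
Fixpoint powS_iso (m : nat) : bimodIso (tpowS Y m \ox N) (N \ox tpowS X m) :=
  if m is m'.+1 then
    biso_comp (slide s (tpowS X m'))
      (biso_comp (tens_iso (biso_id Y) (powS_iso m'))
        (assoc Y (tpowS Y m') N))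
  else s.

Lemma powS_succE m y p n :
  powS_iso m.+1 (tp (tp y p : tpowS Y m.+1) n) =
  slide s (tpowS X m) (tp y (powS_iso m (tp p n))).
Proof. by rewrite [powS_iso _]/= !biso_compE !tpE. Qed.

Lemma nuS_succE (C : kalgebra k) (Z : bimod C C) m z p :
  nuS Z m.+1 (tp z p) = biso_sym (assoc Z (tpowS Z m) Z) (tp z (nuS Z m p)).
Proof. by rewrite [nuS _ _]/= biso_compE !tpE. Qed.

(** Carrying N through m + 2 factors Y can be split by treating the last factor
    first (left side) or the first factor last (right side); [nuS] compares the
    two ways of singling out one factor. *)
Lemma powS_iso_nu m y p n :
  slide (powS_iso m) X (tens_iso (biso_id (tpowS Y m)) s
      (assoc (tpowS Y m) Y N (tp (nuS Y m (tp y p)) n))) =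
  tens_iso (biso_id N) (nuS X m)
    (slide s (tpowS X m) (tp y (powS_iso m (tp p n)))).
Proof.
elim: m y p n => [|m IHm] y p n.
  change (slide s X (tens_iso (biso_id Y) s (assoc Y Y N (tp (tp y p) n))) =
    tens_iso (biso_id N) (biso_id (X \ox X)) (slide s X (tp y (s (tp p n))))).
  rewrite assocEp tens_isoEp biso_idE; move: (slide _ _ _) => t.
  by pure_tensor t n' x; rewrite tpE.
pure_tensor p y' p'; rewrite nuS_succE powS_succE.
have {IHm} IH := IHm y' p' n.
have -> : tens_iso (biso_id N) (nuS X m.+1) (slide s (tpowS X m.+1)
    (tp y (slide s (tpowS X m) (tp y' (powS_iso m (tp p' n)))))) =
  tens_iso (biso_id N) (biso_sym (assoc X (tpowS X m) X))
    (slide s (tpowS X m \ox X) (tp y (slide (powS_iso m) X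
      (tens_iso (biso_id (tpowS Y m)) s
         (assoc (tpowS Y m) Y N (tp (nuS Y m (tp y' p')) n)))))).
  rewrite IH slide_natural; move: (slide s _ (tp y _)) => t.
  pure_tensor t n' x; pure_tensor x x' r.
  by rewrite !tens_isoEp nuS_succE.
move: (nuS Y m _) => q {IH}; pure_tensor q p1 y1; rewrite !tpE.
move: (s (tp y1 n)) => t; pure_tensor t n1 x1; rewrite !slideE powS_succE.
move: (powS_iso m _) => t; pure_tensor t n2 r; rewrite !(slideE, tpE).
by move: (s _) => t; pure_tensor t n3 x3; rewrite !tpE.
Qed.

End PowerOfIntertwiner.

(** * Composing an elementary step with an aligned equivalence *)

(** The conclusion on bimodules, for arbitrary bimodules X and Y in place of
    kE^1 and kF^1; in this generality it is amenable to induction on chains. *)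
Definition aligned (k : fieldType) (A B : kalgebra k)
    (X : bimod A A) (Y : bimod B B) : Prop :=
  exists (M : bimod A B) (N : bimod B A) (n : nat)
      (omegaX : bimodIso (M \ox N) (tpow X n))
      (omegaY : bimodIso (N \ox M) (tpow Y n))
      (sigmaM : bimodIso (X \ox M) (M \ox Y))
      (sigmaN : bimodIso (Y \ox N) (N \ox X)),
    [/\ (0 < n)%N,
        tens_iso omegaX (biso_id X) \o sharp sigmaM sigmaN =1
          nu X n \o tens_iso (biso_id X) omegaX
      & tens_iso omegaY (biso_id Y) \o sharp sigmaN sigmaM =1
          nu Y n \o tens_iso (biso_id Y) omegaY].

(** The two identities only need to be checked on pure tensors. *)
Lemma tp_eq3 (k : fieldType) (A B C D : kalgebra k) (X : bimod A B)
    (Y : bimod B C) (Z : bimod C D) (W : bimod A D)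
    (f g : bimodHom (X \ox (Y \ox Z)) W) :
  (forall x y z, f (tp x (tp y z)) = g (tp x (tp y z))) -> f =1 g.
Proof.
move=> fg t; pure_tensor t x u; pure_tensor u y z; exact: fg.
Qed.

Section AlignedElementary.
Variables (k : fieldType) (A B : kalgebra k) (X : bimod A A) (Y : bimod B B).
Variables (M : bimod A B) (N : bimod B A).
Variables (wX : bimodIso (M \ox N) X) (wY : bimodIso (N \ox M) Y).

Lemma aligned_elementary : aligned X Y.
Proof.
exists M, N, 1%N, wX, wY, (step_iso wX wY), (step_iso wY wX); split=> //.
- apply: (@tp_eq3 _ _ _ _ _ X M N (X \ox X)
    (biso_comp (tens_iso wX (biso_id X))
       (sharp (step_iso wX wY) (step_iso wY wX)))
    (biso_comp (nu X 1) (tens_iso (biso_id X) wX))) => x m n.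
  by rewrite !biso_compE step_sharp !tpE.
- apply: (@tp_eq3 _ _ _ _ _ Y N M (Y \ox Y)
    (biso_comp (tens_iso wY (biso_id Y))
       (sharp (step_iso wY wX) (step_iso wX wY)))
    (biso_comp (nu Y 1) (tens_iso (biso_id Y) wY))) => x m n.
  by rewrite !biso_compE step_sharp !tpE.
Qed.

End AlignedElementary.

Section AlignedCons.
Variables (k : fieldType) (A B C : kalgebra k).
Variables (X : bimod A A) (Y : bimod B B) (Z : bimod C C).
Variables (M1 : bimod A B) (N1 : bimod B A).
Variables (wX : bimodIso (M1 \ox N1) X) (wY : bimodIso (N1 \ox M1) Y).
Variables (M : bimod B C) (N : bimod C B) (m : nat).
Variables (omY : bimodIso (M \ox N) (tpowS Y m)).
Variables (omZ : bimodIso (N \ox M) (tpowS Z m)).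
Variables (sM : bimodIso (Y \ox M) (M \ox Z)).
Variables (sN : bimodIso (Z \ox N) (N \ox Y)).
Hypothesis hY : forall y a b,
  tens_iso omY (biso_id Y) (sharp sM sN (tp y (tp a b))) =
  nuS Y m (tp y (omY (tp a b))).
Hypothesis hZ : forall z b a,
  tens_iso omZ (biso_id Z) (sharp sN sM (tp z (tp b a))) =
  nuS Z m (tp z (omZ (tp b a))).

Local Notation s1 := (step_iso wX wY).
Local Notation s2 := (step_iso wY wX).
Local Notation kap := (powS_iso s2 m).

Definition cons_omX : bimodIso ((M1 \ox M) \ox (N \ox N1)) (tpowS X m.+1) :=
  biso_comp (tens_iso wX (biso_id (tpowS X m)))
  (biso_comp (biso_sym (assoc M1 N1 (tpowS X m)))
  (biso_comp (tens_iso (biso_id M1) kap)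
  (biso_comp (tens_iso (biso_id M1) (tens_iso omY (biso_id N1)))
  (biso_comp (tens_iso (biso_id M1) (biso_sym (assoc M N N1)))
     (assoc M1 M (N \ox N1)))))).

Lemma cons_omXE m1 a b n1 :
  cons_omX (tp (tp m1 a) (tp b n1)) =
  tens_iso wX (biso_id (tpowS X m)) (biso_sym (assoc M1 N1 (tpowS X m))
    (tp m1 (kap (tp (omY (tp a b)) n1)))).
Proof. by rewrite /cons_omX !biso_compE !tpE. Qed.

Definition cons_omZ : bimodIso ((N \ox N1) \ox (M1 \ox M)) (tpowS Z m.+1) :=
  biso_comp (biso_sym (nuS Z m))
  (biso_comp (tens_iso omZ (biso_id Z))
  (biso_comp (biso_sym (assoc N M Z))
  (biso_comp (tens_iso (biso_id N) sM)
  (biso_comp (tens_iso (biso_id N) (tens_iso wY (biso_id M)))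
  (biso_comp (tens_iso (biso_id N) (biso_sym (assoc N1 M1 M)))
     (assoc N N1 (M1 \ox M))))))).

Lemma cons_omZE b n1 m1 a :
  cons_omZ (tp (tp b n1) (tp m1 a)) =
  biso_sym (nuS Z m) (tens_iso omZ (biso_id Z) (biso_sym (assoc N M Z)
    (tp b (sM (tp (wY (tp n1 m1)) a))))).
Proof. by rewrite /cons_omZ !biso_compE !tpE. Qed.

(** The last part of [cons_omX], with a factor X left over on the right. *)
Definition cons_glue : bimodIso (M1 \ox (N1 \ox (tpowS X m \ox X)))
    (tpowS X m.+1 \ox X) :=
  biso_comp (biso_sym (assoc X (tpowS X m) X))
  (biso_comp (tens_iso wX (biso_id (tpowS X m \ox X)))
     (biso_sym (assoc M1 N1 (tpowS X m \ox X)))).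

Lemma cons_glueE m1 n1 q :
  cons_glue (tp m1 (tp n1 q)) =
  biso_sym (assoc X (tpowS X m) X) (tp (wX (tp m1 n1)) q).
Proof. by rewrite /cons_glue !biso_compE !tpE. Qed.

(** By [step_sharp], x (x) wX (m1 (x) n1) can be recovered from
    [step_iso wX wY (x (x) m1)] and n1, so that x and m1 enter the right side of
    the first identity only through the element with which its left side
    starts. *)
Lemma cons_nuX x m1 a b n1 :
  nuS X m.+1 (tp x (cons_omX (tp (tp m1 a) (tp b n1)))) =
  cons_glue (tens_iso (biso_id M1)
      (tens_iso (biso_id N1) (nuS X m))
    (tens_iso (biso_id M1) (slide s2 (tpowS X m))
      (assoc M1 Y (N1 \ox tpowS X m)
        (tp (s1 (tp x m1)) (kap (tp (omY (tp a b)) n1)))))).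
Proof.
rewrite cons_omXE; move: (kap _) => t; pure_tensor t n' q.
rewrite !tpE nuS_succE.
transitivity (biso_sym (assoc X (tpowS X m) X)
  (tens_iso (biso_id X) (nuS X m) (assoc X X (tpowS X m)
    (tp (tp x (wX (tp m1 n'))) q)))); first by rewrite !tpE.
rewrite -(step_sharp wX wY) sharpE.
move: (s1 _) => t; pure_tensor t m1' y; rewrite !tpE slideE.
move: (s2 _) => t; pure_tensor t n'' x''; rewrite !tpE.
by rewrite cons_glueE.
Qed.

(** After [cons_nuX], the compatibility of [powS_iso] with nu and the identity
    [hY] for Y turn one side into the other. *)
Lemma cons_sharpX x m1 a b n1 :
  tens_iso cons_omX (biso_id X) (sharp (sharp s1 sM) (sharp sN s2)
    (tp x (tp (tp m1 a) (tp b n1)))) =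
  nuS X m.+1 (tp x (cons_omX (tp (tp m1 a) (tp b n1)))).
Proof.
rewrite cons_nuX sharpE [sharp s1 sM _]sharpE.
move: (s1 _) => t; pure_tensor t m1' y; rewrite !tpE.
rewrite -powS_iso_nu -hY sharpE.
move: (sM _) => t; pure_tensor t a' z; rewrite !tpE sharpE.
move: (sN _) => t; pure_tensor t b' y'; rewrite !tpE.
move: (s2 _) => t; pure_tensor t n1' x'; rewrite !tpE slideE cons_omXE.
by move: (kap _) => t; pure_tensor t n2 r; rewrite !tpE cons_glueE tpE.
Qed.

(** The middle of Z (x) N (x) N1 (x) M1 (x) M is handled by [step_sharp], which
    lets a factor Y jump over N1 (x) M1 unchanged; what remains is the identity
    [hZ]. The two intermediate expressions reorganise both sides around the
    value of sN on z (x) b. *)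
Lemma cons_sharpZ z b n1 m1 a :
  tens_iso cons_omZ (biso_id Z) (sharp (sharp sN s2) (sharp s1 sM)
    (tp z (tp (tp b n1) (tp m1 a)))) =
  nuS Z m.+1 (tp z (cons_omZ (tp (tp b n1) (tp m1 a)))).
Proof.
rewrite cons_omZE nuS_succE biso_symVK.
rewrite sharpE [sharp sN s2 _]sharpE.
transitivity (tens_iso (biso_sym (nuS Z m)) (biso_id Z)
  (tens_iso (tens_iso omZ (biso_id Z)) (biso_id Z)
  (tens_iso (biso_sym (assoc N M Z)) (biso_id Z)
  (biso_sym (assoc N (M \ox Z) Z)
  (tens_iso (biso_id N) (tens_iso sM (biso_id Z))
  (tens_iso (biso_id N) (biso_sym (assoc Y M Z))
  (assoc N Y (M \ox Z) (tp (sN (tp z b)) (sM (tp (wY (tp n1 m1)) a)))))))))).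
  move: (sN _) => t; pure_tensor t b' y'; rewrite !tpE.
  transitivity (tens_iso (biso_sym (nuS Z m)) (biso_id Z)
    (tens_iso (tens_iso omZ (biso_id Z)) (biso_id Z)
    (tens_iso (biso_sym (assoc N M Z)) (biso_id Z)
    (biso_sym (assoc N (M \ox Z) Z)
    (tp b' (biso_sym (assoc M Z Z) (slide sM Z
      (tens_iso (biso_id Y) sM (assoc Y Y M
      (tp (tp y' (wY (tp n1 m1))) a)))))))))).
    rewrite -(step_sharp wY wX) sharpE.
    move: (s2 _) => t; pure_tensor t n1' x'; rewrite !tpE sharpE.
    move: (s1 _) => t; pure_tensor t m1' y''; rewrite !tpE.
    move: (sM (tp y'' a)) => t; pure_tensor t a'' z''; rewrite !tpE.
    rewrite cons_omZE slideE.
    by move: (sM _) => t; pure_tensor t a' z'; rewrite !tpE.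
  rewrite !tpE; move: (sM (tp _ a)) => t; pure_tensor t a' z'.
  rewrite slideE !tpE.
  by move: (sM _) => t; pure_tensor t a1 z1; rewrite !tpE.
move: (sM (tp _ a)) => t; pure_tensor t a' z'; rewrite !tpE.
rewrite -[tp z (omZ _)](biso_symK (nuS Z m)) -hZ sharpE.
by move: (sN _) => t; pure_tensor t b' y'; rewrite !tpE.
Qed.

End AlignedCons.

Lemma aligned_cons (k : fieldType) (A B C : kalgebra k)
    (X : bimod A A) (Y : bimod B B) (Z : bimod C C)
    (M1 : bimod A B) (N1 : bimod B A)
    (wX : bimodIso (M1 \ox N1) X) (wY : bimodIso (N1 \ox M1) Y) :
  aligned Y Z -> aligned X Z.
Proof.
case=> M [N] [[|m]] [omY] [omZ] [sM] [sN] [// _ hY hZ].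
have {}hY y a b : tens_iso omY (biso_id Y) (sharp sM sN (tp y (tp a b))) =
    nuS Y m (tp y (omY (tp a b))).
  transitivity (nuS Y m (tens_iso (biso_id Y) omY (tp y (tp a b)))).
    exact: hY.
  by rewrite tens_isoEp.
have {}hZ z b a : tens_iso omZ (biso_id Z) (sharp sN sM (tp z (tp b a))) =
    nuS Z m (tp z (omZ (tp b a))).
  transitivity (nuS Z m (tens_iso (biso_id Z) omZ (tp z (tp b a)))).
    exact: hZ.
  by rewrite tens_isoEp.
exists (M1 \ox M), (N \ox N1), m.+2, (cons_omX wX wY omY),
  (cons_omZ wY omZ sM), (sharp (step_iso wX wY) sM),
  (sharp sN (step_iso wY wX)).
split=> //.
- apply: (@tp_eq3 _ _ _ _ _ X (M1 \ox M) (N \ox N1) (tpowS X m.+1 \ox X)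
    (biso_comp (tens_iso (cons_omX wX wY omY) (biso_id X))
      (sharp (sharp (step_iso wX wY) sM) (sharp sN (step_iso wY wX))))
    (biso_comp (nuS X m.+1)
      (tens_iso (biso_id X) (cons_omX wX wY omY)))) => x u v.
  pure_tensor u m1 a; pure_tensor v b n1.
  by rewrite !biso_compE cons_sharpX // tens_isoEp.
- apply: (@tp_eq3 _ _ _ _ _ Z (N \ox N1) (M1 \ox M) (tpowS Z m.+1 \ox Z)
    (biso_comp (tens_iso (cons_omZ wY omZ sM) (biso_id Z))
      (sharp (sharp sN (step_iso wY wX)) (sharp (step_iso wX wY) sM)))
    (biso_comp (nuS Z m.+1)
      (tens_iso (biso_id Z) (cons_omZ wY omZ sM)))) => x u v.
  pure_tensor u b n1; pure_tensor v m1 a.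
  by rewrite !biso_compE cons_sharpZ // tens_isoEp.
Qed.

(** * Bimodules of bipartite multigraphs *)

Record bigraph (V W : finType) := Bigraph {
  bsize : nat;
  bsrc : 'I_bsize -> V;
  brng : 'I_bsize -> W
}.

(** The matrix equation A_E = R S, made into a bijection. *)
Record factors (E : graph) (W : finType)
    (R : bigraph (vert E) W) (S : bigraph W (vert E)) := Factors {
  fst_half : edge E -> 'I_(bsize R);
  snd_half : edge E -> 'I_(bsize S);
  half_src : forall e, src e = bsrc (fst_half e);
  half_mid : forall e, brng (fst_half e) = bsrc (snd_half e);
  half_rng : forall e, rng e = brng (snd_half e);
  half_inj : forall e f,
    fst_half e = fst_half f -> snd_half e = snd_half f -> e = f;
  half_surj : forall r s, brng r = bsrc s ->
    exists e, fst_half e = r /\ snd_half e = s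
}.

Section LinearTensors.
Variables (k : fieldType) (A B C : kalgebra k).
Variables (X : bimod A B) (Y : bimod B C).

Lemma tpZl c (x : X) (y : Y) : tp (c *: x) y = c *: tp x y.
Proof.
by rewrite -[RHS]/(tens_lact (kalg_in A c) (tpure x y)) tens_lact_pure lactZ.
Qed.

Lemma tpZr c (x : X) (y : Y) : tp x (c *: y) = c *: tp x y.
Proof. by rewrite -tpZl -(ractZ c x) -(lactZ c y) /tp tpure_bal. Qed.

Lemma tp_suml (I : Type) (r : seq I) (P : pred I) (G : I -> X) (y : Y) :
  tp (\sum_(i <- r | P i) G i) y = \sum_(i <- r | P i) tp (G i) y.
Proof.
by apply: (big_morph (fun x => tp x y)) => [a b|]; [apply: tpDl | apply: tp0l].
Qed.

Lemma tp_sumr (I : Type) (r : seq I) (P : pred I) (G : I -> Y) (x : X) :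
  tp x (\sum_(i <- r | P i) G i) = \sum_(i <- r | P i) tp x (G i).
Proof. by apply: (big_morph (tp x)) => [a b|]; [apply: tpDr | apply: tp0r]. Qed.

End LinearTensors.

(** The edges of E index exactly the nonvanishing terms. *)
Lemma factors_sum (E : graph) (W : finType) (R : bigraph (vert E) W)
    (S : bigraph W (vert E)) (fct : factors R S) (V : zmodType)
    (G : 'I_(bsize R) -> 'I_(bsize S) -> V) :
    (forall r s, brng r != bsrc s -> G r s = 0) ->
  \sum_r \sum_s G r s = \sum_e G (fst_half fct e) (snd_half fct e).
Proof.
move=> G0; rewrite pair_big /=.
pose h e := (fst_half fct e, snd_half fct e).
have hinj : injective h by move=> e f [/half_inj h1 /h1].
rewrite (bigID [in h @: [set: edge E]]) /= [X in _ + X]big1 ?addr0; last first.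
  case=> r s rs; apply: G0; apply: contra rs => /eqP/(half_surj fct)[e [e1 e2]].
  by apply/imsetP; exists e; rewrite ?inE // /h e1 e2.
rewrite big_imset /=; last by move=> e f _ _ /hinj.
by apply: eq_bigl => e; rewrite inE.
Qed.

Section BigraphBimodule.
Variables (k : fieldType) (E F : graph) (R : bigraph (vert E) (vert F)).

Definition kbigraph_lact (a : kE0 k E) (x : {ffun 'I_(bsize R) -> k^o}) :
  {ffun 'I_(bsize R) -> k^o} := [ffun r => a (bsrc r) * x r].
Definition kbigraph_ract (x : {ffun 'I_(bsize R) -> k^o}) (b : kE0 k F) :
  {ffun 'I_(bsize R) -> k^o} := [ffun r => x r * b (brng r)].

(** The analogue of kE^1 for a multigraph from E^0 to F^0. *)
Definition kbigraph : bimod (kE0 k E) (kE0 k F).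
Proof.
apply: (@Bimod k (kE0 k E) (kE0 k F) {ffun 'I_(bsize R) -> k^o}
  kbigraph_lact kbigraph_ract).
- by move=> a x y; apply/ffunP => e; rewrite !ffunE mulrDr.
- by move=> a b x; apply/ffunP => e; rewrite !ffunE mulrDl.
- by move=> x; apply/ffunP => e; rewrite !ffunE mul1r.
- by move=> a b x; apply/ffunP => e; rewrite !ffunE mulrA.
- by move=> x y b; apply/ffunP => e; rewrite !ffunE mulrDl.
- by move=> x a b; apply/ffunP => e; rewrite !ffunE mulrDr.
- by move=> x; apply/ffunP => e; rewrite !ffunE mulr1.
- by move=> x a b; apply/ffunP => e; rewrite !ffunE mulrA.
- by move=> a x b; apply/ffunP => e; rewrite !ffunE mulrA.
- by move=> c x; apply/ffunP => e; rewrite !ffunE.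
- by move=> c x; apply/ffunP => e; rewrite !ffunE mulrC.
Defined.

Definition kbigraph_edge (r : 'I_(bsize R)) : kbigraph :=
  [ffun r' => (r' == r)%:R].

Lemma kbigraph_sum (x : kbigraph) :
  x = \sum_r x r *: kbigraph_edge r.
Proof.
apply/ffunP => r; rewrite sum_ffunE (bigD1 r) //= big1 ?addr0.
  by rewrite !ffunE eqxx [RHS]mulr1.
by move=> r' /negPf r'r; rewrite !ffunE eq_sym r'r [LHS]mulr0.
Qed.

Lemma kbigraph_edge_ract r w :
  ract (kbigraph_edge r) (kE0_vert k w) = kbigraph_edge r *+ (w == brng r).
Proof.
apply/ffunP => f; rewrite ffunMnE !ffunE /=.
case: (eqVneq f r) => [->|_]; last by rewrite mul0r mul0rn.
by rewrite mul1r eq_sym.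
Qed.

Lemma kbigraph_edge_lact r w :
  lact (kE0_vert k w) (kbigraph_edge r) = kbigraph_edge r *+ (w == bsrc r).
Proof.
apply/ffunP => f; rewrite ffunMnE !ffunE /=.
case: (eqVneq f r) => [->|_]; last by rewrite mulr0 mul0rn.
by rewrite mulr1 eq_sym.
Qed.

End BigraphBimodule.

Arguments kbigraph k {E F} R.
Arguments kbigraph_edge k {E F R} r.

Section Factorization.
Variables (k : fieldType) (E F : graph).
Variables (R : bigraph (vert E) (vert F)) (S : bigraph (vert F) (vert E)).
Variable fct : factors R S.

Definition compose_halves (x : kbigraph k R) (y : kbigraph k S) : kE1 k E :=
  [ffun e => x (fst_half fct e) * y (snd_half fct e)].

Fact compose_halvesDl x x' y :
  compose_halves (x + x') y = compose_halves x y + compose_halves x' y.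
Proof. by apply/ffunP => e; rewrite !ffunE mulrDl. Qed.

Fact compose_halvesDr x y y' :
  compose_halves x (y + y') = compose_halves x y + compose_halves x y'.
Proof. by apply/ffunP => e; rewrite !ffunE mulrDr. Qed.

Fact compose_halves_bal x b y :
  compose_halves (ract x b) y = compose_halves x (lact b y).
Proof. by apply/ffunP => e; rewrite !ffunE (half_mid fct) mulrA. Qed.

Definition factor_fun : kbigraph k R \ox kbigraph k S -> kE1 k E :=
  tens_lift compose_halves.

Lemma factor_funD : {morph factor_fun : t u / t + u}.
Proof.
apply: tens_liftD; [exact: compose_halvesDl | exact: compose_halvesDr
  | exact: compose_halves_bal].
Qed.

Lemma factor_funE x y : factor_fun (tp x y) = compose_halves x y.
Proof.
apply: tens_lift_pure; [exact: compose_halvesDl | exact: compose_halvesDr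
  | exact: compose_halves_bal].
Qed.

Lemma factor_fun0 : factor_fun 0 = 0.
Proof. by apply: (addrI (factor_fun 0)); rewrite -factor_funD !addr0. Qed.

Definition factor_hom : bimodHom (kbigraph k R \ox kbigraph k S) (kE1 k E).
Proof.
apply: (@BimodHom _ _ _ (kbigraph k R \ox kbigraph k S) (kE1 k E) factor_fun).
- exact: factor_funD.
- move=> a; elim/tpB_ind => [|x y t IH].
    by rewrite lact0r factor_fun0 lact0r.
  rewrite lactDr !factor_funD IH lactDr; congr (_ + _).
  rewrite -[lact a _]/(tens_lact a (tpure x y)) tens_lact_pure -/(tp _ _).
  rewrite !factor_funE; apply/ffunP => e.
  by rewrite !ffunE (half_src fct) mulrA.
- move=> + b; elim/tpB_ind => [|x y t IH].
    by rewrite ract0l factor_fun0 ract0l.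
  rewrite ractDl !factor_funD IH ractDl; congr (_ + _).
  rewrite -[ract _ b]/(tens_ract (tpure x y) b) tens_ract_pure -/(tp _ _).
  rewrite !factor_funE; apply/ffunP => e.
  by rewrite !ffunE (half_rng fct) mulrA.
Defined.

Definition split_edge (e : edge E) : kbigraph k R \ox kbigraph k S :=
  tp (kbigraph_edge k (fst_half fct e)) (kbigraph_edge k (snd_half fct e)).

Definition factor_inv (z : kE1 k E) : kbigraph k R \ox kbigraph k S :=
  \sum_e z e *: split_edge e.

Lemma compose_edge e :
  compose_halves (kbigraph_edge k (fst_half fct e))
    (kbigraph_edge k (snd_half fct e)) =
  kE1_edge k e.
Proof.
apply/ffunP => f; rewrite !ffunE.
case: (eqVneq f e) => [->|fe]; first by rewrite !eqxx mulr1.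
case: eqVneq => [e1|_]; last by rewrite mul0r.
case: eqVneq => [e2|_]; last by rewrite mulr0.
by rewrite (half_inj e1 e2) eqxx in fe.
Qed.

(** The vertex at the end of r acts as the identity on r and kills s. *)
Lemma tp_edge0 r s : brng r != bsrc s ->
  tp (kbigraph_edge k r : kbigraph k R) (kbigraph_edge k s : kbigraph k S) = 0.
Proof.
move=> rs; have := @kbigraph_edge_ract k E F R r (brng r).
rewrite eqxx mulr1n => <-.
rewrite /tp tpure_bal kbigraph_edge_lact (negPf rs) mulr0n; exact: tp0r.
Qed.

Lemma factor_invE x y : factor_inv (compose_halves x y) = tp x y.
Proof.
rewrite [in RHS](kbigraph_sum x) [in RHS](kbigraph_sum y) tp_suml.
under [in RHS]eq_bigr do rewrite tp_sumr.
rewrite (factors_sum fct) => [|r s rs]; last first.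
  by rewrite tpZl tpZr tp_edge0 // !scaler0.
by apply: eq_bigr => e _; rewrite ffunE tpZl tpZr scalerA.
Qed.

Lemma factor_invD : {morph factor_inv : z z' / z + z'}.
Proof.
move=> z z'; rewrite /factor_inv -big_split /=.
by apply: eq_bigr => e _; rewrite ffunE scalerDl.
Qed.

Lemma factor_fun_edge c e : factor_fun (c *: split_edge e) = c *: kE1_edge k e.
Proof.
transitivity (factor_fun (tp (c *: kbigraph_edge k (fst_half fct e))
  (kbigraph_edge k (snd_half fct e)))); first by rewrite tpZl.
rewrite factor_funE -compose_edge; apply/ffunP => f; rewrite !ffunE.
by rewrite -[LHS]mulrA.
Qed.

(** kR (x) kS has a basis of composable pairs, because the other pairs give zero
    ([tp_edge0]). *)
Definition factor_iso : bimodIso (kbigraph k R \ox kbigraph k S) (kE1 k E).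
Proof.
apply: (@BimodIso _ _ _ _ _ factor_hom factor_inv).
- elim/tpB_ind => [|x y t IH].
    rewrite bhom0; apply: (addrI (factor_inv 0)).
    by rewrite -factor_invD !addr0.
  by rewrite bhomD factor_invD IH [factor_hom _]factor_funE factor_invE.
- move=> z; rewrite /= /factor_inv (big_morph _ factor_funD factor_fun0).
  under eq_bigr do rewrite factor_fun_edge.
  apply/ffunP => e; rewrite sum_ffunE (bigD1 e) //=.
  rewrite big1 ?addr0 => [|f /negPf fe].
    by rewrite !ffunE eqxx [LHS]mulr1.
  by rewrite !ffunE eq_sym fe [LHS]mulr0.
Defined.

End Factorization.

Lemma aligned_factors (k : fieldType) (E F : graph)
    (R : bigraph (vert E) (vert F)) (S : bigraph (vert F) (vert E)) :
  factors R S -> factors S R -> aligned (kE1 k E) (kE1 k F).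
Proof.
move=> fE fF; exact: aligned_elementary (factor_iso k fE) (factor_iso k fF).
Qed.

(** * Functors between graded modules defined by matrix representations *)

(** Right modules are left modules over the converse ring; [x ** a] displays the
    action on the right, in the order in which products act. *)
Definition rmul (R : pzRingType) (M : lmodType R^c) (x : M) (a : R) : M :=
  (a : R^c) *: x.

Notation "x ** a" := (rmul x a) (at level 40, left associativity).

Section RightModules.
Variables (R : pzRingType) (M : lmodType R^c).
Implicit Types (x y : M) (a b : R).

Lemma rmulDl x y a : (x + y) ** a = x ** a + y ** a.
Proof. exact: scalerDr. Qed.

Lemma rmulBl x y a : (x - y) ** a = x ** a - y ** a.
Proof. exact: scalerBr. Qed.

Lemma rmulDr x a b : x ** (a + b) = x ** a + x ** b.
Proof. exact: scalerDl. Qed.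

Lemma rmulA x a b : x ** a ** b = x ** (a * b).
Proof. exact: scalerA. Qed.

Lemma rmul1 x : x ** 1 = x.
Proof. exact: scale1r. Qed.

Lemma rmul0l a : (0 : M) ** a = 0.
Proof. exact: scaler0. Qed.

Lemma rmul0r x : x ** 0 = 0.
Proof. exact: scale0r. Qed.

Lemma rmul_suml (I : Type) (r : seq I) (P : pred I) (F : I -> M) a :
  (\sum_(i <- r | P i) F i) ** a = \sum_(i <- r | P i) F i ** a.
Proof. exact: scaler_sumr. Qed.

Lemma rmul_sumr (I : Type) (r : seq I) (P : pred I) (F : I -> R) x :
  x ** (\sum_(i <- r | P i) F i) = \sum_(i <- r | P i) x ** F i.
Proof.
by apply: (big_morph (rmul x)) => [a b|]; [apply: rmulDr | apply: rmul0r].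
Qed.

Lemma rmul_linear (N : lmodType R^c) (f : {linear M -> N}) x a :
  f (x ** a) = f x ** a.
Proof. exact: linearZ. Qed.

End RightModules.

(** A homomorphism from S to matrices over R that need not preserve 1: rho(1) is
    then an idempotent matrix, and a projective R-module on which S acts. *)
Record matRep (R S : pzRingType) := MatRep {
  rep_dim : nat;
  rep_mx :> S -> 'M[R]_rep_dim;
  repD : {morph rep_mx : a b / a + b};
  repM : {morph rep_mx : a b / a * b >-> a *m b}
}.

Section Corner.
Variables (R S : pzRingType) (rho : matRep R S).
Local Notation n := (rep_dim rho).

Section CornerModule.
Variable M : lmodType R^c.

Definition rowmul (x : {ffun 'I_n -> M}) (A : 'M[R]_n) : {ffun 'I_n -> M} :=
  [ffun j => \sum_i x i ** A i j].

Lemma rowmulDl x y A : rowmul (x + y) A = rowmul x A + rowmul y A.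
Proof.
apply/ffunP => j; rewrite !ffunE -big_split; apply: eq_bigr => i _.
by rewrite ffunE rmulDl.
Qed.

Lemma rowmulBl x y A : rowmul (x - y) A = rowmul x A - rowmul y A.
Proof.
apply/ffunP => j; rewrite !ffunE -sumrB; apply: eq_bigr => i _.
by rewrite !ffunE rmulBl.
Qed.

Lemma rowmulDr x A B : rowmul x (A + B) = rowmul x A + rowmul x B.
Proof.
apply/ffunP => j; rewrite !ffunE -big_split; apply: eq_bigr => i _.
by rewrite mxE rmulDr.
Qed.

Lemma rowmulA x A B : rowmul (rowmul x A) B = rowmul x (A *m B).
Proof.
apply/ffunP => j; rewrite !ffunE.
under eq_bigr do rewrite ffunE rmul_suml.
rewrite exchange_big; apply: eq_bigr => i _.
by rewrite mxE rmul_sumr; apply: eq_bigr => l _; rewrite rmulA.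
Qed.

(** M^n rho(1), the set of row vectors over M on which rho(1) acts as the
    identity, is M tensored over R with the projective module R^n rho(1). *)
Definition in_corner : {pred {ffun 'I_n -> M}} :=
  fun x => rowmul x (rho 1) == x.

Fact in_corner_zmod : zmod_closed in_corner.
Proof.
split=> [|x y /eqP hx /eqP hy].
  apply/eqP/ffunP => j; rewrite !ffunE big1 // => i _.
  by rewrite ffunE rmul0l.
by apply/eqP; rewrite rowmulBl hx hy.
Qed.
HB.instance Definition _ :=
  GRing.isZmodClosed.Build {ffun 'I_n -> M} in_corner in_corner_zmod.

Record corner := Corner { corner_val :> {ffun 'I_n -> M};
                          cornerP : in_corner corner_val }.
HB.instance Definition _ := [isSub for corner_val].
HB.instance Definition _ := [Choice of corner by <:].
HB.instance Definition _ := [SubChoice_isSubZmodule of corner by <:].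

Lemma corner_id (x : corner) : rowmul x (rho 1) = x.
Proof. exact/eqP/cornerP. Qed.

Fact corner_act_subproof (a : S) (x : corner) : in_corner (rowmul x (rho a)).
Proof. by apply/eqP; rewrite rowmulA -repM mulr1. Qed.

Definition corner_act (a : S^c) (x : corner) : corner :=
  Corner (corner_act_subproof a x).

Fact corner_actA a b v :
  corner_act a (corner_act b v) = corner_act (a * b) v.
Proof. by apply: val_inj; rewrite /= rowmulA -repM. Qed.

Fact corner_act1 : left_id 1 corner_act.
Proof. by move=> x; apply: val_inj; rewrite /= corner_id. Qed.

Fact corner_actDr : right_distributive corner_act +%R.
Proof. by move=> a x y; apply: val_inj; rewrite /= rowmulDl. Qed.

Fact corner_actDl v : {morph corner_act^~ v : a b / a + b}.
Proof. by move=> a b; apply: val_inj; rewrite /= repD rowmulDr. Qed.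

HB.instance Definition _ := GRing.Zmodule_isLmodule.Build S^c corner
  corner_actA corner_act1 corner_actDr corner_actDl.

Lemma corner_rmulE (x : corner) (a : S) j :
  (x ** a) j = \sum_i x i ** rho a i j.
Proof. by rewrite ffunE. Qed.

Lemma cornerDE (x y : corner) j : (x + y) j = x j + y j.
Proof. by rewrite ffunE. Qed.

Lemma cornerBE (x y : corner) j : (x - y) j = x j - y j.
Proof. by rewrite /= !ffunE. Qed.

Lemma corner0E j : (0 : corner) j = 0.
Proof. by rewrite ffunE. Qed.

Lemma corner_ext (x y : corner) : x =1 y -> x = y.
Proof. by move=> xy; apply: val_inj; apply/ffunP. Qed.

Lemma corner_sumE (I : Type) (r : seq I) (P : pred I) (F : I -> corner) j :
  (\sum_(i <- r | P i) F i) j = \sum_(i <- r | P i) F i j.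
Proof.
apply: (big_morph (fun x : corner => x j)) => [x y|].
  exact: cornerDE.
exact: corner0E.
Qed.

End CornerModule.

Section CornerMap.
Variables (M N : lmodType R^c) (f : {linear M -> N}).

Fact corner_map_subproof (x : corner M) :
  in_corner [ffun i => f (x i)].
Proof.
apply/eqP/ffunP => j; rewrite !ffunE -[in RHS](corner_id x) ffunE linear_sum.
by apply: eq_bigr => i _; rewrite ffunE rmul_linear.
Qed.

Definition corner_map (x : corner M) : corner N :=
  Corner (corner_map_subproof x).

Lemma corner_mapE x i : corner_map x i = f (x i).
Proof. by rewrite ffunE. Qed.

Fact corner_map_linear : linear corner_map.
Proof.
move=> a x y; apply: corner_ext => j.
rewrite corner_mapE !cornerDE -![_ *: _]/(_ ** (a : S)) !corner_rmulE.
rewrite linearD /= linear_sum corner_mapE; congr (_ + _).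
by apply: eq_bigr => i _; rewrite corner_mapE rmul_linear.
Qed.
HB.instance Definition _ :=
  GRing.isLinear.Build S^c (corner M) (corner N) _ corner_map corner_map_linear.
End CornerMap.

End Corner.

Arguments in_corner {R S} rho {M} x.
Arguments corner_map {R S} rho {M N} f x.

Lemma direct_sum_sum (V : zmodType) (V_ : int -> V -> Prop) d (I : Type)
    (r : seq I) (P : pred I) (F : I -> V) : direct_sum V_ ->
  (forall i, P i -> V_ d (F i)) -> V_ d (\sum_(i <- r | P i) F i).
Proof.
case=> sub _ _ hF; have [V0 VB] := sub d.
apply: big_ind => // x y hx hy.
have -> : x + y = x - (0 - y) by rewrite sub0r opprK.
by apply: (VB) => //; apply: (VB).
Qed.

Section GradedCorner.
Variables (R S : gradedRing) (rho : matRep R S).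
Local Notation n := (rep_dim rho).
Hypothesis rho_deg : forall d a, gring_comp d a ->
  forall i j, gring_comp d (rho a i j).
Hypothesis rho_deg1 : forall i j, gring_comp 0 (rho 1 i j).

Section Object.
Variable M : gradedModule R.

Definition corner_comp (d : int) (x : corner rho M) : Prop :=
  forall i, gmod_comp d (x i).

(** A vector x = x rho(1) is the sum of the vectors (y at position i) rho(1) for
    the homogeneous components y of the entries x_i. These lie in the corner and
    are homogeneous since rho(1) has degree zero. *)
Lemma corner_direct : direct_sum corner_comp.
Proof.
have [sub gen ind] := gmod_direct M.
split=> [d||s f us hf sf0 d ds].
- have [V0 VB] := sub d; split=> [i|x y hx hy i].
    by rewrite corner0E.
  by rewrite cornerBE; apply: VB.
- move=> x.
  have hcut i (y : M) :
      in_corner rho (rowmul [ffun l => if l == i then y else 0] (rho 1)).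
    by apply/eqP; rewrite rowmulA -repM mulr1.
  pose cut i y := Corner (hcut i y).
  have cutE i y j : cut i y j = y ** rho 1 i j.
    rewrite ffunE (bigD1 i) //= ffunE eqxx big1 ?addr0 // => l /negPf li.
    by rewrite ffunE li rmul0l.
  have [s hs] := choice (fun i => gen (x i)).
  exists [seq cut i y | i <- enum 'I_n, y <- s i]; split=> [y|].
    case/allpairsPdep=> i [z [_ /(proj1 (hs i)) [d hd] ->]].
    exists d => j; rewrite cutE -[d]addr0; exact: gmod_act.
  apply: corner_ext => j; rewrite big_allpairs_dep corner_sumE big_enum /=.
  rewrite -[in LHS](corner_id x) ffunE; apply: eq_bigr => i _.
  rewrite [in LHS](proj2 (hs i)) rmul_suml corner_sumE.
  by apply: eq_bigr => y _; rewrite cutE.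
- apply: corner_ext => j; rewrite corner0E.
  apply: (ind s (fun d => f d j)) => // [i|]; first exact: hf.
  by rewrite -corner_sumE sf0 corner0E.
Qed.

Lemma corner_comp_act d e x (a : S) :
  corner_comp d x -> gring_comp e a -> corner_comp (d + e) (x ** a).
Proof.
move=> hx ha j; rewrite corner_rmulE; apply: direct_sum_sum => [|i _].
  exact: gmod_direct.
by apply: gmod_act => //; apply: rho_deg.
Qed.

Definition corner_gr : gradedModule S :=
  @GradedModule S (corner rho M) corner_comp corner_direct corner_comp_act.

End Object.

Lemma corner_map_deg (M N : gradedModule R) (f : gradedHom M N) d
    (x : corner rho M) :
  corner_comp d x -> corner_comp d (corner_map rho f x).
Proof. by move=> hx i; rewrite corner_mapE; apply: ghom_deg. Qed.

Definition corner_grmap (M N : gradedModule R) (f : gradedHom M N) :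
    gradedHom (corner_gr M) (corner_gr N) :=
  @GradedHom S (corner_gr M) (corner_gr N) (corner_map rho f)
    (@corner_map_deg M N f).

Definition corner_functor : functor (GrCat R) (GrCat S).
Proof.
apply: (@Functor (GrCat R) (GrCat S) corner_gr corner_grmap).
- move=> M; apply: gradedHom_ext => x; apply: corner_ext => i.
  exact: corner_mapE.
- move=> M N P g f; apply: gradedHom_ext => x; apply: corner_ext => i.
  by rewrite /= !ffunE.
Defined.

(** The grading of the corner is defined entrywise, hence the two modules have
    the same components and differ only in proofs. *)
Lemma corner_functor_graded : graded_functor corner_functor.
Proof.
move=> g M; rewrite /= /suspension /corner_gr.
by congr GradedModule; apply: Prop_irrelevance.
Qed.

End GradedCorner.

(** * The unit of a split pair of representations *)

(** The composite of the functors of rho and tau is the functor of the matrix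
    representation a |-> rho(tau(a)) of R over itself, with rows indexed by
    pairs (r, s). The row u and the column v are mutually inverse isomorphisms
    between this functor and the identity: [split_uv] and [split_vu] say that
    the composites are 1 and rho(tau(1)), and [split_lin] is R-linearity. *)
Record splitting (R S : pzRingType) (rho : matRep R S) (tau : matRep S R)
    (u v : 'I_(rep_dim tau) -> 'I_(rep_dim rho) -> R) : Prop := Splitting {
  split_lin : forall a r s,
    a * u r s = \sum_r' \sum_s' u r' s' * rho (tau a r' r) s' s;
  split_uv : \sum_r \sum_s u r s * v r s = 1;
  split_vu : forall r' s' r s, v r' s' * u r s = rho (tau 1 r' r) s' s
}.

Section Unit.
Variables (R S : pzRingType) (rho : matRep R S) (tau : matRep S R).
Variables (u v : 'I_(rep_dim tau) -> 'I_(rep_dim rho) -> R).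
Hypothesis uv : splitting u v.

Section Module.
Variable M : lmodType R^c.

(** By [split_lin] for a = 1, u = u rho(tau(1)); multiplying by rho(1) on the
    right does not change this. *)
Fact unit_inner_subproof (x : M) r : in_corner rho [ffun s => x ** u r s].
Proof.
apply/eqP/ffunP => s; rewrite !ffunE.
rewrite -[u r s]mul1r (split_lin uv) rmul_sumr.
under eq_bigr => s' _ do rewrite ffunE -[u r s']mul1r (split_lin uv) rmulA
  mulr_suml rmul_sumr.
rewrite exchange_big; apply: eq_bigr => r' _.
rewrite -rmul_sumr; congr (_ ** _).
under eq_bigr => s' _ do rewrite mulr_suml.
rewrite exchange_big; apply: eq_bigr => l _.
under eq_bigr => s' _ do rewrite -mulrA.
rewrite -mulr_sumr -[in RHS](mulr1 (tau 1 r' r)) repM mxE.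
by [].
Qed.

Definition unit_inner (x : M) r : corner rho M :=
  Corner (unit_inner_subproof x r).

Lemma unit_innerE x r s : unit_inner x r s = x ** u r s.
Proof. by rewrite ffunE. Qed.

Lemma unit_inner_act x a r :
  unit_inner (x ** a) r = \sum_r' unit_inner x r' ** tau a r' r.
Proof.
apply: corner_ext => s; rewrite unit_innerE corner_sumE rmulA (split_lin uv).
rewrite rmul_sumr; apply: eq_bigr => r' _; rewrite rmul_sumr corner_rmulE.
by apply: eq_bigr => s' _; rewrite unit_innerE rmulA.
Qed.

Fact unit_subproof (x : M) : in_corner tau [ffun r => unit_inner x r].
Proof.
apply/eqP/ffunP => r; rewrite !ffunE -[in RHS](rmul1 x) unit_inner_act.
by apply: eq_bigr => r' _; rewrite ffunE.
Qed.

Definition unit_map (x : M) : corner tau (corner rho M) :=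
  Corner (unit_subproof x).

Lemma unit_map_inner x r : unit_map x r = unit_inner x r.
Proof. by rewrite ffunE. Qed.

Lemma unit_mapE x r s : unit_map x r s = x ** u r s.
Proof. by rewrite !ffunE. Qed.

Fact unit_map_linear : linear unit_map.
Proof.
move=> a x y; apply: corner_ext => r.
rewrite cornerDE -![_ *: _]/(_ ** (a : R)) corner_rmulE.
apply: corner_ext => s; rewrite cornerDE corner_sumE !unit_mapE rmulDl.
congr (_ + _); transitivity (unit_inner (x ** (a : R)) r s).
  by rewrite unit_innerE.
rewrite unit_inner_act corner_sumE.
by apply: eq_bigr => r' _; rewrite unit_map_inner.
Qed.
HB.instance Definition _ :=
  GRing.isLinear.Build R^c M (corner tau (corner rho M)) _ unit_map
    unit_map_linear.

Definition unit_lin : {linear M -> corner tau (corner rho M)} := unit_map.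

Definition counit_map (y : corner tau (corner rho M)) : M :=
  \sum_r \sum_s y r s ** v r s.

Lemma unit_mapK : cancel unit_map counit_map.
Proof.
move=> x; rewrite /counit_map -[RHS]rmul1 -(split_uv uv) rmul_sumr.
apply: eq_bigr => r _; rewrite rmul_sumr; apply: eq_bigr => s _.
by rewrite unit_mapE rmulA.
Qed.

Lemma counit_mapK : cancel counit_map unit_map.
Proof.
move=> y; apply: corner_ext => r; apply: corner_ext => s.
rewrite unit_mapE rmul_suml -[in RHS](corner_id y) ffunE corner_sumE.
apply: eq_bigr => r' _; rewrite rmul_suml corner_rmulE.
by apply: eq_bigr => s' _; rewrite rmulA (split_vu uv).
Qed.

(** The inverse of a linear bijection is linear. *)
Fact counit_map_linear : linear counit_map.
Proof.
move=> a x y; apply: (can_inj unit_mapK).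
by rewrite linearP /= !counit_mapK.
Qed.
HB.instance Definition _ :=
  GRing.isLinear.Build R^c (corner tau (corner rho M)) M _ counit_map
    counit_map_linear.

Definition counit_lin : {linear corner tau (corner rho M) -> M} := counit_map.

End Module.

Lemma unit_map_natural (M N : lmodType R^c) (f : {linear M -> N}) x :
  unit_map (f x) = corner_map tau (corner_map rho f) (unit_map x).
Proof.
apply: corner_ext => r; apply: corner_ext => s.
by rewrite unit_mapE !corner_mapE unit_mapE rmul_linear.
Qed.

Lemma counit_map_natural (M N : lmodType R^c) (f : {linear M -> N}) y :
  counit_map (corner_map tau (corner_map rho f) y) = f (counit_map y).
Proof.
apply: (can_inj (@unit_mapK N)).
by rewrite unit_map_natural !counit_mapK.
Qed.

End Unit.

Section GradedUnit.
Variables (R S : gradedRing) (rho : matRep R S) (tau : matRep S R).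
Variables (u v : 'I_(rep_dim tau) -> 'I_(rep_dim rho) -> R).
Hypothesis uv : splitting u v.
Hypothesis u_deg : forall r s, gring_comp 1 (u r s).
Hypothesis v_deg : forall r s, gring_comp (-1) (v r s).
Variable M : gradedModule R.

Lemma unit_map_deg d (x : M) :
  gmod_comp d x -> forall r s, gmod_comp (1 + d) (unit_map uv x r s).
Proof. by move=> hx r s; rewrite unit_mapE addrC; apply: gmod_act. Qed.

Lemma counit_map_deg d (y : corner tau (corner rho M)) :
  (forall r s, gmod_comp (1 + d) (y r s)) -> gmod_comp d (counit_map v y).
Proof.
move=> hy; apply: direct_sum_sum => [|r _]; first exact: gmod_direct.
apply: direct_sum_sum => [|s _]; first exact: gmod_direct.
by rewrite -[d](addrK 1) [d + 1]addrC; apply: gmod_act.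
Qed.

End GradedUnit.

Lemma gradedModule_eq (R : gradedRing) (V : lmodType R^c)
    (V1 V2 : int -> V -> Prop) D1 D2 A1 A2 : V1 = V2 ->
  @GradedModule R V V1 D1 A1 = @GradedModule R V V2 D2 A2.
Proof.
move=> e; case: _ / e D2 A2 => D2 A2.
by congr GradedModule; apply: Prop_irrelevance.
Qed.

Lemma suspension_functor_graded (R : gradedRing) (h : int) :
  graded_functor (suspension_functor R h).
Proof.
move=> g M; apply: gradedModule_eq; apply/funext => n /=.
by rewrite addrCA.
Qed.

Lemma graded_functor_comp (R S T : gradedRing)
    (G : functor (GrCat S) (GrCat T)) (F : functor (GrCat R) (GrCat S)) :
  graded_functor G -> graded_functor F -> graded_functor (functor_comp G F).
Proof.
move=> gG gF g M.
by rewrite /= -[suspension _ _]/(suspension_functor T g _) gG gF.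
Qed.

(** As u has degree 1 and v degree -1, both composites of the corner functors
    are isomorphic to the suspension by -1; one of the functors is therefore
    suspended by 1. *)
Lemma geGr_splitting (R S : gradedRing) (rho : matRep R S) (tau : matRep S R)
    (u v : 'I_(rep_dim tau) -> 'I_(rep_dim rho) -> R)
    (u' v' : 'I_(rep_dim rho) -> 'I_(rep_dim tau) -> S) :
    (forall d a, gring_comp d a -> forall i j, gring_comp d (rho a i j)) ->
    (forall i j, gring_comp 0 (rho 1 i j)) ->
    (forall d a, gring_comp d a -> forall i j, gring_comp d (tau a i j)) ->
    (forall i j, gring_comp 0 (tau 1 i j)) ->
    splitting u v -> splitting u' v' ->
    (forall r s, gring_comp 1 (u r s)) ->
    (forall r s, gring_comp (-1) (v r s)) ->
    (forall r s, gring_comp 1 (u' r s)) ->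
    (forall r s, gring_comp (-1) (v' r s)) ->
  geGr R S.
Proof.
move=> rho_deg rho1 tau_deg tau1 uv uv' udeg vdeg u'deg v'deg.
pose Phi := corner_functor rho_deg rho1.
pose Gam := functor_comp (suspension_functor R 1) (corner_functor tau_deg tau1).
exists Phi, Gam; split.
- exact: corner_functor_graded.
- apply: graded_functor_comp; last exact: corner_functor_graded.
  exact: suspension_functor_graded.
- pose t (M : gradedModule R) : gradedHom (Gam (Phi M)) M :=
    @GradedHom R (Gam (Phi M)) M (counit_lin uv M)
      (fun d y hy => @counit_map_deg R S rho tau v vdeg M d y hy).
  pose w (M : gradedModule R) : gradedHom M (Gam (Phi M)) :=
    @GradedHom R M (Gam (Phi M)) (unit_lin uv M)
      (fun d x hx => @unit_map_deg R S rho tau u v uv udeg M d x hx).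
  exists t, w; split=> [M|M|M N f]; apply: gradedHom_ext => x.
  + exact: counit_mapK.
  + exact: unit_mapK.
  + exact: (@counit_map_natural _ _ _ _ _ _ uv M N f x).
- pose t (M : gradedModule S) : gradedHom (Phi (Gam M)) M :=
    @GradedHom S (Phi (Gam M)) M (counit_lin uv' M)
      (fun d y hy => @counit_map_deg S R tau rho v' v'deg M d y hy).
  pose w (M : gradedModule S) : gradedHom M (Phi (Gam M)) :=
    @GradedHom S M (Phi (Gam M)) (unit_lin uv' M)
      (fun d x hx => @unit_map_deg S R tau rho u' v' uv' u'deg M d x hx).
  exists t, w; split=> [M|M|M N f]; apply: gradedHom_ext => x.
  + exact: counit_mapK.
  + exact: unit_mapK.
  + exact: (@counit_map_natural _ _ _ _ _ _ uv' M N f x).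
Qed.

(** * Homomorphisms from Leavitt path algebras to matrix algebras *)

Section LpaLift.
Variables (k : fieldType) (F : graph) (A : kalgebra k).

(** Images of the generators that satisfy the relations of L_k(F). No condition
    is put on the unit: the images of the vertices may sum to a proper
    idempotent of A. *)
Record lpa_family := LpaFamily {
  fam_vert : vert F -> A;
  fam_edge : edge F -> A;
  fam_ghost : edge F -> A;
  fam_vertM : forall v u, fam_vert v * fam_vert u = fam_vert v *+ (v == u);
  fam_src_edge : forall e, fam_vert (src e) * fam_edge e = fam_edge e;
  fam_edge_rng : forall e, fam_edge e * fam_vert (rng e) = fam_edge e;
  fam_rng_ghost : forall e, fam_vert (rng e) * fam_ghost e = fam_ghost e;
  fam_ghost_src : forall e, fam_ghost e * fam_vert (src e) = fam_ghost e;
  fam_ck1 : forall e f,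
    fam_ghost e * fam_edge f = fam_vert (rng e) *+ (e == f);
  fam_ck2 : forall v,
    fam_vert v = \sum_(e | src e == v) fam_edge e * fam_ghost e
}.

Variable fam : lpa_family.

Fixpoint lpa_eval (x : lpa_term k F) : A :=
  match x with
  | LZero => 0
  | LVert v => fam_vert fam v
  | LEdge e => fam_edge fam e
  | LGhost e => fam_ghost fam e
  | LAdd x y => lpa_eval x + lpa_eval y
  | LScale c x => kalg_in A c * lpa_eval x
  | LMul x y => lpa_eval x * lpa_eval y
  end.

Lemma lpa_evalP x y : lpa_eq x y -> lpa_eval x = lpa_eval y.
Proof.
elim=> {x y} //=.
- by move=> x y z _ -> _ ->.
- by move=> x x' y y' _ -> _ ->.
- by move=> c x x' _ ->.
- by move=> x x' y y' _ -> _ ->.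
- by move=> x y z; rewrite addrA.
- by move=> x y; rewrite addrC.
- by move=> x; rewrite add0r.
- by move=> x; rewrite rmorphN rmorph1 mulN1r addNr.
- by move=> c d x; rewrite mulrA -rmorphM.
- by move=> x; rewrite rmorph1 mul1r.
- by move=> c x y; rewrite mulrDr.
- by move=> c d x; rewrite rmorphD mulrDl.
- by move=> x y z; rewrite mulrA.
- by move=> x y z; rewrite mulrDl.
- by move=> x y z; rewrite mulrDr.
- by move=> c x y; rewrite mulrA.
- by move=> c x y; rewrite !mulrA kalg_inC.
- by move=> v u; rewrite fam_vertM; case: eqP.
- by move=> e; rewrite fam_src_edge.
- by move=> e; rewrite fam_edge_rng.
- by move=> e; rewrite fam_rng_ghost.
- by move=> e; rewrite fam_ghost_src.
- by move=> e f; rewrite fam_ck1; case: eqP.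
- by move=> v; rewrite fam_ck2; elim/big_rec2: _ => //= e a x _ ->.
Qed.

Definition lpa_lift (a : lpa k F) : A := lpa_eval (lpa_repr a).

Lemma lpa_lift_pi x : lpa_lift (lpa_pi x) = lpa_eval x.
Proof. exact/lpa_evalP/lpa_reprP. Qed.

Lemma lpa_liftD : {morph lpa_lift : a b / a + b}.
Proof. by move=> a b; rewrite -[a + b]/(lpa_pi _) lpa_lift_pi. Qed.

Lemma lpa_lift0 : lpa_lift 0 = 0.
Proof. by rewrite -[0]/(lpa_pi _) lpa_lift_pi. Qed.

Lemma lpa_liftM : {morph lpa_lift : a b / a * b}.
Proof. by move=> a b; rewrite -[a * b]/(lpa_pi _) lpa_lift_pi. Qed.

Lemma lpa_liftZ c a : lpa_lift (c *: a) = kalg_in A c * lpa_lift a.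
Proof. by rewrite -[c *: a]/(lpa_pi _) lpa_lift_pi. Qed.

Lemma lpa_lift_vert v : lpa_lift (lpa_vert k v) = fam_vert fam v.
Proof. exact: lpa_lift_pi. Qed.

Lemma lpa_lift_edge e : lpa_lift (lpa_edge k e) = fam_edge fam e.
Proof. exact: lpa_lift_pi. Qed.

Lemma lpa_lift_ghost e : lpa_lift (lpa_ghost k e) = fam_ghost fam e.
Proof. exact: lpa_lift_pi. Qed.

Lemma lpa_lift_sum (I : Type) (r : seq I) (P : pred I) (G : I -> lpa k F) :
  lpa_lift (\sum_(i <- r | P i) G i) = \sum_(i <- r | P i) lpa_lift (G i).
Proof. exact: (big_morph lpa_lift lpa_liftD lpa_lift0). Qed.

Lemma lpa_lift1 : lpa_lift 1 = \sum_v fam_vert fam v.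
Proof.
rewrite -[1]/(\sum_v lpa_vert k v) lpa_lift_sum.
by apply: eq_bigr => v _; rewrite lpa_lift_vert.
Qed.

End LpaLift.

Section MatrixAlgebra.
Variables (k : fieldType) (E : graph) (n : nat).
Local Notation L := (lpa k E).

Definition mx_in (c : k) : 'M[L]_n := (c *: (1 : L))%:M.

Fact mx_in_zmod : zmod_morphism mx_in.
Proof. by move=> c d; rewrite /mx_in scalerBl raddfB. Qed.

Fact mx_in_monoid : monoid_morphism mx_in.
Proof.
split=> [|c d]; first by rewrite /mx_in scale1r.
by rewrite /mx_in -[RHS]scalar_mxM -lpa_scaleMl mul1r scalerA.
Qed.
HB.instance Definition _ :=
  GRing.isZmodMorphism.Build k 'M[L]_n mx_in mx_in_zmod.
HB.instance Definition _ :=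
  GRing.isMonoidMorphism.Build k 'M[L]_n mx_in mx_in_monoid.

Lemma mx_in_entry c (A : 'M[L]_n) i j : (mx_in c * A) i j = c *: A i j.
Proof.
rewrite -[mx_in c * A]/(mx_in c *m A) mul_scalar_mx mxE.
by rewrite -lpa_scaleMl mul1r.
Qed.

Fact mx_inC c A : mx_in c * A = A * mx_in c.
Proof.
apply/matrixP => i j; rewrite mx_in_entry -[A * _]/(A *m mx_in c) mxE.
rewrite (bigD1 j) //= big1 ?addr0 => [|l /negPf lj]; rewrite mxE ?lj.
  by rewrite eqxx -lpa_scaleMr mulr1.
by rewrite mulr0n mulr0.
Qed.

Definition mxalg : kalgebra k := @KAlgebra k 'M[L]_n mx_in mx_inC.

End MatrixAlgebra.

Section LpaMatRep.
Variables (k : fieldType) (E F : graph) (n : nat).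
Variable fam : lpa_family F (mxalg k E n).

Definition lpa_matrep : matRep (lpa k E) (lpa k F) :=
  @MatRep (lpa k E) (lpa k F) n (lpa_lift fam) (lpa_liftD fam) (lpa_liftM fam).

Lemma lpa_matrepZ c a i j : lpa_matrep (c *: a) i j = c *: lpa_matrep a i j.
Proof. by rewrite [in LHS]/lpa_matrep [LHS]/= lpa_liftZ mx_in_entry. Qed.

Local Notation homog := (@lpa_homog k E).

Lemma lpa_homog_sum (d : int) (I : Type) (r : seq I) (P : pred I)
    (G : I -> lpa k E) :
  (forall i, P i -> homog d (G i)) -> homog d (\sum_(i <- r | P i) G i).
Proof.
by move=> hG; apply: big_ind => //; [apply: lpa_homog0 | apply: lpa_homog_add].
Qed.

Hypothesis deg_vert : forall v i j, homog 0 (fam_vert fam v i j).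
Hypothesis deg_edge : forall e i j, homog 1 (fam_edge fam e i j).
Hypothesis deg_ghost : forall e i j, homog (-1) (fam_ghost fam e i j).

Lemma lpa_matrep_deg1 i j : homog 0 (lpa_matrep 1 i j).
Proof.
rewrite /= lpa_lift1 summxE; apply: lpa_homog_sum => v _; exact: deg_vert.
Qed.

Lemma mx_homog_mul d e (A B : 'M[lpa k E]_n) :
  (forall i j, homog d (A i j)) -> (forall i j, homog e (B i j)) ->
  forall i j, homog (d + e) ((A *m B) i j).
Proof.
move=> hA hB i j; rewrite mxE; apply: lpa_homog_sum => l _.
exact: lpa_homog_mul.
Qed.

(** It suffices to know the degrees of the entries on generators, as entries of
    products are sums of products of entries. *)
Lemma lpa_matrep_deg d a : lpa_homog d a ->
  forall i j, homog d (lpa_matrep a i j).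
Proof.
elim=> {a} [|c v p w q a _ _ <- _ IH] i j.
  by rewrite /= lpa_lift0 mxE; apply: lpa_homog0.
rewrite repD mxE; apply: lpa_homog_add => //.
rewrite lpa_matrepZ; apply: lpa_homog_scale; rewrite repM {IH}.
move: i j; apply: mx_homog_mul => i j.
  rewrite -[_%:Z]add0r repM; move: i j; apply: mx_homog_mul => i j.
    by rewrite /= lpa_lift_vert.
  elim: p i j => [|e p IHp] i j.
    by rewrite big_nil; apply: lpa_matrep_deg1.
  rewrite big_cons /= intS -[lpa_lift fam]/(rep_mx lpa_matrep) repM.
  by move: i j; apply: mx_homog_mul => // i j; rewrite /= lpa_lift_edge.
rewrite -[- _]addr0 -[size q]size_rev repM.
move: i j; apply: mx_homog_mul => i j; last by rewrite /= lpa_lift_vert.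
elim: (rev q) i j => [|e s IHs] i j.
  by rewrite big_nil; apply: lpa_matrep_deg1.
rewrite big_cons /= intS opprD -[lpa_lift fam]/(rep_mx lpa_matrep) repM.
by move: i j; apply: mx_homog_mul => // i j; rewrite /= lpa_lift_ghost.
Qed.

End LpaMatRep.

(** * Transfer of Leavitt path algebras along a factorization *)

Section HalfEdges.
Variables (k : fieldType) (E : graph) (W : finType).
Variables (R : bigraph (vert E) W) (S : bigraph W (vert E)).
Variable fct : factors R S.
Local Notation L := (lpa k E).
Local Notation V := (lpa_vert k).

(** The edge (r, s) of E, or 0 if r and s are not composable: there is at most
    one term in the sum. *)
Definition pair_edge r s : L :=
  \sum_(e | (fst_half fct e == r) && (snd_half fct e == s)) lpa_edge k e.

Definition pair_ghost r s : L :=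
  \sum_(e | (fst_half fct e == r) && (snd_half fct e == s)) lpa_ghost k e.

Lemma pair_edgeE e : pair_edge (fst_half fct e) (snd_half fct e) = lpa_edge k e.
Proof.
rewrite /pair_edge (big_pred1 e) // => f.
apply/andP/eqP => [[/eqP h1 /eqP h2]|->]; first exact: half_inj h1 h2.
by rewrite !eqxx.
Qed.

Lemma pair_ghostE e :
  pair_ghost (fst_half fct e) (snd_half fct e) = lpa_ghost k e.
Proof.
rewrite /pair_ghost (big_pred1 e) // => f.
apply/andP/eqP => [[/eqP h1 /eqP h2]|->]; first exact: half_inj h1 h2.
by rewrite !eqxx.
Qed.

(** Case analysis on whether r and s are composable. *)
Variant pair_spec r s : L -> L -> bool -> Prop :=
| PairEdge e of r = fst_half fct e & s = snd_half fct e :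
    pair_spec r s (lpa_edge k e) (lpa_ghost k e) true
| PairNone : pair_spec r s 0 0 false.

Lemma pairP r s :
  pair_spec r s (pair_edge r s) (pair_ghost r s) (brng r == bsrc s).
Proof.
case: eqP => [/(half_surj fct)[e [<- <-]]|rs].
  by rewrite pair_edgeE pair_ghostE; constructor.
have no e : (fst_half fct e == r) && (snd_half fct e == s) = false.
  by apply/andP => -[/eqP er /eqP es]; apply: rs; rewrite -er -es half_mid.
by rewrite /pair_edge /pair_ghost !big_pred0 //; constructor.
Qed.

Lemma pair_edge_rng r s : pair_edge r s * V (brng s) = pair_edge r s.
Proof.
by case: pairP => [e _ ->|]; rewrite ?mul0r // -(half_rng fct) lpa_edge_rngM.
Qed.

Lemma pair_ghost_rng r s : V (brng s) * pair_ghost r s = pair_ghost r s.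
Proof.
by case: pairP => [e _ ->|]; rewrite ?mulr0 // -(half_rng fct) lpa_rng_ghostM.
Qed.

Lemma vert_pair_edge v r s :
  V v * pair_edge r s = pair_edge r s *+ (v == bsrc r).
Proof.
case: pairP => [e -> _|]; last by rewrite mulr0 mul0rn.
rewrite -(half_src fct) -(lpa_src_edgeM k e) mulrA lpa_vertM.
by case: eqVneq => [->|_] //; rewrite mul0r.
Qed.

Lemma pair_ghost_src r s : pair_ghost r s * V (bsrc r) = pair_ghost r s.
Proof.
by case: pairP => [e -> _|]; rewrite ?mul0r // -(half_src fct) lpa_ghost_srcM.
Qed.

Lemma vert_src_pair_edge r s : V (bsrc r) * pair_edge r s = pair_edge r s.
Proof. by rewrite vert_pair_edge eqxx. Qed.

Lemma pair_ghost_edge r' s' r s :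
  pair_ghost r' s' * pair_edge r s =
  V (brng s) *+ [&& r' == r, s' == s & brng r == bsrc s].
Proof.
rewrite andbA.
case: (boolP ((r' == r) && (s' == s))) => [/andP[/eqP-> /eqP->]|ne].
  case: pairP => [e _ ->|]; last by rewrite mulr0.
  by rewrite lpa_ck1 eqxx -(half_rng fct).
case: (pairP r s) => [e er es|]; last by rewrite mulr0.
case: (pairP r' s') => [f fr fs|]; last by rewrite mul0r.
rewrite lpa_ck1; case: eqVneq => // fe.
by rewrite fr fs er es fe !eqxx in ne.
Qed.

(** The second Cuntz-Krieger relation at v, the edges leaving v being the
    composable pairs (r, s) with r leaving v. *)
Lemma sum_pair_edge_ghost v :
  \sum_(r | bsrc r == v) \sum_s pair_edge r s * pair_ghost r s = V v.
Proof.
pose G r s := if bsrc r == v then pair_edge r s * pair_ghost r s else 0.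
transitivity (\sum_r \sum_s G r s).
  rewrite big_mkcond; apply: eq_bigr => r _; rewrite /G.
  by case: eqP => // _; rewrite big1.
rewrite (factors_sum fct) => [|r s rs].
  rewrite lpa_ck2 [RHS]big_mkcond; apply: eq_bigr => e _.
  by rewrite /G -(half_src fct) pair_edgeE pair_ghostE.
by rewrite /G; move: rs; case: pairP => // _; rewrite mul0r if_same.
Qed.

Lemma sum_pair_edge_ghost1 :
  \sum_r \sum_s pair_edge r s * pair_ghost r s = 1.
Proof.
rewrite -[RHS]/(\sum_v lpa_vert k v) (partition_big (@bsrc _ _ R) predT) //=.
by apply: eq_bigr => v _; rewrite sum_pair_edge_ghost.
Qed.

Lemma homog_pair_edge r s : lpa_homog 1 (pair_edge r s).
Proof.
case: pairP => [e _ _|]; last exact: lpa_homog0.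
have /(_ _ isT) := @lpa_homog_mono k E (src e) [:: e] (rng e) [::].
rewrite /= eqxx /lpa_path /lpa_path_ghost big_nil big_seq1 mul1r => /(_ isT).
by rewrite -mulrA lpa_edge_rngM lpa_src_edgeM.
Qed.

Lemma homog_pair_ghost r s : lpa_homog (-1) (pair_ghost r s).
Proof.
case: pairP => [e _ _|]; last exact: lpa_homog0.
have /(_ isT) := @lpa_homog_mono k E (rng e) [::] (src e) [:: e].
rewrite /= eqxx /lpa_path /lpa_path_ghost big_nil big_seq1 mulr1 => /(_ isT).
by rewrite lpa_ghost_srcM lpa_rng_ghostM.
Qed.

End HalfEdges.

Lemma lpa_homog_vert (k : fieldType) (E : graph) (v : vert E) :
  lpa_homog 0 (lpa_vert k v).
Proof.
have := @lpa_homog_mono k E v [::] v [::] isT isT.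
by rewrite /lpa_path /lpa_path_ghost !big_nil mulr1 mul1r lpa_vertM eqxx.
Qed.

Lemma sum_delta (V : nmodType) (n : nat) (j : 'I_n) (G : 'I_n -> V) :
  \sum_i G i *+ (i == j) = G j.
Proof.
rewrite (bigD1 j) //= eqxx big1 ?addr0 // => i /negPf ij.
by rewrite ij.
Qed.

Section TransferFamily.
Variables (k : fieldType) (E F : graph).
Variables (R : bigraph (vert E) (vert F)) (S : bigraph (vert F) (vert E)).
Variables (fE : factors R S) (fF : factors S R).
Local Notation n := (bsize S).
Local Notation L := (lpa k E).
Local Notation V := (lpa_vert k).
Local Notation U := (pair_edge k fE).
Local Notation U' := (pair_ghost k fE).

(** The action of F on row vectors with one entry for each s : w -> v in S, this
    entry lying in the summand of an L_k(E)-module on which v is the identity. A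
    vertex w selects the positions s leaving w. An edge f = (s0, r0) takes the
    entry at s0 to the positions s composable with r0, acting there by the edge
    (r0, s) of E, and the ghost of f collects these entries back by means of the
    ghosts (r0, s)^*. *)
Definition transfer_vert (w : vert F) : 'M[L]_n :=
  \matrix_(s, t) (V (brng s) *+ ((s == t) && (bsrc s == w))).
Definition transfer_edge (f : edge F) : 'M[L]_n :=
  \matrix_(s, t) (U (snd_half fF f) t *+ (s == fst_half fF f)).
Definition transfer_ghost (f : edge F) : 'M[L]_n :=
  \matrix_(s, t) (U' (snd_half fF f) s *+ (t == fst_half fF f)).

Lemma transfer_vert_mul w (A : 'M[L]_n) s t :
  (transfer_vert w *m A) s t = V (brng s) * A s t *+ (bsrc s == w).
Proof.
rewrite mxE -[RHS](sum_delta s (fun i => V (brng i) * A i t *+ (bsrc i == w))).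
apply: eq_bigr => i _; rewrite mxE.
case: (eqVneq i s) => [->|_]; first by rewrite mulrnAl.
by rewrite mul0r.
Qed.

Lemma mul_transfer_vert w (A : 'M[L]_n) s t :
  (A *m transfer_vert w) s t = A s t * V (brng t) *+ (bsrc t == w).
Proof.
rewrite mxE -[RHS](sum_delta t (fun i => A s i * V (brng i) *+ (bsrc i == w))).
apply: eq_bigr => i _; rewrite mxE.
case: (eqVneq i t) => [->|_]; first by rewrite mulrnAr.
by rewrite mulr0.
Qed.

(** The first Cuntz-Krieger relation for f = (s0, r0) and g = (s1, r1) comes
    from that of E for (r0, s) and (r1, t). The second one at w is, at a
    position s leaving w, the relation of E at the end of s, where the sum runs
    over the edges (r, i) starting there. *)
Definition transfer_family : lpa_family F (mxalg k E n).
Proof.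
apply: (@LpaFamily _ _ (mxalg k E n)
  transfer_vert transfer_edge transfer_ghost).
- move=> v u; apply/matrixP => s t.
  rewrite [LHS](transfer_vert_mul v (transfer_vert u)) mulmxnE !mxE.
  rewrite mulrnAr lpa_vertM eqxx mulr1n -!mulrnA !mulnb -!andbA.
  case: eqVneq => //= _.
  by case: (eqVneq (bsrc s) v) => [->|_]; rewrite ?andbT ?andbF.
- move=> f; apply/matrixP => s t.
  rewrite [LHS](transfer_vert_mul (src f) (transfer_edge f)) !mxE.
  case: eqVneq => [->|_]; last by rewrite mulr0 mul0rn.
  by rewrite (half_src fF) eqxx (half_mid fF) vert_src_pair_edge.
- move=> f; apply/matrixP => s t.
  rewrite [LHS](mul_transfer_vert (rng f) (transfer_edge f)) !mxE.
  rewrite mulrnAl pair_edge_rng (half_rng fF) [bsrc t == _]eq_sym.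
  by case: pairP => [e _ _|]; rewrite ?mul0rn.
- move=> f; apply/matrixP => s t.
  rewrite [LHS](transfer_vert_mul (rng f) (transfer_ghost f)) !mxE.
  rewrite mulrnAr pair_ghost_rng (half_rng fF) [bsrc s == _]eq_sym.
  by case: pairP => [e _ _|]; rewrite ?mul0rn.
- move=> f; apply/matrixP => s t.
  rewrite [LHS](mul_transfer_vert (src f) (transfer_ghost f)) !mxE.
  case: eqVneq => [->|_]; last by rewrite mul0r mul0rn.
  by rewrite (half_src fF) eqxx (half_mid fF) pair_ghost_src.
- move=> f g; apply/matrixP => s t.
  rewrite [LHS]mxE mulmxnE mxE.
  under eq_bigr => i _ do rewrite !mxE mulrnAl.
  rewrite (sum_delta (fst_half fF f) (fun i => _ * (_ *+ (i == _)))).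
  rewrite mulrnAr pair_ghost_edge -!mulrnA !mulnb.
  case: (eqVneq f g) => [->|fg].
    rewrite !eqxx !andbT /= (half_rng fF) [bsrc s == _]eq_sym.
    by case: (eqVneq s t) => [->|].
  rewrite andbF; case: eqP => //= h2; case: (_ =P fst_half fF g) => [h1|_].
    by rewrite (half_inj h1 h2) eqxx in fg.
  by rewrite !andbF.
- move=> v; apply/matrixP => s t.
  pose G s' r := (\sum_i U r i * U' r i) *+
    [&& bsrc s' == v, brng s' == bsrc r, s == s' & t == s'].
  transitivity (\sum_s' \sum_r G s' r).
    rewrite mxE (bigD1 s) //= [X in _ + X]big1 ?addr0 => [|s' /negPf s's].
      rewrite -(sum_pair_edge_ghost k fE (brng s)) -sumrMnl [LHS]big_mkcond.
      apply: eq_bigr => r _; rewrite /G eqxx [t == s]eq_sym [bsrc r == _]eq_sym.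
      by case: eqVneq => _ /=; rewrite ?andbF // andbC.
    by rewrite big1 // => r _; rewrite /G [s == _]eq_sym s's !andbF.
  rewrite (factors_sum fF) => [|s' r /negPf sr]; last by rewrite /G sr !andbF.
  rewrite summxE [RHS]big_mkcond; apply: eq_bigr => f _.
  rewrite /G -(half_src fF) (half_mid fF) eqxx.
  case: eqVneq => // _; rewrite [RHS]mxE -sumrMnl; apply: eq_bigr => i _.
  by rewrite !mxE mulrnAr mulrnAl -mulrnA mulnb.
Defined.

End TransferFamily.

(** * Elementary strong shift equivalence of Leavitt path algebras *)

(* Keeps [/=] from unfolding a representation that is applied to an element. *)
Arguments rep_mx : simpl never.

Section RepSums.
Variables (R S : pzRingType) (rho : matRep R S).

Lemma rep0 : rho 0 = 0.
Proof. by apply: (addrI (rho 0)); rewrite -repD !addr0. Qed.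

Lemma rep_sum (I : Type) (r : seq I) (P : pred I) (G : I -> S) :
  rho (\sum_(i <- r | P i) G i) = \sum_(i <- r | P i) rho (G i).
Proof. exact: (big_morph rho (@repD _ _ rho) rep0). Qed.

Lemma rep_mulrn a m : rho (a *+ m) = rho a *+ m.
Proof. by elim: m => [|m IHm]; rewrite ?mulr0n ?rep0 // !mulrS repD IHm. Qed.

End RepSums.

Section Transfer.
Variables (k : fieldType) (E F : graph).
Variables (R : bigraph (vert E) (vert F)) (S : bigraph (vert F) (vert E)).
Variables (fE : factors R S) (fF : factors S R).

Definition transfer : matRep (lpa k E) (lpa k F) :=
  lpa_matrep (transfer_family k fE fF).

Lemma transfer_vertE w s t :
  transfer (lpa_vert k w) s t =
  lpa_vert k (brng s) *+ ((s == t) && (bsrc s == w)).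
Proof. by rewrite [transfer _]lpa_lift_vert mxE. Qed.

Lemma transfer_edgeE f s t :
  transfer (lpa_edge k f) s t =
  pair_edge k fE (snd_half fF f) t *+ (s == fst_half fF f).
Proof. by rewrite [transfer _]lpa_lift_edge mxE. Qed.

Lemma transfer_ghostE f s t :
  transfer (lpa_ghost k f) s t =
  pair_ghost k fE (snd_half fF f) s *+ (t == fst_half fF f).
Proof. by rewrite [transfer _]lpa_lift_ghost mxE. Qed.

Lemma transferZ c a s t : transfer (c *: a) s t = c *: transfer a s t.
Proof. exact: lpa_matrepZ. Qed.

Lemma transfer1E s t : transfer 1 s t = lpa_vert k (brng s) *+ (s == t).
Proof.
rewrite -[1]/(\sum_v lpa_vert k v) rep_sum summxE (bigD1 (bsrc s)) //=.
rewrite transfer_vertE eqxx andbT big1 ?addr0 // => v /negPf vs.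
by rewrite transfer_vertE [bsrc s == _]eq_sym vs andbF.
Qed.

Lemma transfer_deg1 s t : lpa_homog 0 (transfer 1 s t).
Proof.
rewrite transfer1E; case: eqP => _; [exact: lpa_homog_vert | exact: lpa_homog0].
Qed.

Lemma transfer_deg d a : lpa_homog d a ->
  forall s t, lpa_homog d (transfer a s t).
Proof.
apply: lpa_matrep_deg => [v|f|f] s t; rewrite mxE.
- by case: (_ && _); [exact: lpa_homog_vert | exact: lpa_homog0].
- by case: (_ == _); [exact: homog_pair_edge | exact: lpa_homog0].
- by case: (_ == _); [exact: homog_pair_ghost | exact: lpa_homog0].
Qed.

End Transfer.

Section TransferSplitting.
Variables (k : fieldType) (E F : graph).
Variables (R : bigraph (vert E) (vert F)) (S : bigraph (vert F) (vert E)).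
Variables (fE : factors R S) (fF : factors S R).
Local Notation rho := (transfer k fE fF).
Local Notation tau := (transfer k fF fE).
Local Notation u := (pair_edge k fE).
Local Notation v := (pair_ghost k fE).

(** The condition is closed under the operations of the algebra, so that it need
    only be checked on generators. *)
Definition intertwines (a : lpa k E) : Prop := forall r s,
  a * u r s = \sum_r' \sum_s' u r' s' * rho (tau a r' r) s' s.

Lemma intertwines_vert w : intertwines (lpa_vert k w).
Proof.
move=> r s; rewrite (bigD1 r) //= [X in _ + X]big1 ?addr0 => [|r' /negPf r'r].
  rewrite transfer_vertE eqxx andTb rep_mulrn.
  under eq_bigr => s' _ do rewrite mulmxnE transfer_vertE.
  rewrite (bigD1 s) //= big1 ?addr0 => [|s' /negPf s's]; last first.
    by rewrite s's mul0rn mulr0.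
  rewrite eqxx /= !mulrnAr pair_edge_rng vert_pair_edge [bsrc s == _]eq_sym.
  by rewrite [w == _]eq_sym; case: pairP => [e _ _|]; rewrite ?mul0rn.
rewrite big1 // => s' _; rewrite transfer_vertE r'r /= mulr0n rep0.
by rewrite mxE mulr0.
Qed.

Lemma intertwines_edge e : intertwines (lpa_edge k e).
Proof.
move=> r s; rewrite (bigD1 (fst_half fE e)) //=.
rewrite [X in _ + X]big1 ?addr0; last first.
  move=> r' /negPf r'e; rewrite big1 // => s' _.
  by rewrite transfer_edgeE r'e mulr0n rep0 mxE mulr0.
rewrite transfer_edgeE eqxx mulr1n.
transitivity (u (fst_half fE e) (snd_half fE e) * u r s *+
  (brng (snd_half fE e) == bsrc r)).
  rewrite pair_edgeE -(half_rng fE) -mulrnAr -vert_pair_edge mulrA.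
  by rewrite lpa_edge_rngM.
rewrite (bigD1 (snd_half fE e)) //= big1 ?addr0 => [|s' /negPf s'e].
  case: (@pairP k _ _ _ _ fF) => [f er es|]; last by rewrite rep0 mxE mulr0.
  by rewrite transfer_edgeE -er -es eqxx.
case: (@pairP k _ _ _ _ fF) => [f er es|]; last by rewrite rep0 mxE mulr0.
by rewrite transfer_edgeE -er s'e mulr0n mulr0.
Qed.

(** Both sides vanish unless e = (r, s); then the right side is the second
    Cuntz-Krieger relation at the end of s. *)
Lemma intertwines_ghost e : intertwines (lpa_ghost k e).
Proof.
move=> r s.
transitivity (lpa_vert k (brng (snd_half fE e)) *+
  ((r == fst_half fE e) && (s == snd_half fE e))).
  rewrite -(pair_ghostE k fE e) pair_ghost_edge.
  case: eqVneq => [<-|_] //=; case: eqVneq => [<-|_] //=.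
  by rewrite (half_mid fE) eqxx.
rewrite -(sum_pair_edge_ghost k fE) -sumrMnl [LHS]big_mkcond.
apply: eq_bigr => r' _; rewrite transfer_ghostE rep_mulrn.
rewrite [bsrc r' == _]eq_sym.
case: (@pairP k _ _ _ _ fF) => [f es er|]; last first.
  by rewrite rep0 mul0rn big1 // => s' _; rewrite mxE mulr0.
rewrite -sumrMnl; apply: eq_bigr => s' _.
by rewrite mulmxnE transfer_ghostE -es -er -!mulrnAr -mulrnA mulnb andbC.
Qed.

Lemma intertwinesD a b : intertwines a -> intertwines b -> intertwines (a + b).
Proof.
move=> ha hb r s; rewrite mulrDl ha hb -big_split; apply: eq_bigr => r' _.
rewrite -big_split; apply: eq_bigr => s' _ /=.
by rewrite repD mxE repD mxE mulrDr.
Qed.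

Lemma intertwinesZ c a : intertwines a -> intertwines (c *: a).
Proof.
move=> ha r s; rewrite -lpa_scaleMl ha scaler_sumr; apply: eq_bigr => r' _.
rewrite scaler_sumr; apply: eq_bigr => s' _.
by rewrite !transferZ lpa_scaleMr.
Qed.

Lemma intertwinesM a b : intertwines a -> intertwines b -> intertwines (a * b).
Proof.
move=> ha hb r s; rewrite -mulrA hb mulr_sumr.
under eq_bigr => r1 _ do rewrite mulr_sumr.
under eq_bigr => r1 _ do under eq_bigr => s1 _ do rewrite mulrA ha mulr_suml.
under eq_bigr => r1 _ do rewrite exchange_big /=.
rewrite exchange_big; apply: eq_bigr => r2 _ /=.
under eq_bigr => r1 _ do under eq_bigr => s1 _ do rewrite mulr_suml.
under eq_bigr => r1 _ do rewrite exchange_big /=.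
rewrite exchange_big; apply: eq_bigr => s2 _ /=.
rewrite repM mxE rep_sum summxE mulr_sumr; apply: eq_bigr => r1 _.
rewrite repM mxE mulr_sumr; apply: eq_bigr => s1 _.
by rewrite mulrA.
Qed.

Lemma transfer_splitting : @splitting _ _ rho tau u v.
Proof.
split=> [a||r' s' r s].
- rewrite -/(intertwines a); elim/lpa_ind: a => [|w|e|e|a b|c a|a b].
  + move=> r s; rewrite mul0r big1 // => r' _; rewrite big1 // => s' _.
    by rewrite rep0 mxE rep0 mxE mulr0.
  + exact: intertwines_vert.
  + exact: intertwines_edge.
  + exact: intertwines_ghost.
  + exact: intertwinesD.
  + exact: intertwinesZ.
  + exact: intertwinesM.
- exact: sum_pair_edge_ghost1.
- rewrite transfer1E rep_mulrn mulmxnE transfer_vertE pair_ghost_edge -mulrnA.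
  rewrite mulnb; case: (eqVneq r' r) => [->|_]; last by rewrite andbF.
  rewrite andbT; case: (eqVneq s' s) => [->|_] //=.
  by rewrite eq_sym.
Qed.

End TransferSplitting.

Lemma geGr_factors (k : fieldType) (E F : graph)
    (R : bigraph (vert E) (vert F)) (S : bigraph (vert F) (vert E)) :
  factors R S -> factors S R -> geGr (lpa_graded k E) (lpa_graded k F).
Proof.
move=> fE fF.
apply: (@geGr_splitting (lpa_graded k E) (lpa_graded k F) (transfer k fE fF)
  (transfer k fF fE) (pair_edge k fE) (pair_ghost k fE) (pair_edge k fF)
  (pair_ghost k fF)).
- exact: transfer_deg.
- exact: transfer_deg1.
- exact: transfer_deg.
- exact: transfer_deg1.
- exact: transfer_splitting.
- exact: transfer_splitting.
- exact: homog_pair_edge.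
- exact: homog_pair_ghost.
- exact: homog_pair_edge.
- exact: homog_pair_ghost.
Qed.

(** The isomorphism of G' F' with the identity is inserted between G and F. *)
Lemma nat_iso_sandwich (C D D' : category) (F : functor C D) (G : functor D C)
    (F' : functor D D') (G' : functor D' D) :
    nat_iso (functor_comp G F) (functor_id C) ->
    nat_iso (functor_comp G' F') (functor_id D) ->
  nat_iso (functor_comp (functor_comp G G') (functor_comp F' F)) (functor_id C).
Proof.
case=> /= t [/= u [/= ut tu tn]] [/= t' [/= u' [/= ut' tu' tn']]].
exists (fun a => cmp (t a) (fmor G (t' (F a)))),
  (fun a => cmp (fmor G (u' (F a))) (u a)); split=> /= [a|a|a b f].
- by rewrite cmpA -[cmp (cmp _ (u a)) _]cmpA ut cmpm1 -fmorM ut' fmor1.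
- by rewrite cmpA -[cmp (cmp (t a) _) _]cmpA -fmorM tu' fmor1 cmpm1 tu.
- by rewrite -cmpA -fmorM tn' fmorM cmpA tn -cmpA.
Qed.

Lemma geGr_trans (R S T : gradedRing) : geGr R S -> geGr S T -> geGr R T.
Proof.
case=> [Phi [Gam [gPhi gGam iR iS]]] [Phi' [Gam' [gPhi' gGam' iS' iT]]].
exists (functor_comp Phi' Phi), (functor_comp Gam Gam'); split.
- exact: graded_functor_comp.
- exact: graded_functor_comp.
- exact: nat_iso_sandwich.
- exact: nat_iso_sandwich.
Qed.

(** * From matrices to multigraphs *)

(** Two finite families over K whose fibers have the same size are in bijection
    over K: each fiber is matched with the fiber over the same key through the
    enumerations of both. *)
Section MatchFibers.
Variables (P Q K : finType) (p : P -> K) (q : Q -> K).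
Hypothesis cardE : forall c, #|{: {x | p x == c}}| = #|{: {y | q y == c}}|.

Let match_fiber c (x : {x | p x == c}) : {y | q y == c} :=
  enum_val (cast_ord (cardE c) (enum_rank x)).

Definition match_fibers (x : P) : Q :=
  val (match_fiber (exist _ x (eqxx (p x)) : {x' | p x' == p x})).

(* The key at which a fiber is taken may be replaced by an equal one; this lets
   two elements with the same key be compared within one fiber. *)
Let match_fibersE x c (px : p x == c) :
  match_fibers x = val (match_fiber (exist _ x px : {x' | p x' == c})).
Proof.
rewrite /match_fibers; have /eqP e := px; case: _ / e in px *.
by rewrite (bool_irrelevance px (eqxx (p x))).
Qed.

Lemma match_fibers_key x : q (match_fibers x) = p x.
Proof. by apply/eqP; exact: (valP (match_fiber _)). Qed.

Lemma match_fibers_inj : injective match_fibers.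
Proof.
move=> x y xy; have px : p x == p y by rewrite -!match_fibers_key xy.
move: xy; rewrite (match_fibersE px) (match_fibersE (eqxx (p y))).
by move/val_inj/enum_val_inj/cast_ord_inj/enum_rank_inj => [].
Qed.

Lemma match_fibers_surj y : exists x, match_fibers x = y.
Proof.
pose Y : {y' | q y' == q y} := exist _ y (eqxx (q y)).
pose X : {x | p x == q y} := enum_val (cast_ord (esym (cardE _)) (enum_rank Y)).
exists (val X); rewrite (match_fibersE (valP X)).
have -> : exist _ (val X) (valP X) = X by apply: val_inj.
by rewrite /match_fiber enum_valK cast_ordKV enum_rankK.
Qed.

End MatchFibers.

Section BigraphOfCounts.
Variables (V W : finType) (mu : V -> W -> nat).

Definition multi_edge := {p : V * W & 'I_(mu p.1 p.2)}.

Definition bigraph_of : bigraph V W :=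
  @Bigraph V W #|{: multi_edge}| (fun i => (tag (enum_val i)).1)
    (fun i => (tag (enum_val i)).2).

Lemma sum_multi_edge (f : V -> W -> nat) :
  (\sum_(x : multi_edge) f (tag x).1 (tag x).2 =
   \sum_v \sum_w mu v w * f v w)%N.
Proof.
rewrite pair_big /=.
transitivity (\sum_p \sum_(i : 'I_(mu p.1 p.2)) f p.1 p.2)%N.
  by rewrite sig_big_dep; apply: eq_bigl.
by apply: eq_bigr => p _; rewrite sum_nat_const card_ord.
Qed.

End BigraphOfCounts.

Definition edge_count (E : graph) (v w : vert E) : nat :=
  #|[set e : edge E | (src e == v) && (rng e == w)]|.

Lemma sum_bool_delta (I : finType) (i : I) (f : I -> nat) :
  (\sum_j f j * (j == i) = f i)%N.
Proof.
rewrite (bigD1 i) //= eqxx muln1 big1 ?addn0 // => j /negPf ji.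
by rewrite ji muln0.
Qed.

(** The composable pairs between v and v' number the sum over w of
    mu v w * nu w v', which is assumed to be the number of edges; the bijection
    is then obtained fiber by fiber over the pairs (v, v'). *)
Lemma factors_of_counts (E : graph) (W : finType)
    (mu : vert E -> W -> nat) (nu : W -> vert E -> nat) :
    (forall v v', edge_count v v' = (\sum_w mu v w * nu w v')%N) ->
  inhabited (factors (bigraph_of mu) (bigraph_of nu)).
Proof.
move=> counts.
pose comp : {pred multi_edge mu * multi_edge nu} :=
  fun t => (tag t.1).2 == (tag t.2).1.
pose Q : finType := {t in comp}.
pose key (t : Q) := ((tag (val t).1).1, (tag (val t).2).2).
pose ends (e : edge E) := (src e, rng e).
have cardE c : #|{: {e | ends e == c}}| = #|{: {t | key t == c}}|.
  rewrite !card_sig; case: c => v v'.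
  transitivity (edge_count v v').
    by rewrite /edge_count cardsE; apply: eq_card => e; rewrite !inE.
  rewrite counts.
  transitivity (\sum_(x : multi_edge mu) \sum_(y : multi_edge nu)
     ((tag y).1 == (tag x).2) * ((tag y).2 == v') * ((tag x).1 == v))%N.
    pose g a w := (\sum_w' \sum_a'
      nu w' a' * ((w' == w) * (a' == v') * (a == v)))%N.
    transitivity (\sum_(x : multi_edge mu) g (tag x).1 (tag x).2)%N; last first.
      apply: eq_bigr => x _.
      exact: esym (sum_multi_edge nu (fun w' a' =>
        (w' == (tag x).2) * (a' == v') * ((tag x).1 == v))%N).
    have gE a w : g a w = (nu w v' * (a == v))%N.
      rewrite -[RHS](sum_bool_delta w (fun w => nu w v' * (a == v))%N).
      apply: eq_bigr => w' _.
      rewrite -[RHS](sum_bool_delta v'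
        (fun a' => nu w' a' * (a == v) * (w' == w))%N).
      apply: eq_bigr => a' _; rewrite -!mulnA; congr (_ * _)%N.
      by rewrite !mulnA mulnC mulnA.
    rewrite sum_multi_edge exchange_big; apply: eq_bigr => w _ /=.
    rewrite -(sum_bool_delta v (fun a => mu a w * nu w v')%N).
    by apply: eq_bigr => a _; rewrite gE mulnA.
  rewrite pair_big /= -sum1_card.
  rewrite -[RHS](big_sub_cond comp
    (fun t => ((tag t.1).1, (tag t.2).2) == (v, v')) (fun=> 1%N)).
  rewrite [RHS]big_mkcond; apply: eq_bigr => -[x y] _.
  rewrite unfold_in /comp /= xpair_eqE eq_sym.
  by do 3!case: eqP.
pose phi := match_fibers cardE.
have phi_key e : key (phi e) = ends e by exact: match_fibers_key.
have srcE e : (tag (val (phi e)).1).1 = src e by have [] := phi_key e.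
have rngE e : (tag (val (phi e)).2).2 = rng e by have [] := phi_key e.
constructor.
apply: (@Factors E W (bigraph_of mu) (bigraph_of nu)
  (fun e => enum_rank (val (phi e)).1) (fun e => enum_rank (val (phi e)).2)).
- by move=> e; rewrite /= enum_rankK srcE.
- by move=> e; rewrite /= !enum_rankK; apply/eqP; apply: (valP (phi e)).
- by move=> e; rewrite /= enum_rankK rngE.
- move=> e f /enum_rank_inj h1 /enum_rank_inj h2.
  apply: (match_fibers_inj (cardE := cardE)); apply: val_inj.
  by rewrite [LHS]surjective_pairing [RHS]surjective_pairing h1 h2.
- move=> r s /= /eqP rs.
  have [e phie] := match_fibers_surj cardE
    (exist (fun t => t \in comp) (enum_val r, enum_val s) rs).
  by exists e; rewrite /phi phie /= !enum_valK.
Qed.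

(** * Strong shift equivalence *)

(** The numbering is left free: that of [adjmx] comes from the enumeration of
    the vertices, whereas the graph of a matrix has its vertices numbered from
    the outset. *)
Definition presents (E : graph) (A : sqmx) : Prop :=
  exists2 g : vert E -> 'I_(tag A), bijective g &
    forall v w, edge_count v w = tagged A (g v) (g w).

Lemma presents_adjmx (E : graph) :
  presents E (existT (fun p => 'M[nat]_p) #|vert E| (adjmx E)).
Proof.
exists enum_rank; first exact: enum_rank_bij.
by move=> v w; rewrite mxE !enum_rankK.
Qed.

(** The intermediate matrices of a chain are not given by graphs. *)
Definition matrix_graph (A : sqmx) : graph :=
  @Graph 'I_(tag A) {p : 'I_(tag A) * 'I_(tag A) & 'I_(tagged A p.1 p.2)}
    (fun e => (tag e).1) (fun e => (tag e).2).

Lemma presents_matrix_graph (A : sqmx) : presents (matrix_graph A) A.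
Proof.
exists id; first exact: (Bijective (g := id)).
move=> v w; rewrite /edge_count cardsE -sum1_card big_mkcond /=.
rewrite (sum_multi_edge (tagged A)
  (fun a b => if (a == v) && (b == w) then 1 else 0)%N).
rewrite -[RHS](sum_bool_delta v (fun v => tagged A v w)).
apply: eq_bigr => a _.
rewrite -[RHS](sum_bool_delta w (fun w => tagged A a w * (a == v))%N).
by apply: eq_bigr => b _; do 2!case: eqP; rewrite ?muln0 ?muln1.
Qed.

(** The end points of a chain are graphs given with a numbering of the vertices;
    the entries of R and S are pulled back along it. *)
Lemma elementary_factors (E F : graph) (A B : sqmx) :
    presents E A -> presents F B -> elementary_sse A B ->
  exists (R : bigraph (vert E) (vert F)) (S : bigraph (vert F) (vert E)),
    inhabited (factors R S) /\ inhabited (factors S R).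
Proof.
case=> g gbij gE [h hbij hE] [R [S [AE BE]]].
exists (bigraph_of (fun v w => R (g v) (h w))),
  (bigraph_of (fun w v => S (h w) (g v))).
split; apply: factors_of_counts => v v'.
- rewrite gE AE mxE (reindex h) //; exact: onW_bij.
- rewrite hE BE mxE (reindex g) //; exact: onW_bij.
Qed.

(** A = A 1 and A = 1 A. This turns a chain of length zero into a single step,
    as is needed for the exponent n to be positive. *)
Lemma elementary_sse_refl (A : sqmx) : elementary_sse A A.
Proof.
exists (tagged A), 1%:M; split; [by rewrite mulmx1 | by rewrite mul1mx].
Qed.

(** Steps are added at the start of the chain, so that nothing is required of P
    for two chains to be joined; this is the form in which [aligned_cons] is
    proved. *)
Lemma sse_chain (P : graph -> graph -> Prop) :
    (forall (E F : graph) (R : bigraph (vert E) (vert F))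
       (S : bigraph (vert F) (vert E)), factors R S -> factors S R -> P E F) ->
    (forall (E F G : graph) (R : bigraph (vert E) (vert F))
       (S : bigraph (vert F) (vert E)),
       factors R S -> factors S R -> P F G -> P E G) ->
  forall E F : graph, strong_shift_equivalent (adjmx E) (adjmx F) -> P E F.
Proof.
move=> base step E F [N [C [C0 CN chain]]].
have {C0} : presents E (C 0%N) by rewrite C0; apply: presents_adjmx.
have {CN} : presents F (C N) by rewrite CN; apply: presents_adjmx.
elim: N C E chain => [|N IHN] C E chain FC EC.
  have [R [S [[fE] [fF]]]] := elementary_factors EC FC (elementary_sse_refl _).
  exact: base fE fF.
have GC := presents_matrix_graph (C 1%N).
have [R [S [[fE] [fF]]]] := elementary_factors EC GC (chain 0%N isT).
apply: step fE fF _.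
exact: (IHN (fun i => C i.+1)) (fun i => chain i.+1) FC GC.
Qed.

Theorem proposition6p9 (k : fieldType) (E F : graph)
    (hE : no_sinks E) (hF : no_sinks F)
    (hEF : strong_shift_equivalent (adjmx E) (adjmx F)) :
  (exists (M : bimod (kE0 k E) (kE0 k F)) (N : bimod (kE0 k F) (kE0 k E))
      (n : nat)
      (omegaE : bimodIso (M \ox N) (tpow (kE1 k E) n))
      (omegaF : bimodIso (N \ox M) (tpow (kE1 k F) n))
      (sigmaM : bimodIso (kE1 k E \ox M) (M \ox kE1 k F))
      (sigmaN : bimodIso (kE1 k F \ox N) (N \ox kE1 k E)),
    [/\ (0 < n)%N,
        tens_iso omegaE (biso_id (kE1 k E)) \o sharp sigmaM sigmaN =1
          nu (kE1 k E) n \o tens_iso (biso_id (kE1 k E)) omegaE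
      & tens_iso omegaF (biso_id (kE1 k F)) \o sharp sigmaN sigmaM =1
          nu (kE1 k F) n \o tens_iso (biso_id (kE1 k F)) omegaF])
  /\ graded_morita_equivalent (lpa_graded k E) (lpa_graded k F).
Proof.
split.
- move: E F hEF {hE hF}.
  apply: (sse_chain (P := fun E F => aligned (kE1 k E) (kE1 k F))).
  + by move=> E F R S; apply: aligned_factors.
  + move=> E F G R S fE fF.
    exact: aligned_cons (factor_iso k fE) (factor_iso k fF).
- right; move: E F hEF {hE hF}.
  apply: (sse_chain (P := fun E F => geGr (lpa_graded k E) (lpa_graded k F))).
  + by move=> E F R S; apply: geGr_factors.
  + move=> E F G R S fE fF; apply: geGr_trans; exact: geGr_factors fE fF.
Qed.
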